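(* Let $P=P^F_{m,k}$, $L$, $\overline{L}$ be as in the context. There is a neighborhood $V$ of the origin in $U\times\mathbb{R}$ such that for every $s\in\mathbb{R}$ and every $N>0$ there is a constant $C=C_{s,N}$, locally uniform in $s$, such that for all $v\in C_0^\infty(V)$, $$\|v\|^2_{s-\frac{k-1}{2m}}+\|\overline{L}v\|_s^2+\|\bar z^{\,k}Lv\|_s^2\ \leq\ C\left(|(Pv,v)_s|+\|v\|_{-N}^2\right).$$
   Context: Let $m,k\geq 1$ be integers, and let $U\subset\mathbb{C}$ be an open neighborhood of $0$. Points of $U\times\mathbb{R}$ are written $(z,t)$; $\partial_z,\partial_{\bar z}$ are the usual Wirtinger derivatives, and subscripts on functions denote derivatives. Let $F=F(z,\bar z)$ be a smooth real-valued function on $U$ (independent of $t$) such that $$F_{z\bar z}=|z|^{2(m-1)}g,\qquad F_z=\bar z|z|^{2(m-1)}h,$$ with $g,h$ smooth on $U$ and $g(0)\neq 0$; $U$ is taken small enough that $g$ does not vanish on $U$. Define $$L=\frac{\partial}{\partial z}+iF_z\frac{\partial}{\partial t},\qquad \overline{L}=\frac{\partial}{\partial\bar z}-iF_{\bar z}\frac{\partial}{\partial t},\qquad P=P^F_{m,k}=L\overline{L}+\overline{L}\,|z|^{2k}L .$$ All norms and inner products are those of $L^2$ in $z$ and $H^s$ in $t$: $(v,w)_s=\int_{\mathbb{C}}\int_{\mathbb{R}}(1+\tau^2)^{s}\,\hat v(z,\tau)\overline{\hat w(z,\tau)}\,d\tau\,dA(z)$, where $\hat{\ }$ is the Fourier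 transform in $t$ only and $dA$ is Lebesgue measure, and $\|v\|_s^2=(v,v)_s$. *)

(* Defs.v *)
From HB Require Import structures.
From mathcomp Require Import all_boot all_order all_algebra.
From mathcomp Require Import complex.
From mathcomp Require Import all_classical all_reals all_analysis.
Set Implicit Arguments.
Unset Strict Implicit.
Unset Printing Implicit Defensive.
Import Order.TTheory GRing.Theory Num.Theory numFieldNormedType.Exports.
Local Open Scope classical_set_scope.
Local Open Scope ring_scope.
Local Open Scope complex_scope.

(* The type R[i] carries no real normed-space or measurable structure, so as a
   domain the complex plane is R * R, with (x, y) standing for x + i y, and
   C x R is (R * R) * R; R[i] is used for values only. *)

Definition toC {R : realType} (z : R * R) : R[i] := z.1 +i* z.2.

Section Smoothness.
Variables (R : realType) (E : normedModType R).

(* In finite dimension, f is of class C^(n+1) on an open set iff it is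
   differentiable there and all its directional derivatives are C^n. *)
Fixpoint classC (n : nat) (A : set E) (f : E -> R) : Prop :=
  match n with
  | 0 => forall x, A x -> {for x, continuous f}
  | n'.+1 => (forall x, A x -> differentiable f x) /\
             (forall u : E, classC n' A (fun x => 'D_u f x))
  end.

Definition smooth_on (A : set E) (f : E -> R) : Prop :=
  forall n, classC n A f.

Definition csmooth_on (A : set E) (f : E -> R[i]) : Prop :=
  smooth_on A (fun x => complex.Re (f x)) /\
  smooth_on A (fun x => complex.Im (f x)).

Definition test_function (V : set E) (v : E -> R[i]) : Prop :=
  [/\ csmooth_on setT v,
      compact (closure [set p | v p != 0]) &
      closure [set p | v p != 0] `<=` V].

Definition cderive (f : E -> R[i]) (x u : E) : R[i] :=
  'D_u (fun y => complex.Re (f y)) x +i* 'D_u (fun y => complex.Im (f y)) x.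

End Smoothness.

Section Operators.
Variable R : realType.

Definition dz (f : R * R -> R[i]) (z : R * R) : R[i] :=
  (cderive f z (1, 0) - 'i%C * cderive f z (0, 1)) / 2.

Definition dzbar (f : R * R -> R[i]) (z : R * R) : R[i] :=
  (cderive f z (1, 0) + 'i%C * cderive f z (0, 1)) / 2.

Definition dt (v : (R * R) * R -> R[i]) (p : (R * R) * R) : R[i] :=
  cderive (fun t : R => v (p.1, t)) p.2 1.

Definition ofreal (F : R * R -> R) : R * R -> R[i] := fun z => (F z)%:C.

Definition opL (F : R * R -> R) (v : (R * R) * R -> R[i]) :
    (R * R) * R -> R[i] := fun p =>
  dz (fun z => v (z, p.2)) p.1 + 'i%C * dz (ofreal F) p.1 * dt v p.

Definition opLbar (F : R * R -> R) (v : (R * R) * R -> R[i]) :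
    (R * R) * R -> R[i] := fun p =>
  dzbar (fun z => v (z, p.2)) p.1 - 'i%C * dzbar (ofreal F) p.1 * dt v p.

Definition opP (k : nat) (F : R * R -> R) (v : (R * R) * R -> R[i]) :
    (R * R) * R -> R[i] := fun p =>
  opL F (opLbar F v) p +
  opLbar F (fun q => `|toC q.1| ^+ (2 * k) * opL F v q) p.

End Operators.

Section SobolevNorms.
Variable R : realType.

Definition cintegral d (T : measurableType d) (mu : {measure set T -> \bar R})
    (f : T -> R[i]) : R[i] :=
  (\int[mu]_x complex.Re (f x))%R +i* (\int[mu]_x complex.Im (f x))%R.

Definition lebesgueR : {measure set (measurableTypeR R) -> \bar R} :=
  @lebesgue_measure R.

Definition lebesgueC :
    {measure set (measurableTypeR R * measurableTypeR R) -> \bar R} :=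
  (@lebesgue_measure R \x @lebesgue_measure R)%E.

Definition expi (theta : R) : R[i] := cos theta +i* sin theta.

(* Another normalization of the Fourier transform would multiply every inner
   product below by the same positive constant. *)
Definition fourier_t (v : (R * R) * R -> R[i]) (z : R * R) (tau : R) : R[i] :=
  cintegral lebesgueR (fun t => expi (- (tau * t)) * v (z, t)).

Definition innerHs (s : R) (v w : (R * R) * R -> R[i]) : R[i] :=
  cintegral lebesgueC (fun z => cintegral lebesgueR (fun tau =>
    ((1 + tau ^+ 2) `^ s)%:C * fourier_t v z tau * (fourier_t w z tau)^*)).

Definition normHs2 (s : R) (v : (R * R) * R -> R[i]) : R :=
  complex.Re (innerHs s v v).

End SobolevNorms.

(* Main.v *)
Require Import Defs.
From HB Require Import structures.
From mathcomp Require Import all_boot all_order all_algebra.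
From mathcomp Require Import complex ring lra.
From mathcomp Require Import all_classical all_reals all_analysis.
From mathcomp Require Import measurable_realfun.
Set Implicit Arguments.
Unset Strict Implicit.
Unset Printing Implicit Defensive.
Import Order.TTheory GRing.Theory Num.Theory numFieldNormedType.Exports.
Local Open Scope classical_set_scope.
Local Open Scope ring_scope.
Local Open Scope complex_scope.

(** Fix a frequency tau and write w for the Fourier transform of v in t at tau.
There L acts as B = d/dz - tau F_z and its conjugate acts as
A = d/dzbar + tau F_zbar; on functions with bounded support A* = - B.  Hence
[energy_identity]
    Re (Pv, v) = - (|A w|^2 + |zbar^k B w|^2),
with L^2 norms in z, which already bounds the last two terms on the left of
the estimate.  What remains is to bound |w|^2 by the same two norms, at the
cost of a factor |tau|^((k-1)/m).  Two facts are used.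

- [commutator]  |B w|^2 - |A w|^2 = (tau/2) * integral of (lap F) |w|^2, and
  lap F = 4 |z|^(2(m-1)) Re g.  As F is real, so is F_(z zbar); therefore g is
  real at every nonzero point, thus at 0 by continuity, and near the origin
  lap F does not change sign and has the exact size |z|^(2(m-1))
  [curvature_sign].

- [poincare]  |w|^2 <= lam * integral of |z|^2 |w|^2
  + (2 lam)^-1 (|A w|^2 + |B w|^2) for all lam > 0: the uncertainty principle
  for z and d/dz.

When tau has the sign opposite to that of lap F, the commutator gives
|B w| <= |A w|; since |z| is small on the support, a fixed lam gives
|w|^2 <= 8 |A w|^2.

When the signs agree, B w is controlled only up to the commutator term, and
zbar^k B w has to be used.  Multiplication by zbar^k commutes with B, so the
commutator identity for zbar^k w gives
    2 c |tau| * integral of |z|^(2(m-1+k)) |w|^2 <= |zbar^k B w|^2.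
Put om = |tau|^(1/m), x = om |z|^2, and take lam = a om.  The two error terms
of the uncertainty principle are then the integrals of a x |w|^2 and
(C/a) x^(m-1) |w|^2, and for a suitable constant a the elementary bound
    a x + (C/a) x^(m-1) <= 1/2 + D x^(m-1+k)      [weight_bound]
absorbs one half of |w|^2 and leaves a multiple of om^(m-1+k) times the
integral above, that is of om^(k-1) |zbar^k B w|^2.  This is [key_estimate].

Multiplying by (1 + tau^2)^(s - (k-1)/(2m)) and integrating over |tau| >= 1
gives the theorem [frequency_estimate, sobolev_estimate]; for |tau| <= 1 all
the weights are comparable to each other, which is where the norm of
order -N enters, and where the constant 2^|s - (k-1)/(2m) + N| comes from.

Everything is carried out on real and imaginary parts.  The functions L v and
P v are not treated as smooth test functions: the bookkeeping only records
that they are continuous, vanish off the support of v, may be differentiated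
in t indefinitely with the same properties, and in z as often as needed.
That is enough for rapid decay in tau, for integration by parts in z, and for
Fubini. *)

(** * Measurability and integrability *)

(** A function measurable in one variable and continuous in the other is jointly
measurable: it is the limit of its values at the grid points just below the
second variable.  This makes separately regular functions available to
Fubini. *)
Lemma caratheodory_measurable d (X : measurableType d) (R : realType)
    (f : X * measurableTypeR R -> R) :
  (forall y, measurable_fun setT (fun x => f (x, y))) ->
  (forall x, continuous (fun y : R => f (x, y))) ->
  measurable_fun setT f.
Proof.
move=> mf cf.
pose r (n : nat) (y : R) : R := (Num.floor (y * n.+1%:R))%:~R / n.+1%:R.
apply: (@measurable_fun_cvg _ _ _ setT (fun n p => f (p.1, r n p.2))).
  move=> n _ Y mY; rewrite setTI.
  have -> : (fun p => f (p.1, r n p.2)) @^-1` Y =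
    \bigcup_(k : int) (((fun x => f (x, k%:~R / n.+1%:R)) @^-1` Y) `*`
       [set` `[k%:~R / n.+1%:R, (k + 1)%:~R / n.+1%:R[ ]).
    have n0 : 0 < n.+1%:R :> R by [].
    apply/seteqP; split=> [[x y] /= Yxy|[x y] [k _ [/= Yxk]]].
      exists (Num.floor (y * n.+1%:R)) => //; split => //=.
      rewrite in_itv/= ler_pdivrMr// ltr_pdivlMr//.
      by rewrite floor_le floorD1_gt.
    rewrite in_itv/= ler_pdivrMr// ltr_pdivlMr// => /andP[h1 h2].
    suff -> : r n y = k%:~R / n.+1%:R by [].
    by rewrite /r; congr (_%:~R / _); apply/floor_def; rewrite h1.
  apply: countable_bigcupT_measurable => // k; apply: measurableX.
    by have := mf (k%:~R / n.+1%:R) measurableT Y mY; rewrite setTI.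
  exact: measurable_itv.
move=> [x y] _ /=; apply: (cvg_comp (r ^~ y) (fun y' => f (x, y'))); last first.
  exact: cf.
apply/cvgrPdist_le => e e0; near=> n.
have n0 : 0 < n.+1%:R :> R by [].
have -> : y - r n y = (y * n.+1%:R - (Num.floor (y * n.+1%:R))%:~R) / n.+1%:R.
  by rewrite /r mulrBl mulfK// lt0r_neq0.
rewrite ger0_norm; last first.
  by rewrite divr_ge0// subr_ge0 floor_le.
rewrite ler_pdivrMr// (@le_trans _ _ 1)//.
  by rewrite lerBlDr addrC -intrD1 ltW// floorD1_gt.
rewrite -ler_pdivrMl// mulr1.
near: n; exists (Num.truncn (e^-1)) => // n /= hn.
rewrite (le_trans (ltW (truncnS_gt _)))// ler_nat ltnS//.
Unshelve. all: end_near. Qed.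

Lemma bounded_support_integrable d (T : measurableType d) (R : realType)
    (mu : {measure set T -> \bar R}) (f : T -> R) (A : set T) (M : R) :
  measurable A -> (mu A < +oo)%E -> measurable_fun setT f ->
  (forall x, `|f x| <= M) -> (forall x, ~ A x -> f x = 0) ->
  mu.-integrable setT (EFin \o f).
Proof.
move=> mA Aoo mf fM f0.
have -> : EFin \o f = (EFin \o f) \_ A.
  apply/funext => x; rewrite patchE /=; case: ifPn => // /negP xA.
  by rewrite f0// => Ax; apply: xA; rewrite inE.
apply/(integrable_mkcond _ _).1 => //.
apply: measurable_bounded_integrable => //; first exact: measurable_funTS.
exists `|M|; split=> [|y My x Ax]; first by rewrite num_real.
by rewrite /= (le_trans (fM x))// (le_trans (ler_norm _))// ltW.
Qed.

Section Line.
Variable R : realType.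
Implicit Types f : R -> R.

(** Functions cut off by the support of a test function are zero, hence
differentiable, on the open complement of that support, whatever happens to
their coefficients there. *)
Lemma derive_off_support (V : normedModType R) (g : V -> R) (A : set V) (a v : V) :
  open A -> A a -> (forall x, A x -> g x = 0) -> is_derive a v g 0.
Proof.
move=> oA Aa g0; apply: (@near_eq_is_derive _ _ _ (cst 0)).
by apply: filterS (open_nbhs_nbhs (conj oA Aa)) => x Ax; rewrite g0.
Qed.

Lemma open_outside (M : R) : open [set x : R | M < `|x|].
Proof.
have -> : [set x : R | M < `|x|] = Num.norm @^-1` [set y | M < y] by [].
by apply: open_comp; [move=> x _; exact: norm_continuous|exact: open_gt].
Qed.

Lemma integral_derive0 f (M : R) : (forall x, derivable f x 1) ->
  continuous (fun x => 'D_1 f x) -> (forall x, M < `|x| -> f x = 0) ->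
  \int[lebesgueR R]_x 'D_1 f x = 0.
Proof.
move=> df cf f0.
have Df0 x : M < `|x| -> 'D_1 f x = 0.
  by move=> Mx; have [_ ->] := @derive_off_support R f _ x 1 (@open_outside M) Mx f0.
pose N := `|M| + 1.
have MN : M < N by rewrite /N (le_lt_trans (ler_norm _))// ltrDl.
have N0 : 0 < N by rewrite /N ltr_wpDl.
have -> : \int[lebesgueR R]_x 'D_1 f x = \int[lebesgueR R]_(x in `[-N, N]) 'D_1 f x.
  rewrite [RHS]Rintegral_mkcond; apply: eq_Rintegral => x _.
  rewrite patchE; case: ifPn => // /negP xN; apply: Df0.
  rewrite (lt_le_trans MN)// leNgt; apply/negP => xN'; apply: xN.
  by rewrite inE/= in_itv/=; move: xN'; rewrite ltr_norml => /andP[/ltW -> /ltW ->].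
have NN : - N < N by rewrite gtrN.
rewrite /Rintegral (@continuous_FTC2 _ (fun x => 'D_1 f x) f _ _ NN).
- by rewrite !f0 ?normrN ?gtr0_norm// -EFinB/= subrr.
- exact: continuous_subspaceT.
- split.
  + by move=> x _; exact: df.
  + by apply: cvg_at_right_filter; apply: differentiable_continuous; exact/derivable1_diffP.
  + by apply: cvg_at_left_filter; apply: differentiable_continuous; exact/derivable1_diffP.
- by move=> x _; rewrite derive1E.
Qed.

End Line.

Lemma continuous_pairl (T S : topologicalType) (y : S) : continuous (fun x : T => (x, y)).
Proof. by move=> x; apply: cvg_pair; [exact: cvg_id|exact: cvg_cst]. Qed.

Lemma continuous_pairr (T S : topologicalType) (x : T) : continuous (fun y : S => (x, y)).
Proof. by move=> y; apply: cvg_pair; [exact: cvg_cst|exact: cvg_id]. Qed.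

(** * Integration over the plane *)

Section Plane.
Variable R : realType.
Implicit Types f g : R * R -> R.

Definition e1 : R * R := (1, 0).
Definition e2 : R * R := (0, 1).

Lemma growth1 f x y : (fun h : R => h^-1 *: (f (h *: e1 + (x, y)) - f (x, y))) =
  (fun h : R => h^-1 *: (f (h *: 1 + x, y) - f (x, y))).
Proof.
by apply/funext => h; congr (_ *: (f _ - _)); congr (_, _) => /=; rewrite scaler0 add0r.
Qed.

Lemma growth2 f x y : (fun h : R => h^-1 *: (f (h *: e2 + (x, y)) - f (x, y))) =
  (fun h : R => h^-1 *: (f (x, h *: 1 + y) - f (x, y))).
Proof.
by apply/funext => h; congr (_ *: (f _ - _)); congr (_, _) => /=; rewrite scaler0 add0r.
Qed.

Lemma derive_e1 f x y : 'D_e1 f (x, y) = 'D_1 (fun x' => f (x', y)) x.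
Proof. by rewrite /derive growth1. Qed.

Lemma derive_e2 f x y : 'D_e2 f (x, y) = 'D_1 (fun y' => f (x, y')) y.
Proof. by rewrite /derive growth2. Qed.

Lemma derivable_e1 f x y : derivable f (x, y) e1 -> derivable (fun x' => f (x', y)) x 1.
Proof. by rewrite /derivable growth1. Qed.

Lemma derivable_e2 f x y : derivable f (x, y) e2 -> derivable (fun y' => f (x, y')) y 1.
Proof. by rewrite /derivable growth2. Qed.

Definition box (M : R) : set (R * R) := [set z | `|z.1| <= M /\ `|z.2| <= M].

(** Separate continuity is what differentiation under the integral sign
delivers, and with bounds and bounded support it suffices for
integrability. *)
Definition plane0 f :=
  [/\ forall y, continuous (fun x => f (x, y)),
      forall x, continuous (fun y => f (x, y)) &
      exists M, forall z, `|f z| <= M /\ (~ box M z -> f z = 0)].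

Definition plane1 f := [/\ plane0 f, plane0 ('D_e1 f), plane0 ('D_e2 f) &
  forall z, derivable f z e1 /\ derivable f z e2].

Lemma boxE M : box M = `[-M, M] `*` `[-M, M].
Proof.
by apply/seteqP; split=> -[x y]; rewrite /box /= !in_itv/= !ler_norml.
Qed.

Lemma measurable_box M : measurable (box M : set (measurableTypeR R * measurableTypeR R)).
Proof. by rewrite boxE; apply: measurableX; exact: measurable_itv. Qed.

Lemma lebesgueC_box M : (lebesgueC R (box M) < +oo)%E.
Proof.
rewrite boxE; have -> : lebesgueC R (`[-M, M] `*` `[-M, M]) =
    (@lebesgue_measure R `[(- M)%R, M] * @lebesgue_measure R `[(- M)%R, M])%E.
  by apply: product_measure1E; exact: measurable_itv.
by rewrite lebesgue_measure_itv; case: ifPn => _; rewrite ?mule0 -?EFinB -?EFinM ltry.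
Qed.

Lemma box_le M N : M <= N -> box M `<=` box N.
Proof. by move=> MN z [z1 z2]; split; exact: le_trans MN. Qed.

Lemma plane0_measurable f : plane0 f -> measurable_fun setT (f : measurableTypeR R * measurableTypeR R -> R).
Proof.
move=> [c1 c2 _]; apply: caratheodory_measurable => //.
by move=> y; exact: continuous_measurable_fun (c1 y).
Qed.

Lemma plane0_integrable f : plane0 f -> (lebesgueC R).-integrable setT (EFin \o f).
Proof.
move=> Hf; have [_ _ [M fM]] := Hf.
apply: (bounded_support_integrable (measurable_box M) (lebesgueC_box M) (plane0_measurable Hf)).
  by move=> z; exact: (fM z).1.
by move=> z; exact: (fM z).2.
Qed.

Lemma plane0D f g : plane0 f -> plane0 g -> plane0 (fun z => f z + g z).
Proof.
move=> [f1 f2 [M fM]] [g1 g2 [N gN]]; split.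
- by move=> y x; apply: continuousD; [exact: f1|exact: g1].
- by move=> x y; apply: continuousD; [exact: f2|exact: g2].
have M0 : 0 <= M := le_trans (normr_ge0 _) (fM (0, 0)).1.
have N0 : 0 <= N := le_trans (normr_ge0 _) (gN (0, 0)).1.
exists (M + N) => z; have [fz fz0] := fM z; have [gz gz0] := gN z; split.
  by rewrite (le_trans (ler_normD _ _))// lerD.
move=> zMN; rewrite fz0 ?gz0 ?addr0// => h; apply: zMN; apply: box_le h.
  by rewrite lerDr.
by rewrite lerDl.
Qed.

Lemma plane0M f g : plane0 f -> plane0 g -> plane0 (fun z => f z * g z).
Proof.
move=> [f1 f2 [M fM]] [g1 g2 [N gN]]; split.
- by move=> y x; apply: continuousM; [exact: f1|exact: g1].
- by move=> x y; apply: continuousM; [exact: f2|exact: g2].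
have M0 : 0 <= M := le_trans (normr_ge0 _) (fM (0, 0)).1.
have N0 : 0 <= N := le_trans (normr_ge0 _) (gN (0, 0)).1.
exists (M * N + M) => z; have [fz fz0] := fM z; have [gz gz0] := gN z; split.
  by rewrite normrM ler_wpDr// ler_pM.
move=> zMN; rewrite fz0 ?mul0r// => h; apply: zMN; apply: box_le h.
by rewrite lerDr mulr_ge0.
Qed.

Lemma plane0_continuous_mul (c f : R * R -> R) : continuous c -> plane0 f -> plane0 (fun z => c z * f z).
Proof.
move=> cc [f1 f2 [M fM]]; split.
- move=> y x; apply: continuousM; last exact: f1.
  apply: (@continuous_comp _ _ _ (fun x => (x, y)) c); last exact: cc.
  exact: continuous_pairl.
- move=> x y; apply: continuousM; last exact: f2.
  apply: (@continuous_comp _ _ _ (fun y => (x, y)) c); last exact: cc.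
  exact: continuous_pairr.
have M0 : 0 <= M := le_trans (normr_ge0 _) (fM (0, 0)).1.
have cbox : compact (box M).
  by rewrite boxE; apply: compact_setX; exact: segment_compact.
have : compact (c @` box M) by apply: continuous_compact => //; exact: continuous_subspaceT.
move=> /compact_bounded[N [_ /(_ (`|N| + 1))]].
rewrite (le_lt_trans (ler_norm _)) ?ltrDl// => /(_ isT) cN.
exists ((`|N| + 1) * M + M) => z; have [fz fz0] := fM z; split.
  rewrite normrM; have [zM|zM] := pselect (box M z).
    by rewrite ler_wpDr// ler_pM//; apply: cN; exists z.
  by rewrite fz0// normr0 mulr0 addr_ge0// mulr_ge0// addr_ge0.
move=> zMN; rewrite fz0 ?mulr0// => h; apply: zMN; apply: box_le h.
by rewrite lerDr mulr_ge0// addr_ge0.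
Qed.

Lemma plane0Z (k : R) f : plane0 f -> plane0 (fun z => k * f z).
Proof. by move=> Hf; apply: plane0_continuous_mul => // z; exact: cvg_cst. Qed.

End Plane.
Arguments e1 {R}.
Arguments e2 {R}.

Section PlaneIntegral.
Variable R : realType.
Implicit Types f g : R * R -> R.

Definition plane_int f : R := \int[lebesgueC R]_z f z.

Lemma plane_intD f g : plane0 f -> plane0 g -> plane_int (fun z => f z + g z) = plane_int f + plane_int g.
Proof. by move=> Hf Hg; rewrite /plane_int RintegralD//; exact: plane0_integrable. Qed.

Lemma plane_intZ k f : plane0 f -> plane_int (fun z => k * f z) = k * plane_int f.
Proof. by move=> Hf; rewrite /plane_int RintegralZl//; exact: plane0_integrable. Qed.

Lemma plane_int_le f g : plane0 f -> plane0 g -> (forall z, f z <= g z) -> plane_int f <= plane_int g.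
Proof.
by move=> Hf Hg fg; apply: le_Rintegral => //; exact: plane0_integrable.
Qed.

Lemma plane_int_ge0 f : (forall z, 0 <= f z) -> 0 <= plane_int f.
Proof. by move=> f0; apply: Rintegral_ge0. Qed.

Lemma eq_plane_int f g : (forall z, f z = g z) -> plane_int f = plane_int g.
Proof. by move=> fg; congr plane_int; apply/funext. Qed.

Lemma plane1_plane0 f : plane1 f -> plane0 f. Proof. by case. Qed.
Lemma plane1_D1 f : plane1 f -> plane0 ('D_e1 f). Proof. by case. Qed.
Lemma plane1_D2 f : plane1 f -> plane0 ('D_e2 f). Proof. by case. Qed.

Lemma plane1M_D1 f g z : plane1 f -> plane1 g ->
  'D_e1 (fun z => f z * g z) z = 'D_e1 f z * g z + f z * 'D_e1 g z.
Proof.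
move=> [_ _ _ /(_ z)[df _]] [_ _ _ /(_ z)[dg _]].
by have := deriveM df dg; rewrite addrC /GRing.scale/= [g z * _]mulrC => <-.
Qed.

Lemma plane1M_D2 f g z : plane1 f -> plane1 g ->
  'D_e2 (fun z => f z * g z) z = 'D_e2 f z * g z + f z * 'D_e2 g z.
Proof.
move=> [_ _ _ /(_ z)[_ df]] [_ _ _ /(_ z)[_ dg]].
by have := deriveM df dg; rewrite addrC /GRing.scale/= [g z * _]mulrC => <-.
Qed.

Lemma plane1M f g : plane1 f -> plane1 g -> plane1 (fun z => f z * g z).
Proof.
move=> Hf Hg; split; first by apply: plane0M; exact: plane1_plane0.
- have -> : 'D_e1 (fun z => f z * g z) = fun z => 'D_e1 f z * g z + f z * 'D_e1 g z.
    by apply/funext => z; rewrite plane1M_D1.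
  by move: Hf Hg => [? ? ? _] [? ? ? _]; apply: plane0D; exact: plane0M.
- have -> : 'D_e2 (fun z => f z * g z) = fun z => 'D_e2 f z * g z + f z * 'D_e2 g z.
    by apply/funext => z; rewrite plane1M_D2.
  by move: Hf Hg => [? ? ? _] [? ? ? _]; apply: plane0D; exact: plane0M.
move: Hf Hg => [_ _ _ Hf] [_ _ _ Hg] z.
have [f1 f2] := Hf z; have [g1 g2] := Hg z.
by split; [exact: derivableM f1 g1|exact: derivableM f2 g2].
Qed.

Lemma line_integrable (u : R -> R) (M : R) : continuous u ->
  (forall x, `|u x| <= M) -> (forall x, M < `|x| -> u x = 0) ->
  (lebesgueR R).-integrable setT (EFin \o u).
Proof.
move=> cu uM u0; apply: (@bounded_support_integrable _ (measurableTypeR R) R (lebesgueR R) u `[-M, M] M) => //.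
- have -> : lebesgueR R `[(- M)%R, M]%classic = @lebesgue_measure R `[(- M)%R, M]%classic by [].
  by rewrite lebesgue_measure_itv; case: ifPn => _; rewrite -?EFinB ltry.
- exact: continuous_measurable_fun.
move=> x /= xM; apply: u0; rewrite ltNge; apply/negP => xM'.
by apply: xM; rewrite in_itv/= -ler_norml.
Qed.

Lemma plane_int_iterated1 f : plane0 f -> (forall y, \int[lebesgueR R]_x f (x, y) = 0) -> plane_int f = 0.
Proof.
move=> Hf f0; have fi := plane0_integrable Hf; have [c1 _ [M fM]] := Hf.
rewrite /plane_int /Rintegral.
have <- := @integral21_prod_meas1 _ _ _ _ R (@lebesgue_measure R) (@lebesgue_measure R) _ fi.
rewrite (eq_integral (fun _ => 0%E)) ?integral0// => y _.
transitivity (\int[lebesgueR R]_x f (x, y))%:E; last by rewrite f0.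
rewrite /fubini_G/= /Rintegral fineK//.
apply: integrable_fin_num => //.
apply: (@line_integrable (fun x => f (x, y)) M) => [|x|x xM]; first exact: c1.
  exact: (fM _).1.
by apply: (fM _).2 => -[/=]; rewrite leNgt xM.
Qed.

Lemma plane_int_iterated2 f : plane0 f -> (forall x, \int[lebesgueR R]_y f (x, y) = 0) -> plane_int f = 0.
Proof.
move=> Hf f0; have fi := plane0_integrable Hf; have [_ c2 [M fM]] := Hf.
rewrite /plane_int /Rintegral.
have <- := @integral12_prod_meas1 _ _ _ _ R (@lebesgue_measure R) (@lebesgue_measure R) _ fi.
rewrite (eq_integral (fun _ => 0%E)) ?integral0// => x _.
transitivity (\int[lebesgueR R]_y f (x, y))%:E; last by rewrite f0.
rewrite /fubini_F/= /Rintegral fineK//.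
apply: integrable_fin_num => //.
apply: (@line_integrable (fun y => f (x, y)) M) => [|y|y yM]; first exact: c2.
  exact: (fM _).1.
by apply: (fM _).2 => -[/= _]; rewrite leNgt yM.
Qed.

(** The divergence theorem for compact support: by Fubini it reduces to the
fundamental theorem of calculus on each line. *)
Lemma plane_int_derive1 f : plane1 f -> plane_int ('D_e1 f) = 0.
Proof.
move=> [[_ _ [M fM]] H _ df]; apply: plane_int_iterated1 => // y.
under eq_Rintegral do rewrite derive_e1.
apply: (@integral_derive0 _ _ M).
- by move=> x; apply: derivable_e1; exact: (df _).1.
- have [c _ _] := H; have := c y.
  by rewrite (_ : (fun x => _) = (fun x => 'D_1 (fun x0 => f (x0, y)) x))//; apply/funext => x; rewrite derive_e1.
by move=> x xM; apply: (fM _).2 => -[/=]; rewrite leNgt xM.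
Qed.

Lemma plane_int_derive2 f : plane1 f -> plane_int ('D_e2 f) = 0.
Proof.
move=> [[_ _ [M fM]] _ H df]; apply: plane_int_iterated2 => // x.
under eq_Rintegral do rewrite derive_e2.
apply: (@integral_derive0 _ _ M).
- by move=> y; apply: derivable_e2; exact: (df _).2.
- have [_ c _] := H; have := c x.
  by rewrite (_ : (fun y => _) = (fun y => 'D_1 (fun y0 => f (x, y0)) y))//; apply/funext => y; rewrite derive_e2.
by move=> y yM; apply: (fM _).2 => -[/= _]; rewrite leNgt yM.
Qed.

End PlaneIntegral.

(** * Regularity classes for functions of (z, t) *)

Section Slices.
Variable R : realType.
Local Notation E := ((R * R) * R)%type.

Definition tdir : E := (0, 1).
Definition zdir (e : R * R) : E := (e, 0).

(** The derivative at a point along a direction depends only on the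
increments from that point, so a coefficient that is constant along the
direction can be frozen. *)
Lemma is_derive_growth (V : normedModType R) (f g : V -> R) (p u : V) :
  (forall h : R, f (h *: u + p) - f p = g (h *: u + p) - g p) ->
  forall d, is_derive p u g d -> is_derive p u f d.
Proof.
move=> fg d gd.
have e : (fun h : R => h^-1 *: (f (h *: u + p) - f p)) =
    (fun h : R => h^-1 *: (g (h *: u + p) - g p)).
  by apply/funext => h; rewrite fg.
by split; [have := @ex_derive _ _ _ _ _ _ _ gd|have := @derive_val _ _ _ _ _ _ _ gd];
  rewrite /derivable /derive e.
Qed.

Lemma is_derive_coef_t (c : R * R -> R) (b : E -> R) p d :
  is_derive p tdir b d -> is_derive p tdir (fun q => c q.1 * b q) (c p.1 * d).
Proof.
move=> bd; apply: (@is_derive_growth _ _ (fun q => c p.1 * b q)) => h.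
by rewrite /= scaler0 add0r.
Qed.

Lemma is_derive_fst (c : R * R -> R) (p : E) e d :
  is_derive p.1 e c d -> is_derive p (zdir e) (fun q => c q.1) d.
Proof.
move=> cd.
by split; [have := @ex_derive _ _ _ _ _ _ _ cd|have := @derive_val _ _ _ _ _ _ _ cd].
Qed.

Lemma growth_z (b : E -> R) z t e :
  (fun h : R => h^-1 *: (b (h *: zdir e + (z, t)) - b (z, t))) =
  (fun h : R => h^-1 *: (b (h *: e + z, t) - b (z, t))).
Proof.
apply/funext => h.
by congr (_ *: (b _ - _)); congr (_, _); rewrite /= scaler0 add0r.
Qed.

Lemma growth_t (b : E -> R) z t :
  (fun h : R => h^-1 *: (b (h *: tdir + (z, t)) - b (z, t))) =
  (fun h : R => h^-1 *: (b (z, h *: 1 + t) - b (z, t))).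
Proof.
apply/funext => h.
by congr (_ *: (b _ - _)); congr (_, _); rewrite /= scaler0 add0r.
Qed.

Lemma derive_slice_z (b : E -> R) z t e :
  'D_e (fun z => b (z, t)) z = 'D_(zdir e) b (z, t).
Proof. by rewrite /derive growth_z. Qed.

Lemma derive_slice_t (b : E -> R) z t :
  'D_1 (fun t : R => b (z, t)) t = 'D_tdir b (z, t).
Proof. by rewrite /derive growth_t. Qed.

Lemma derivable_slice_z (b : E -> R) z t e :
  derivable b (z, t) (zdir e) -> derivable (fun z => b (z, t)) z e.
Proof. by rewrite /derivable growth_z. Qed.

Lemma derivable_slice_t (b : E -> R) z t :
  derivable b (z, t) tdir -> derivable (fun t : R => b (z, t)) t 1.
Proof. by rewrite /derivable growth_t. Qed.

End Slices.
Arguments tdir {R}.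

Lemma continuous_near_eq (T S : topologicalType) (f g : T -> S) (x : T) :
  (\near x, f x = g x) -> {for x, continuous f} -> {for x, continuous g}.
Proof.
move=> fg cf; have e : f x = g x := nbhs_singleton fg.
rewrite /prop_for /continuous_at -e.
apply: cvg_trans cf; apply: near_eq_cvg.
by apply: filterS fg => y ->.
Qed.

Section Classes.
Variable R : realType.
Local Notation E := ((R * R) * R)%type.
Variables (U : set (R * R)) (K : set E).
Hypothesis openU : open U.
Hypothesis closedK : closed K.
Hypothesis KU : forall p, K p -> U p.1.

(** [K] is the support of the test function and [U] the domain of the
coefficients.  A coefficient need not be regular off [U], but it is always
multiplied by a function that vanishes off [K]. *)
Definition C0K (b : E -> R) := continuous b /\ forall p, ~ K p -> b p = 0.

(** Smoothness in t alone: each derivative in t can be traded for a factor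
tau in the Fourier transform, so [rapid] functions have rapidly decreasing
transforms. *)
Fixpoint rapid_upto n (b : E -> R) : Prop :=
  C0K b /\ if n is n'.+1 then (forall p, derivable b p tdir) /\ rapid_upto n' ('D_tdir b)
           else True.

Definition rapid b := forall n, rapid_upto n b.

Definition coef0 (c : R * R -> R) := forall z, U z -> {for z, continuous c}.

Definition coef1 (c : R * R -> R) :=
  [/\ coef0 c, forall e, coef0 ('D_e c) & forall e z, U z -> derivable c z e].

Definition rapid1 b := [/\ rapid b, forall e, rapid ('D_(zdir e) b) &
  forall e p, derivable b p (zdir e)].

Lemma rapid_C0K b : rapid b -> C0K b.
Proof. by move=> /(_ 0%N)[]. Qed.

Lemma rapid_derivable b : rapid b -> forall p, derivable b p tdir.
Proof. by move=> /(_ 1%N)[_ []]. Qed.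

Lemma rapid_D b : rapid b -> rapid ('D_tdir b).
Proof. by move=> rb n; have [_ []] := rb n.+1. Qed.

Lemma C0KD b1 b2 : C0K b1 -> C0K b2 -> C0K (fun p => b1 p + b2 p).
Proof.
move=> [c1 z1] [c2 z2]; split=> [p|p pK]; first by apply: continuousD; [exact: c1|exact: c2].
by rewrite z1 ?z2 ?addr0.
Qed.

Lemma rapidD b1 b2 : rapid b1 -> rapid b2 -> rapid (fun p => b1 p + b2 p).
Proof.
move=> r1 r2 n; elim: n b1 b2 {r1 r2}(r1 n) (r2 n) => [|n IH] b1 b2 [h1 d1] [h2 d2].
  by split => //; exact: C0KD.
split; first exact: C0KD.
move: d1 d2 => [d1 r1] [d2 r2]; split=> [p|]; first exact: derivableD.
rewrite (_ : 'D_tdir _ = fun p => 'D_tdir b1 p + 'D_tdir b2 p); first exact: IH.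
by apply/funext => p; rewrite deriveD.
Qed.

(** On [U] the coefficient is continuous; elsewhere the product is locally
zero, because the closed set [K] lies over [U]. *)
Lemma C0K_coef c b : coef0 c -> C0K b -> C0K (fun p => c p.1 * b p).
Proof.
move=> cc [cb zb]; split=> [p|p pK]; last by rewrite zb ?mulr0.
have [pU|pU] := pselect (U p.1).
  apply: continuousM; last exact: cb.
  by apply: continuous_comp; [exact: cvg_fst|exact: cc].
have nKp : ~ K p by move=> /KU.
apply: (@continuous_near_eq _ _ (cst 0)); last exact: cvg_cst.
have := open_nbhs_nbhs (conj (closed_openC closedK) nKp).
by apply: filterS => q qK /=; rewrite zb ?mulr0.
Qed.

Lemma rapid_coef c b : coef0 c -> rapid b -> rapid (fun p => c p.1 * b p).
Proof.
move=> cc rb n; elim: n b {rb}(rb n) => [|n IH] b [hb db].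
  by split => //; exact: C0K_coef.
split; first exact: C0K_coef.
move: db => [db rb]; split=> [p|].
  by apply: ex_derive; apply: is_derive_coef_t; exact/derivableP.
rewrite (_ : 'D_tdir _ = fun p => c p.1 * 'D_tdir b p); first exact: IH.
apply/funext => p; apply: derive_val; apply: is_derive_coef_t.
exact/derivableP.
Qed.

Lemma coef0_cst k : coef0 (cst k).
Proof. by move=> z _; exact: cvg_cst. Qed.

Lemma rapidZ k b : rapid b -> rapid (fun p => k * b p).
Proof. by move=> rb; have := @rapid_coef (cst k) b (@coef0_cst k) rb. Qed.

Lemma rapid1_rapidD b e : rapid1 b -> rapid ('D_(zdir e) b). Proof. by case. Qed.

Lemma rapid1D b1 b2 : rapid1 b1 -> rapid1 b2 -> rapid1 (fun p => b1 p + b2 p).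
Proof.
move=> [r1 w1 d1] [r2 w2 d2]; split; first exact: rapidD.
  move=> e; rewrite (_ : 'D_(zdir e) _ = fun p => 'D_(zdir e) b1 p + 'D_(zdir e) b2 p).
    exact: rapidD.
  by apply/funext => p; rewrite deriveD.
by move=> e p; exact: derivableD.
Qed.

Lemma is_derive_coef c b e p : coef1 c -> rapid1 b ->
  is_derive p (zdir e) (fun q => c q.1 * b q)
    ('D_e c p.1 * b p + c p.1 * 'D_(zdir e) b p).
Proof.
move=> [c0 c1 dc] [rb w db]; have [pU|pU] := pselect (U p.1).
  have h1 : is_derive p (zdir e) (fun q => c q.1) ('D_e c p.1).
    by apply: is_derive_fst; apply/derivableP; exact: dc.
  have h2 : is_derive p (zdir e) b ('D_(zdir e) b p) by apply/derivableP.
  have := is_deriveM h1 h2.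
  by rewrite /GRing.scale/= addrC [b p * _]mulrC.
have nKp : ~ K p by move=> /KU.
have z0 b' : rapid b' -> b' p = 0 by move=> /rapid_C0K[_ ->].
rewrite (z0 _ rb) (z0 _ (w e)) !mulr0 addr0.
apply: (@derive_off_support R _ _ (~` K)) => // [|q qK]; first exact: closed_openC.
by have [_ ->] := rapid_C0K rb; rewrite ?mulr0.
Qed.

Lemma rapid1_coef c b : coef1 c -> rapid1 b -> rapid1 (fun p => c p.1 * b p).
Proof.
move=> cc wb; have [c0 c1 dc] := cc; have [rb w db] := wb; split.
- exact: rapid_coef.
- move=> e; rewrite (_ : 'D_(zdir e) _ =
    fun p => 'D_e c p.1 * b p + c p.1 * 'D_(zdir e) b p).
    by have := rapidD (rapid_coef (c1 e) rb) (rapid_coef c0 (w e)).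
  by apply/funext => p; apply: derive_val; exact: is_derive_coef.
- by move=> e p; apply: ex_derive; exact: is_derive_coef.
Qed.

Lemma coef1_cst k : coef1 (cst k).
Proof.
split; first exact: coef0_cst.
  move=> e; rewrite (_ : 'D_e _ = cst 0); first exact: coef0_cst.
  by apply/funext => z; rewrite derive_cst.
by move=> e z _; exact: derivable_cst.
Qed.

Lemma rapid1Z k b : rapid1 b -> rapid1 (fun p => k * b p).
Proof. by move=> wb; have := @rapid1_coef (cst k) b (@coef1_cst k) wb. Qed.

Lemma coef0D c d : coef0 c -> coef0 d -> coef0 (fun z => c z + d z).
Proof. by move=> cc cd z zU; apply: continuousD; [exact: cc|exact: cd]. Qed.

Lemma coef0M c d : coef0 c -> coef0 d -> coef0 (fun z => c z * d z).
Proof. by move=> cc cd z zU; apply: continuousM; [exact: cc|exact: cd]. Qed.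

Lemma coef1D c d : coef1 c -> coef1 d -> coef1 (fun z => c z + d z).
Proof.
move=> [c0 c1 dc] [d0 d1 dd]; split; first exact: coef0D.
  move=> e z zU; apply: (@continuous_near_eq _ _ (fun z => 'D_e c z + 'D_e d z)).
    apply: filterS (open_nbhs_nbhs (conj openU zU)) => y yU.
    by rewrite deriveD//; [exact: dc|exact: dd].
  exact: (coef0D (c1 e) (d1 e)).
by move=> e z zU; apply: derivableD; [exact: dc|exact: dd].
Qed.

Lemma coef1M c d : coef1 c -> coef1 d -> coef1 (fun z => c z * d z).
Proof.
move=> [c0 c1 dc] [d0 d1 dd]; split; first exact: coef0M.
  move=> e z zU; apply: (@continuous_near_eq _ _ (fun z => c z * 'D_e d z + d z * 'D_e c z)).
    apply: filterS (open_nbhs_nbhs (conj openU zU)) => y yU.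
    by rewrite deriveM//; [exact: dc|exact: dd].
  by apply: (coef0D (coef0M c0 (d1 e)) (coef0M d0 (c1 e))).
by move=> e z zU; apply: derivableM; [exact: dc|exact: dd].
Qed.

Lemma coef1X c n : coef1 c -> coef1 (fun z => c z ^+ n).
Proof.
move=> cc; elim: n => [|n IH].
  by rewrite (_ : (fun z => _) = cst 1); [exact: coef1_cst|apply/funext => z; rewrite expr0].
rewrite (_ : (fun z => _) = fun z => c z * c z ^+ n); first exact: coef1M.
by apply/funext => z; rewrite exprS.
Qed.

Lemma smooth_coef1 F e : smooth_on U F -> coef1 ('D_e F).
Proof.
move=> sF; split.
- by have [_ h] := sF 1%N; exact: h.
- by move=> u; have [_ /(_ e)[_ h]] := sF 2%N; exact: h.
move=> u z zU; have [_ /(_ e)[h _]] := sF 2%N.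
by apply: diff_derivable; exact: h.
Qed.
End Classes.

(** * Symmetry of second derivatives *)

Section Schwarz.
Variables (R : realType) (V : normedModType R).

Lemma is_derive_line (f : V -> R) (q u : V) (s : R) : derivable f (s *: u + q) u ->
  is_derive s 1 (fun s : R => f (s *: u + q)) ('D_u f (s *: u + q)).
Proof.
have e : (fun h : R => h^-1 *: (f ((h *: 1 + s) *: u + q) - f (s *: u + q))) =
    (fun h : R => h^-1 *: (f (h *: u + (s *: u + q)) - f (s *: u + q))).
  apply/funext => h; have -> : h *: (1 : R) = h by exact: mulr1.
  by rewrite scalerDl addrA.
by move=> df; split; rewrite /derivable /derive e.
Qed.

(** The mean value theorem in direction u and then in direction v. *)
Lemma mixed_difference (f : V -> R) (p u v : V) (h : R) (W : set V) : 0 < h ->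
  (forall s t : R, 0 <= s <= h -> 0 <= t <= h -> W (s *: u + (t *: v + p))) ->
  (forall q, W q -> derivable f q u) ->
  (forall q, W q -> derivable ('D_u f) q v) ->
  exists2 q, W q & f (h *: u + (h *: v + p)) - f (h *: u + p) - f (h *: v + p) + f p
    = 'D_v ('D_u f) q * h ^+ 2.
Proof.
move=> h0 Wh du dvu.
have hh : 0 <= h <= h by rewrite lexx ltW.
have h00 : 0 <= (0 : R) <= h by rewrite lexx ltW.
pose G s := f (s *: u + (h *: v + p)) - f (s *: u + p).
pose G' s := 'D_u f (s *: u + (h *: v + p)) - 'D_u f (s *: u + p).
have Wp s : 0 <= s <= h -> W (s *: u + p).
  by move=> sh; have := Wh s 0 sh h00; rewrite scale0r add0r.
have dG s : 0 <= s <= h -> is_derive s 1 G (G' s).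
  move=> sh; apply: is_deriveB; apply: is_derive_line; apply: du; [exact: Wh|exact: Wp].
have [s sh GE] : exists2 c, c \in `[0, h] & G h - G 0 = G' c * (h - 0).
  apply: MVT_segment; first exact: ltW.
  - by move=> s; rewrite in_itv/= => /andP[s0 sh]; apply: dG; rewrite !ltW.
  - apply: derivable_within_continuous => s; rewrite in_itv/= => sh.
    exact: (@ex_derive _ _ _ _ _ _ _ (dG s sh)).
rewrite in_itv/= in sh.
pose H t := 'D_u f (t *: v + (s *: u + p)).
pose H' t := 'D_v ('D_u f) (t *: v + (s *: u + p)).
have Wst t : 0 <= t <= h -> W (t *: v + (s *: u + p)).
  by move=> th; have := Wh s t sh th; rewrite addrCA.
have dH t : 0 <= t <= h -> is_derive t 1 H (H' t).
  by move=> th; apply: is_derive_line; apply: dvu; exact: Wst.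
have [t th HE] : exists2 c, c \in `[0, h] & H h - H 0 = H' c * (h - 0).
  apply: MVT_segment; first exact: ltW.
  - by move=> t; rewrite in_itv/= => /andP[t0 th]; apply: dH; rewrite !ltW.
  - apply: derivable_within_continuous => t; rewrite in_itv/= => th.
    exact: (@ex_derive _ _ _ _ _ _ _ (dH t th)).
rewrite in_itv/= in th.
exists (t *: v + (s *: u + p)); first exact: Wst.
move: GE HE; rewrite /G /G' /H /H' !subr0 !scale0r !add0r.
rewrite [h *: v + (s *: u + p)]addrCA => GE HE.
rewrite HE in GE; rewrite expr2 mulrA -GE; ring.
Qed.

(** The second difference is symmetric in u and v; by [mixed_difference] it
is h^2 times either mixed derivative at some point within the same small
parallelogram, and continuity at p lets h go to 0. *)
Lemma schwarz (f : V -> R) (p u v : V) (U : set V) : open U -> U p ->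
  (forall q, U q -> derivable f q u) -> (forall q, U q -> derivable f q v) ->
  (forall q, U q -> derivable ('D_u f) q v) ->
  (forall q, U q -> derivable ('D_v f) q u) ->
  {for p, continuous ('D_v ('D_u f))} -> {for p, continuous ('D_u ('D_v f))} ->
  'D_v ('D_u f) p = 'D_u ('D_v f) p.
Proof.
move=> oU Up du dv dvu duv cvu cuv; apply/eqP; rewrite -subr_eq0 -normr_le0.
apply/ler_addgt0Pl => e e0; rewrite addr0.
have e2 : 0 < e / 2 by rewrite divr_gt0.
pose W := U `&` ([set q | `|'D_v ('D_u f) p - 'D_v ('D_u f) q| < e / 2] `&`
                 [set q | `|'D_u ('D_v f) p - 'D_u ('D_v f) q| < e / 2]).
have nW : nbhs p W.
  apply: filterI; first exact: open_nbhs_nbhs.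
  apply: filterI; first by move/cvgrPdist_lt: cvu; apply.
  by move/cvgrPdist_lt: cuv; apply.
have [h h0 Wh] : exists2 h, 0 < h & forall s t : R, 0 <= s <= h -> 0 <= t <= h ->
    W (s *: u + (t *: v + p)).
  move: nW => /nbhs_ballP[r /= r0 hr].
  pose c := `|u| + `|v| + 1.
  have c0 : 0 < c by rewrite ltr_wpDl// addr_ge0.
  exists (r / c); first by rewrite divr_gt0.
  move=> s t /andP[s0 sr] /andP[t0 tr]; apply: hr.
  rewrite -ball_normE /= addrA opprD addrCA subrr addr0 normrN.
  rewrite (le_lt_trans (ler_normD _ _))// !normrZ ger0_norm// (ger0_norm t0).
  rewrite (@le_lt_trans _ _ (r / c * `|u| + r / c * `|v|))//.
    by rewrite lerD// ler_wpM2r.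
  rewrite -mulrDr -[ltRHS](mulfVK (lt0r_neq0 c0)) ltr_pM2l ?divr_gt0//.
  by rewrite /c ltrDl.
have WU q : W q -> U q by case.
have [q Wq qE] := mixed_difference h0 Wh (fun q Wq => du q (WU q Wq)) (fun q Wq => dvu q (WU q Wq)).
have Wh' (s t : R) : 0 <= s <= h -> 0 <= t <= h -> W (s *: v + (t *: u + p)).
  by move=> sh th; rewrite addrCA; exact: Wh.
have [q' Wq' q'E] := mixed_difference h0 Wh' (fun q Wq => dv q (WU q Wq)) (fun q Wq => duv q (WU q Wq)).
have qq : 'D_v ('D_u f) q = 'D_u ('D_v f) q'.
  apply: (@mulIf _ (h ^+ 2)); first by rewrite expf_neq0// gt_eqF.
  apply: etrans (esym qE) (etrans _ q'E).
  have -> : h *: v + (h *: u + p) = h *: u + (h *: v + p) by exact: addrCA.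
  by congr (_ + f p); exact: addrAC.
have [_ [h1 _]] := Wq; have [_ [_ h2]] := Wq'.
rewrite [e]splitr.
have -> : 'D_v ('D_u f) p - 'D_u ('D_v f) p =
  ('D_v ('D_u f) p - 'D_v ('D_u f) q) - ('D_u ('D_v f) p - 'D_u ('D_v f) q').
  by rewrite qq opprB addrA subrK.
by apply: (le_trans (ler_normB _ _)); apply: lerD; apply: ltW; [exact: h1|exact: h2].
Qed.

End Schwarz.

Section Smooth.
Variables (R : realType) (V : normedModType R).
Implicit Types (b : V -> R).

Lemma linear_is_derive (l : V -> R) : continuous l ->
  (forall k x y, l (k *: x + y) = k * l x + l y) ->
  forall p, differentiable l p /\ forall u, 'D_u l p = l u.
Proof.
move=> cl ll p.
pose L : {linear V -> R} := HB.pack l (GRing.isLinear.Build R V R *:%R l ll).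
have dl : differentiable l p by exact: (@linear_differentiable _ _ _ L p cl).
by split=> // u; rewrite deriveE// (@diff_lin _ _ _ L p cl).
Qed.

Lemma classC_pred n b : classC n.+1 setT b -> classC n setT b.
Proof.
elim: n b => [|n IH] b [db Db].
  by move=> x _; apply: differentiable_continuous; exact: db.
by split=> // u; apply: IH; exact: Db.
Qed.

Lemma classCD n b1 b2 : classC n setT b1 -> classC n setT b2 ->
  classC n setT (fun p => b1 p + b2 p).
Proof.
elim: n b1 b2 => [|n IH] b1 b2.
  by move=> c1 c2 x _; apply: continuousD; [exact: c1|exact: c2].
move=> [d1 D1] [d2 D2]; split=> [x _|u].
  by apply: differentiableD; [exact: d1|exact: d2].
rewrite (_ : 'D_u _ = fun p => 'D_u b1 p + 'D_u b2 p).
  by apply: IH; [exact: D1|exact: D2].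
by apply/funext => p; rewrite deriveD//; apply: diff_derivable; [exact: d1|exact: d2].
Qed.

Lemma classCZ n k b : classC n setT b -> classC n setT (fun p => k * b p).
Proof.
elim: n b => [|n IH] b.
  by move=> cb x _; apply: continuousM; [exact: cvg_cst|exact: cb].
move=> [db Db]; split=> [x _|w].
  by apply: differentiableM; [exact: differentiable_cst|exact: db].
rewrite (_ : 'D_w _ = fun p => k * 'D_w b p); first by apply: IH; exact: Db.
apply/funext => p; have := @deriveZ _ _ _ b k p w.
by apply; apply: diff_derivable; exact: db.
Qed.

(** Linear factors are enough, since only powers of zbar multiply v before the
operators are applied. *)
Lemma classC_linM n (l : V -> R) b : continuous l ->
  (forall k x y, l (k *: x + y) = k * l x + l y) ->
  classC n setT b -> classC n setT (fun p => l p * b p).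
Proof.
move=> cl ll; have dl := linear_is_derive cl ll.
elim: n b => [|n IH] b.
  by move=> cb x _; apply: continuousM; [exact: cl|exact: cb].
move=> Cb; have [db Db] := Cb; split=> [x _|u].
  by apply: differentiableM; [exact: (dl x).1|exact: db].
rewrite (_ : 'D_u _ = fun p => l p * 'D_u b p + l u * b p).
  by apply: classCD; [apply: IH; exact: Db|apply: classCZ; exact: classC_pred].
apply/funext => p; have := @deriveM _ _ l b p u.
rewrite (dl p).2 /GRing.scale/= [b p * _]mulrC; apply; apply: diff_derivable.
  exact: (dl p).1.
exact: db.
Qed.

End Smooth.

(** * The operators in real coordinates *)

Section ComplexOperators.
Variable R : realType.
Local Notation E := ((R * R) * R)%type.

Definition reC (T : Type) (v : T -> R[i]) : T -> R := fun p => complex.Re (v p).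
Definition imC (T : Type) (v : T -> R[i]) : T -> R := fun p => complex.Im (v p).

Lemma complex_half (x y : R) : (x +i* y) / 2 = (x / 2) +i* (y / 2).
Proof.
have -> : (2 : R[i]) = (2 : R)%:C by rewrite rmorph_nat.
rewrite -fmorphV/=; apply/eqP; rewrite eq_complex/=.
by rewrite !mulr0 subr0 add0r !eqxx.
Qed.

Lemma dzE (f : R * R -> R[i]) z : dz f z =
  (('D_e1 (reC f) z + 'D_e2 (imC f) z) / 2) +i* (('D_e1 (imC f) z - 'D_e2 (reC f) z) / 2).
Proof.
rewrite /dz -complex_half; congr (_ / _).
by apply/eqP; rewrite eq_complex /= !mul0r !mul1r sub0r add0r opprK !eqxx.
Qed.

Lemma dzbarE (f : R * R -> R[i]) z : dzbar f z =
  (('D_e1 (reC f) z - 'D_e2 (imC f) z) / 2) +i* (('D_e1 (imC f) z + 'D_e2 (reC f) z) / 2).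
Proof.
rewrite /dzbar -complex_half; congr (_ / _).
by apply/eqP; rewrite eq_complex /= !mul0r !mul1r sub0r add0r !eqxx.
Qed.

Lemma dtE (v : E -> R[i]) p : dt v p = 'D_tdir (reC v) p +i* 'D_tdir (imC v) p.
Proof.
by case: p => z t; rewrite /dt /cderive /= -!derive_slice_t.
Qed.

Lemma dz_ofreal (F : R * R -> R) z : dz (ofreal F) z = ('D_e1 F z / 2) +i* (- 'D_e2 F z / 2).
Proof.
rewrite dzE (_ : imC (ofreal F) = cst 0)// !derive_cst addr0 sub0r.
by rewrite (_ : reC (ofreal F) = F).
Qed.

Lemma dzbar_ofreal (F : R * R -> R) z : dzbar (ofreal F) z = ('D_e1 F z / 2) +i* ('D_e2 F z / 2).
Proof.
rewrite dzbarE (_ : imC (ofreal F) = cst 0)// !derive_cst subr0 add0r.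
by rewrite (_ : reC (ofreal F) = F).
Qed.

Lemma derive_slice_re (v : E -> R[i]) z t e :
  'D_e (reC (fun z => v (z, t))) z = 'D_(zdir e) (reC v) (z, t).
Proof. exact: (derive_slice_z (reC v)). Qed.

Lemma derive_slice_im (v : E -> R[i]) z t e :
  'D_e (imC (fun z => v (z, t))) z = 'D_(zdir e) (imC v) (z, t).
Proof. exact: (derive_slice_z (imC v)). Qed.

Lemma opL_Re F v p : complex.Re (opL F v p) = 2^-1 *
  ('D_(zdir e1) (reC v) p + 'D_(zdir e2) (imC v) p
   + 'D_e2 F p.1 * 'D_tdir (reC v) p - 'D_e1 F p.1 * 'D_tdir (imC v) p).
Proof.
case: p => z t; rewrite /opL dzE dz_ofreal dtE /= !derive_slice_re !derive_slice_im.
by field.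
Qed.

Lemma opL_Im F v p : complex.Im (opL F v p) = 2^-1 *
  ('D_(zdir e1) (imC v) p - 'D_(zdir e2) (reC v) p
   + 'D_e1 F p.1 * 'D_tdir (reC v) p + 'D_e2 F p.1 * 'D_tdir (imC v) p).
Proof.
case: p => z t; rewrite /opL dzE dz_ofreal dtE /= !derive_slice_re !derive_slice_im.
by field.
Qed.

Lemma opLbar_Re F v p : complex.Re (opLbar F v p) = 2^-1 *
  ('D_(zdir e1) (reC v) p - 'D_(zdir e2) (imC v) p
   + 'D_e2 F p.1 * 'D_tdir (reC v) p + 'D_e1 F p.1 * 'D_tdir (imC v) p).
Proof.
case: p => z t; rewrite /opLbar dzbarE dzbar_ofreal dtE /= !derive_slice_re !derive_slice_im.
by field.
Qed.

Lemma opLbar_Im F v p : complex.Im (opLbar F v p) = 2^-1 *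
  ('D_(zdir e1) (imC v) p + 'D_(zdir e2) (reC v) p
   - 'D_e1 F p.1 * 'D_tdir (reC v) p + 'D_e2 F p.1 * 'D_tdir (imC v) p).
Proof.
case: p => z t; rewrite /opLbar dzbarE dzbar_ofreal dtE /= !derive_slice_re !derive_slice_im.
by field.
Qed.

End ComplexOperators.

(** * Test functions and their images under L and P *)

Section TestClasses.
Variable R : realType.
Local Notation E := ((R * R) * R)%type.
Variables (U : set (R * R)) (K : set E).
Hypothesis openU : open U.
Hypothesis closedK : closed K.
Hypothesis KU : forall p, K p -> U p.1.

Definition smoothK (b : E -> R) := smooth_on setT b /\ forall p, ~ K p -> b p = 0.

Lemma smoothK_D u b : smoothK b -> smoothK ('D_u b).
Proof.
move=> [sb zb]; split=> [n|p pK]; first by have [_] := sb n.+1; exact.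
have [_ ->] // := @derive_off_support R _ b (~` K) p u (closed_openC closedK) pK zb.
Qed.

Lemma smoothK_C0K b : smoothK b -> C0K K b.
Proof. by move=> [sb zb]; split=> // p; exact: (sb 0%N). Qed.

Lemma smoothK_derivable u b p : smoothK b -> derivable b p u.
Proof. by move=> [sb _]; apply: diff_derivable; exact: (sb 1%N).1. Qed.

Lemma smoothK_rapid b : smoothK b -> rapid K b.
Proof.
move=> tb n; elim: n b tb => [|n IH] b tb; first by split=> //; exact: smoothK_C0K.
split; first exact: smoothK_C0K.
by split=> [p|]; [exact: smoothK_derivable|apply: IH; exact: smoothK_D].
Qed.

Lemma smoothK_rapid1 b : smoothK b -> rapid1 K b.
Proof.
move=> tb; split; first exact: smoothK_rapid.
  by move=> e; apply: smoothK_rapid; exact: smoothK_D.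
by move=> e p; exact: smoothK_derivable.
Qed.

Lemma smoothKD b1 b2 : smoothK b1 -> smoothK b2 -> smoothK (fun p => b1 p + b2 p).
Proof.
move=> [s1 z1] [s2 z2]; split=> [n|p pK]; first by apply: classCD; [exact: s1|exact: s2].
by rewrite z1// z2// addr0.
Qed.

Lemma smoothKZ k b : smoothK b -> smoothK (fun p => k * b p).
Proof.
move=> [sb zb]; split=> [n|p pK]; first by apply: classCZ; exact: sb.
by rewrite zb// mulr0.
Qed.

Lemma continuous_x : continuous (fun p : E => p.1.1).
Proof.
move=> p; apply: (@continuous_comp _ _ _ fst fst); exact: cvg_fst.
Qed.

Lemma continuous_y : continuous (fun p : E => p.1.2).
Proof.
move=> p; apply: (@continuous_comp _ _ _ fst snd); [exact: cvg_fst|exact: cvg_snd].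
Qed.

Lemma smoothK_xM b : smoothK b -> smoothK (fun p => p.1.1 * b p).
Proof.
move=> [sb zb]; split=> [n|p pK]; last by rewrite zb// mulr0.
apply: (@classC_linM _ _ _ (fun p : E => p.1.1)); [exact: continuous_x|by []|exact: sb].
Qed.

Lemma smoothK_yM b : smoothK b -> smoothK (fun p => p.1.2 * b p).
Proof.
move=> [sb zb]; split=> [n|p pK]; last by rewrite zb// mulr0.
apply: (@classC_linM _ _ _ (fun p : E => p.1.2)); [exact: continuous_y|by []|exact: sb].
Qed.

Lemma smoothK_schwarz u v b : smoothK b -> 'D_v ('D_u b) = 'D_u ('D_v b).
Proof.
move=> tb; apply/funext => p.
apply: (@schwarz _ _ b p u v setT) => //; first exact: openT.
- by move=> q _; exact: smoothK_derivable.
- by move=> q _; exact: smoothK_derivable.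
- by move=> q _; apply: smoothK_derivable; exact: smoothK_D.
- by move=> q _; apply: smoothK_derivable; exact: smoothK_D.
- by have [c _] := smoothK_C0K (smoothK_D v (smoothK_D u tb)); exact: c.
- by have [c _] := smoothK_C0K (smoothK_D u (smoothK_D v tb)); exact: c.
Qed.

Lemma coef1_linear (l : R * R -> R) : continuous l ->
  (forall k x y, l (k *: x + y) = k * l x + l y) -> coef1 U l.
Proof.
move=> cl ll; have dl := linear_is_derive cl ll; split.
- by move=> z _; exact: cl.
- move=> e; rewrite (_ : 'D_e l = cst (l e)); first exact: coef0_cst.
  by apply/funext => z; rewrite (dl z).2.
- by move=> e z _; apply: diff_derivable; exact: (dl z).1.
Qed.

Lemma coef1_x : coef1 U fst.
Proof. by apply: coef1_linear => // z; exact: cvg_fst. Qed.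

Lemma coef1_y : coef1 U snd.
Proof. by apply: coef1_linear => // z; exact: cvg_snd. Qed.

Definition rsq (z : R * R) : R := z.1 ^+ 2 + z.2 ^+ 2.

Lemma coef1_rsqX n : coef1 U (fun z => rsq z ^+ n).
Proof.
apply: coef1X => //; apply: coef1D => //; apply: coef1X => //.
  exact: coef1_x.
exact: coef1_y.
Qed.

Definition rapidC (v : E -> R[i]) := rapid K (reC v) /\ rapid K (imC v).
Definition rapid1C (v : E -> R[i]) := rapid1 K (reC v) /\ rapid1 K (imC v).
Definition smoothKC (v : E -> R[i]) := smoothK (reC v) /\ smoothK (imC v).

Lemma smoothKC_rapid1C v : smoothKC v -> rapid1C v.
Proof. by move=> [ta tb]; split; exact: smoothK_rapid1. Qed.

Lemma rapid1C_rapidC v : rapid1C v -> rapidC v.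
Proof. by move=> [[? _ _] [? _ _]]; split. Qed.

Definition zmul (c : R * R -> R) (v : E -> R[i]) : E -> R[i] := fun p => (c p.1)%:C * v p.

Lemma reC_zmul c v : reC (zmul c v) = fun p => c p.1 * reC v p.
Proof. by apply/funext => p; rewrite /zmul /reC; case: (v p) => x y /=; rewrite mul0r subr0. Qed.

Lemma imC_zmul c v : imC (zmul c v) = fun p => c p.1 * imC v p.
Proof. by apply/funext => p; rewrite /zmul /imC; case: (v p) => x y /=; rewrite mul0r addr0. Qed.

Lemma rapidC_zmul c v : coef0 U c -> rapidC v -> rapidC (zmul c v).
Proof.
move=> cc [ra rb].
by split; [rewrite reC_zmul|rewrite imC_zmul]; apply: (rapid_coef closedK KU cc).
Qed.

Lemma rapid1C_zmul c v : coef1 U c -> rapid1C v -> rapid1C (zmul c v).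
Proof.
move=> cc [ra rb].
by split; [rewrite reC_zmul|rewrite imC_zmul]; apply: (rapid1_coef closedK KU cc).
Qed.

Lemma rapid1C_rsqX n v : rapid1C v -> rapid1C (fun p => (rsq p.1 ^+ n)%:C * v p).
Proof. exact: (rapid1C_zmul (coef1_rsqX n)). Qed.

Variable F : R * R -> R.
Hypothesis smoothF : smooth_on U F.

(** The common shape of the real and imaginary parts of L v and of its
conjugate; the signs are carried by the constants [k2], [k3], [k4]. *)
Lemma rapid_first_order (b1 b2 b3 b4 : E -> R) (k2 k3 k4 : R) (e e' : R * R) :
  rapid K b1 -> rapid K b2 -> rapid K b3 -> rapid K b4 ->
  rapid K (fun p => 2^-1 * (b1 p + k2 * b2 p + 'D_e F p.1 * (k3 * b3 p) + 'D_e' F p.1 * (k4 * b4 p))).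
Proof.
move=> r1 r2 r3 r4; apply: (@rapidZ _ U) => //.
have c e0 : coef0 U ('D_e0 F) by have [] := smooth_coef1 e0 smoothF.
apply: rapidD; last by apply: (rapid_coef closedK KU (c _)); apply: (@rapidZ _ U).
apply: rapidD; last by apply: (rapid_coef closedK KU (c _)); apply: (@rapidZ _ U).
by apply: rapidD => //; apply: (@rapidZ _ U).
Qed.

Lemma rapid1_first_order (b1 b2 b3 b4 : E -> R) (k2 k3 k4 : R) (e e' : R * R) :
  rapid1 K b1 -> rapid1 K b2 -> rapid1 K b3 -> rapid1 K b4 ->
  rapid1 K (fun p => 2^-1 * (b1 p + k2 * b2 p + 'D_e F p.1 * (k3 * b3 p) + 'D_e' F p.1 * (k4 * b4 p))).
Proof.
move=> r1 r2 r3 r4; apply: (rapid1Z closedK KU).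
have c e0 : coef1 U ('D_e0 F) := smooth_coef1 e0 smoothF.
have c3 := rapid1_coef closedK KU (c e) (rapid1Z closedK KU k3 r3).
have c4 := rapid1_coef closedK KU (c e') (rapid1Z closedK KU k4 r4).
exact: (rapid1D (rapid1D (rapid1D r1 (rapid1Z closedK KU k2 r2)) c3) c4).
Qed.

Lemma reC_opL v : reC (opL F v) = fun p => 2^-1 * ('D_(zdir e1) (reC v) p
  + 1 * 'D_(zdir e2) (imC v) p + 'D_e2 F p.1 * (1 * 'D_tdir (reC v) p)
  + 'D_e1 F p.1 * (-1 * 'D_tdir (imC v) p)).
Proof. by apply/funext => p; rewrite /reC opL_Re !mul1r mulN1r mulrN. Qed.

Lemma imC_opL v : imC (opL F v) = fun p => 2^-1 * ('D_(zdir e1) (imC v) p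
  + -1 * 'D_(zdir e2) (reC v) p + 'D_e1 F p.1 * (1 * 'D_tdir (reC v) p)
  + 'D_e2 F p.1 * (1 * 'D_tdir (imC v) p)).
Proof. by apply/funext => p; rewrite /imC opL_Im !mul1r mulN1r. Qed.

Lemma reC_opLbar v : reC (opLbar F v) = fun p => 2^-1 * ('D_(zdir e1) (reC v) p
  + -1 * 'D_(zdir e2) (imC v) p + 'D_e2 F p.1 * (1 * 'D_tdir (reC v) p)
  + 'D_e1 F p.1 * (1 * 'D_tdir (imC v) p)).
Proof. by apply/funext => p; rewrite /reC opLbar_Re !mul1r mulN1r. Qed.

Lemma imC_opLbar v : imC (opLbar F v) = fun p => 2^-1 * ('D_(zdir e1) (imC v) p
  + 1 * 'D_(zdir e2) (reC v) p + 'D_e1 F p.1 * (-1 * 'D_tdir (reC v) p)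
  + 'D_e2 F p.1 * (1 * 'D_tdir (imC v) p)).
Proof. by apply/funext => p; rewrite /imC opLbar_Im !mul1r mulN1r mulrN. Qed.

Lemma rapidC_opL v : rapid1C v -> rapidC (opL F v).
Proof.
move=> [[ra wa _] [rb wb _]].
by split; rewrite ?reC_opL ?imC_opL; apply: rapid_first_order => //; exact: rapid_D.
Qed.

Lemma rapidC_opLbar v : rapid1C v -> rapidC (opLbar F v).
Proof.
move=> [[ra wa _] [rb wb _]].
by split; rewrite ?reC_opLbar ?imC_opLbar; apply: rapid_first_order => //; exact: rapid_D.
Qed.

Lemma rapid1C_opL v : smoothKC v -> rapid1C (opL F v).
Proof.
move=> [ta tb].
by split; rewrite ?reC_opL ?imC_opL; apply: rapid1_first_order => //; apply: smoothK_rapid1; exact: smoothK_D.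
Qed.

Lemma rapid1C_opLbar v : smoothKC v -> rapid1C (opLbar F v).
Proof.
move=> [ta tb].
by split; rewrite ?reC_opLbar ?imC_opLbar; apply: rapid1_first_order => //; apply: smoothK_rapid1; exact: smoothK_D.
Qed.

Lemma rapidCD u v : rapidC u -> rapidC v -> rapidC (fun p => u p + v p).
Proof.
move=> [ra rb] [ra' rb']; split.
  rewrite (_ : reC _ = fun p => reC u p + reC v p); first exact: rapidD.
  by apply/funext => p; rewrite /reC raddfD.
rewrite (_ : imC _ = fun p => imC u p + imC v p); first exact: rapidD.
by apply/funext => p; rewrite /imC raddfD.
Qed.

Lemma normC_toC (z : R * R) n : `|toC z| ^+ (2 * n) = (rsq z ^+ n)%:C :> R[i].
Proof.
rewrite exprM normc_def/= -rmorphXn/= sqr_sqrtr ?rmorphXn//.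
by rewrite addr_ge0// sqr_ge0.
Qed.

Lemma opPE k v : opP k F v = fun p => opL F (opLbar F v) p +
  opLbar F (fun q => (rsq q.1 ^+ k)%:C * opL F v q) p.
Proof.
apply/funext => p; rewrite /opP; congr (_ + opLbar F _ p).
by apply/funext => q; rewrite normC_toC.
Qed.

Lemma rapidC_opP k v : smoothKC v -> rapidC (opP k F v).
Proof.
move=> tv; rewrite opPE; apply: rapidCD.
  by apply: rapidC_opL; exact: rapid1C_opLbar.
by apply: rapidC_opLbar; apply: rapid1C_rsqX; exact: rapid1C_opL.
Qed.

Definition zbarM (v : E -> R[i]) : E -> R[i] := fun p => (toC p.1)^* * v p.

Lemma reC_zbarM v : reC (zbarM v) = fun p => p.1.1 * reC v p + p.1.2 * imC v p.
Proof.
by apply/funext => p; rewrite /reC /imC /zbarM; case: (v p) => x y /=; rewrite mulNr opprK.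
Qed.

Lemma imC_zbarM v : imC (zbarM v) = fun p => p.1.1 * imC v p + -1 * (p.1.2 * reC v p).
Proof.
by apply/funext => p; rewrite /reC /imC /zbarM; case: (v p) => x y /=; rewrite mulN1r mulNr.
Qed.

Lemma smoothKC_zbarM v : smoothKC v -> smoothKC (zbarM v).
Proof.
move=> [ta tb]; split; rewrite ?reC_zbarM ?imC_zbarM; apply: smoothKD; first exact: smoothK_xM.
- exact: smoothK_yM.
- exact: smoothK_xM.
by apply: smoothKZ; exact: smoothK_yM.
Qed.

Lemma derive_xM b (p u : E) : smoothK b -> 'D_u (fun p : E => p.1.1 * b p) p = u.1.1 * b p + p.1.1 * 'D_u b p.
Proof.
move=> tb; have [dl Dl] := linear_is_derive continuous_x (fun k x y => erefl) p.
have := @deriveM _ _ (fun p : E => p.1.1) b p u (diff_derivable dl) (smoothK_derivable tb).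
by rewrite Dl /GRing.scale/= addrC [b p * _]mulrC.
Qed.

Lemma derive_yM b (p u : E) : smoothK b -> 'D_u (fun p : E => p.1.2 * b p) p = u.1.2 * b p + p.1.2 * 'D_u b p.
Proof.
move=> tb; have [dl Dl] := linear_is_derive continuous_y (fun k x y => erefl) p.
have := @deriveM _ _ (fun p : E => p.1.2) b p u (diff_derivable dl) (smoothK_derivable tb).
by rewrite Dl /GRing.scale/= addrC [b p * _]mulrC.
Qed.

Lemma derive_reC_zbarM v (p u : E) : smoothKC v -> 'D_u (reC (zbarM v)) p =
  u.1.1 * reC v p + p.1.1 * 'D_u (reC v) p + (u.1.2 * imC v p + p.1.2 * 'D_u (imC v) p).
Proof.
move=> [ta tb]; rewrite reC_zbarM -derive_xM// -derive_yM//.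
by apply: deriveD; apply: smoothK_derivable; [exact: smoothK_xM|exact: smoothK_yM].
Qed.

Lemma derive_imC_zbarM v (p u : E) : smoothKC v -> 'D_u (imC (zbarM v)) p =
  u.1.1 * imC v p + p.1.1 * 'D_u (imC v) p - (u.1.2 * reC v p + p.1.2 * 'D_u (reC v) p).
Proof.
move=> [ta tb]; rewrite imC_zbarM -derive_xM// -derive_yM//.
have -> : (fun p => p.1.1 * imC v p + -1 * (p.1.2 * reC v p)) =
   (fun p => p.1.1 * imC v p - (p.1.2 * reC v p)).
  by apply/funext => q; rewrite mulN1r.
by apply: deriveB; apply: smoothK_derivable; [exact: smoothK_xM|exact: smoothK_yM].
Qed.

(** L differentiates in z and t only, so it commutes with multiplication by the
antiholomorphic function zbar; the conjugate operator does not. *)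
Lemma opL_zbarM v : smoothKC v -> opL F (zbarM v) = zbarM (opL F v).
Proof.
move=> tv; apply/funext => p; apply/eqP; rewrite eq_complex; apply/andP; split; apply/eqP.
  rewrite opL_Re !derive_reC_zbarM// !derive_imC_zbarM//.
  have -> : complex.Re (zbarM (opL F v) p) = reC (zbarM (opL F v)) p by [].
  rewrite reC_zbarM reC_opL imC_opL.
  generalize ('D_(zdir e1) (reC v) p) ('D_(zdir e1) (imC v) p) ('D_(zdir e2) (reC v) p)
    ('D_(zdir e2) (imC v) p) ('D_tdir (reC v) p) ('D_tdir (imC v) p) ('D_e1 F p.1) ('D_e2 F p.1)
    (reC v p) (imC v p) => A1 B1 A2 B2 A3 B3 f1 f2 a b.
  rewrite /=; ring.
rewrite opL_Im !derive_reC_zbarM// !derive_imC_zbarM//.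
have -> : complex.Im (zbarM (opL F v) p) = imC (zbarM (opL F v)) p by [].
rewrite imC_zbarM reC_opL imC_opL.
  generalize ('D_(zdir e1) (reC v) p) ('D_(zdir e1) (imC v) p) ('D_(zdir e2) (reC v) p)
    ('D_(zdir e2) (imC v) p) ('D_tdir (reC v) p) ('D_tdir (imC v) p) ('D_e1 F p.1) ('D_e2 F p.1)
    (reC v p) (imC v p) => A1 B1 A2 B2 A3 B3 f1 f2 a b.
  rewrite /=; ring.
Qed.

Lemma iter_zbarM k v : iter k zbarM v = fun p => (toC p.1)^* ^+ k * v p.
Proof.
elim: k => [|k IH]; apply/funext => p; first by rewrite expr0 mul1r.
by rewrite iterS IH /zbarM exprS mulrA.
Qed.

Lemma smoothKC_zbarX k v : smoothKC v -> smoothKC (fun p => (toC p.1)^* ^+ k * v p).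
Proof.
by rewrite -iter_zbarM => tv; elim: k => //= k IH; exact: smoothKC_zbarM.
Qed.

Lemma opL_zbarX k v : smoothKC v ->
  opL F (fun p => (toC p.1)^* ^+ k * v p) = fun p => (toC p.1)^* ^+ k * opL F v p.
Proof.
move=> tv; rewrite -!iter_zbarM; elim: k => //= k IH.
by rewrite opL_zbarM ?IH// iter_zbarM; exact: smoothKC_zbarX.
Qed.

End TestClasses.

(** * Integration along the fibres in t *)

Section Transform.
Variable R : realType.
Local Notation E := ((R * R) * R)%type.
Variable K : set E.
Hypothesis compactK : compact K.

(** With phi a cosine or a sine this is a component of the Fourier transform;
keeping phi general treats both at once. *)
Definition fiber (phi : R -> R) (b : E -> R) (z : R * R) : R :=
  \int[lebesgueR R]_t (phi t * b (z, t)).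

Lemma bounded_image (c : E -> R) : continuous c -> exists M, forall p, K p -> `|c p| <= M.
Proof.
move=> cc; have : compact (c @` K) by apply: continuous_compact => //; exact: continuous_subspaceT.
move=> /compact_bounded[N [_ /(_ (`|N| + 1))]].
rewrite (le_lt_trans (ler_norm _)) ?ltrDl// => /(_ isT) cN.
by exists (`|N| + 1) => p Kp; apply: cN; exists p.
Qed.

Lemma fiber_off phi b z : (forall t, b (z, t) = 0) -> fiber phi b z = 0.
Proof.
move=> b0; rewrite /fiber /Rintegral; rewrite (eq_integral (fun _ => 0%E)) ?integral0// => t _.
by rewrite b0 mulr0.
Qed.

Lemma K_bounded : exists M, forall p, K p -> box M p.1 /\ `|p.2| <= M.
Proof.
have [M1 h1] := bounded_image (@continuous_x R).
have [M2 h2] := bounded_image (@continuous_y R).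
have [M3 h3] : exists M, forall p, K p -> `|p.2| <= M.
  by apply: bounded_image => p; exact: cvg_snd.
exists (`|M1| + `|M2| + `|M3|) => p Kp; split; first split.
- by rewrite (le_trans (h1 p Kp))// (le_trans (ler_norm _))// -addrA lerDl addr_ge0.
- by rewrite (le_trans (h2 p Kp))// (le_trans (ler_norm _))// -addrA addrCA lerDl addr_ge0.
- by rewrite (le_trans (h3 p Kp))// (le_trans (ler_norm _))// lerDr addr_ge0.
Qed.

Lemma C0K_bounded b : C0K K b -> exists B, forall p, `|b p| <= B.
Proof.
move=> [cb zb]; have [B hB] := bounded_image cb; exists `|B| => p.
have [Kp|Kp] := pselect (K p); last by rewrite zb// normr0.
by rewrite (le_trans (hB p Kp))// ler_norm.
Qed.

Definition cutoff (M B : R) : R -> R := fun t => B * \1_(`[- M, M]%classic) t.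

Lemma cutoff_integrable M B : (lebesgueR R).-integrable setT (EFin \o cutoff M B).
Proof.
apply: (@bounded_support_integrable _ (measurableTypeR R) R (lebesgueR R) _ `[- M, M] `|B|) => //.
- have -> : lebesgueR R `[(- M)%R, M]%classic = @lebesgue_measure R `[(- M)%R, M]%classic by [].
  by rewrite lebesgue_measure_itv; case: ifPn => _; rewrite -?EFinB ltry.
- apply: measurable_funM => //.
- move=> x; rewrite /cutoff normrM indicE normr_nat.
  by case: (x \in _); rewrite ?mulr1 ?mulr0.
by move=> x xM; rewrite /cutoff indicE memNset// mulr0.
Qed.

(** One integrable majorant for all z and all bounded phi, which serves
continuity and differentiation under the integral sign, and uniform bounds
in tau. *)
Lemma dominated b : C0K K b -> exists M B, 0 <= M /\ 0 <= B /\
  (forall z, ~ box M z -> forall t, b (z, t) = 0) /\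
  (forall z t, M < `|t| -> b (z, t) = 0) /\
  (forall z t, `|b (z, t)| <= B) /\
  (forall (phi : R -> R) z t, (forall t, `|phi t| <= 1) -> `|phi t * b (z, t)| <= cutoff M B t).
Proof.
move=> cb; have [M hM] := K_bounded; have [B hB] := C0K_bounded cb.
have B0 : 0 <= B := le_trans (normr_ge0 _) (hB (0, 0, 0)).
have zt z t : `|M| < `|t| -> b (z, t) = 0.
  move=> tM; apply: cb.2 => /hM[_ /=].
  by rewrite leNgt (le_lt_trans (ler_norm _) tM).
exists `|M|, B; do !split => //.
  move=> z zM t; apply: cb.2 => /hM[/= h _]; apply: zM; apply: box_le h.
  exact: ler_norm.
move=> phi z t phi1; rewrite /cutoff indicE.
have [tM|tM] := leP `|t| `|M|.
  rewrite mem_set ?mulr1/= ?in_itv/= -?ler_norml//.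
  by rewrite normrM -[B]mul1r ler_pM.
by rewrite zt// mulr0 normr0 mulr_ge0// ler0n.
Qed.

Lemma C0K_slice_t b z : C0K K b -> continuous (fun t : R => b (z, t)).
Proof.
move=> [cb _] t; apply: (@continuous_comp _ _ _ (fun t => (z, t)) b); last exact: cb.
exact: continuous_pairr.
Qed.

Lemma C0K_slice_x b y t : C0K K b -> continuous (fun x : R => b ((x, y), t)).
Proof.
move=> [cb _] x; apply: (@continuous_comp _ _ _ (fun x => ((x, y), t)) b); last exact: cb.
apply: (@continuous_comp _ _ _ (fun x => (x, y)) (fun z => (z, t))).
  exact: continuous_pairl.
exact: continuous_pairl.
Qed.

Lemma C0K_slice_y b x t : C0K K b -> continuous (fun y : R => b ((x, y), t)).
Proof.
move=> [cb _] y; apply: (@continuous_comp _ _ _ (fun y => ((x, y), t)) b); last exact: cb.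
apply: (@continuous_comp _ _ _ (fun y => (x, y)) (fun z => (z, t))).
  exact: continuous_pairr.
exact: continuous_pairl.
Qed.

Section FixedFrequency.
Variable phi : R -> R.
Hypothesis cphi : continuous phi.
Hypothesis phi1 : forall t, `|phi t| <= 1.

Lemma fiber_integrable b z : C0K K b ->
  (lebesgueR R).-integrable setT (EFin \o (fun t => phi t * b (z, t))).
Proof.
move=> cb; have [M [B [M0 [B0 [_ [zt [bB _]]]]]]] := dominated cb.
apply: (@line_integrable _ _ (M + B)).
- by move=> t; apply: continuousM; [exact: cphi|exact: C0K_slice_t].
- move=> t; rewrite normrM (@le_trans _ _ (1 * B))//; first by rewrite ler_pM.
  by rewrite mul1r lerDr.
- by move=> t tM; rewrite zt ?mulr0// (le_lt_trans _ tM)// lerDl.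
Qed.

Lemma fiber_add b1 b2 z : C0K K b1 -> C0K K b2 ->
  fiber phi (fun p => b1 p + b2 p) z = fiber phi b1 z + fiber phi b2 z.
Proof.
move=> h1 h2; rewrite /fiber -RintegralD//; [|exact: fiber_integrable..].
by apply: eq_Rintegral => t _; rewrite mulrDr.
Qed.

Lemma fiber_coef (c : R * R -> R) b z : C0K K b -> fiber phi (fun p => c p.1 * b p) z = c z * fiber phi b z.
Proof.
move=> h; rewrite /fiber -RintegralZl//; last exact: fiber_integrable.
by apply: eq_Rintegral => t _; rewrite mulrCA.
Qed.

Lemma fiberZ k b z : C0K K b -> fiber phi (fun p => k * b p) z = k * fiber phi b z.
Proof. exact: (fiber_coef (cst k)). Qed.

Lemma fiber_le b M B z : C0K K b ->
  (forall t, `|phi t * b (z, t)| <= cutoff M B t) ->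
  `|fiber phi b z| <= \int[lebesgueR R]_t cutoff M B t.
Proof.
move=> cb h.
apply: (le_trans (le_normr_Rintegral _ (fiber_integrable z cb))) => //.
apply: le_Rintegral => //.
- by apply: integrable_norm; exact: fiber_integrable.
- exact: cutoff_integrable.
Qed.

Lemma fiber_plane0 b : C0K K b -> plane0 (fiber phi b).
Proof.
move=> cb; have [M [B [M0 [_ [zb [_ [_ h]]]]]]] := dominated cb; split.
- move=> y x; have := @continuity_under_integral _ _ _ (lebesgueR R)
    (fun x t => phi t * b ((x, y), t)) setT measurableT (x - 1) (x + 1).
  apply.
  + by move=> x' _; exact: (fiber_integrable (x', y)).
  + by apply: aeW => t _ x' _; apply: continuousM; [exact: cvg_cst|exact: C0K_slice_x].
  + exact: (cutoff_integrable M B).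
  + by move=> x' _; apply: aeW => t _; exact: h.
  + by rewrite inE/= in_itv/= ltrDl ltrBlDr ltrDl ltr01.
- move=> x y; have := @continuity_under_integral _ _ _ (lebesgueR R)
    (fun y t => phi t * b ((x, y), t)) setT measurableT (y - 1) (y + 1).
  apply.
  + by move=> y' _; exact: (fiber_integrable (x, y')).
  + by apply: aeW => t _ y' _; apply: continuousM; [exact: cvg_cst|exact: C0K_slice_y].
  + exact: (cutoff_integrable M B).
  + by move=> y' _; apply: aeW => t _; exact: h.
  + by rewrite inE/= in_itv/= ltrDl ltrBlDr ltrDl ltr01.
set C := \int[lebesgueR R]_t cutoff M B t; exists (`|C| + M) => z; split.
  have hC := fiber_le cb (fun t => h phi z t phi1).
  by rewrite (le_trans hC)// (le_trans (ler_norm _))// lerDl.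
move=> zM; apply: fiber_off; apply: zb => h'; apply: zM; apply: box_le h'.
by rewrite lerDr.
Qed.

(** Differentiation under the integral sign, applied to the restriction of b
to the line through z with direction e. *)
Lemma fiber_is_derive b z e : rapid1 K b -> is_derive z e (fiber phi b) (fiber phi ('D_(zdir e) b) z).
Proof.
move=> [rb rw db]; have cb := rapid_C0K rb; have cd := rapid_C0K (rw e).
have [M [B [M0 [B0 [_ [_ [_ h]]]]]]] := dominated cd.
pose f (s t : R) := phi t * b (s *: e + z, t).
have df (s t : R) : is_derive s 1 (f ^~ t) (phi t * 'D_(zdir e) b (s *: e + z, t)).
  have d1 : is_derive s 1 (fun s => b (s *: e + z, t)) ('D_(zdir e) b (s *: e + z, t)).
    have := @is_derive_line _ _ (fun z => b (z, t)) z e s.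
    rewrite derive_slice_z; apply; apply: derivable_slice_z; exact: db.
  exact: is_deriveZ.
have c := @cvg_differentiation_under_integral _ _ _ (lebesgueR R) f setT measurableT
  0 (-1) 1 _ _ _ (cutoff M B) _ _ _.
have {}c : h^-1 *: (\int[lebesgueR R]_t f (h + 0) t - \int[lebesgueR R]_t f 0 t) @[h --> 0^'] -->
    fiber phi ('D_(zdir e) b) z.
  have -> : fiber phi ('D_(zdir e) b) z = \int[lebesgueR R]_t partial1of2 f 0 t.
    apply: eq_Rintegral => t _; rewrite partial1of2E.
    by have [_ ->] := df 0 t; rewrite scale0r add0r.
  apply: c.
  + by rewrite /= in_itv/= ltrN10 ltr01.
  + by move=> s _; exact: (fiber_integrable (s *: e + z)).
  + by move=> s t _ _; exact: (@ex_derive _ _ _ _ _ _ _ (df s t)).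
  + move=> t; rewrite /cutoff mulr_ge0// indicE ler0n.
  + exact: cutoff_integrable.
  + by move=> s t _ _; rewrite partial1of2E; have [_ ->] := df s t; exact: h.
have e' : (fun h : R => h^-1 *: (\int[lebesgueR R]_t f (h + 0) t - \int[lebesgueR R]_t f 0 t)) =
    (fun h : R => h^-1 *: (fiber phi b (h *: e + z) - fiber phi b z)).
  by apply/funext => s; rewrite /f addr0 scale0r add0r.
rewrite e' in c; split; first by apply/cvg_ex; eexists; exact: c.
exact: (cvg_lim _ c).
Qed.

End FixedFrequency.

End Transform.

(** * The Fourier transform in t *)

Section Frequency.
Variable R : realType.
Local Notation E := ((R * R) * R)%type.
Variable K : set E.
Hypothesis compactK : compact K.

Definition cosw (tau t : R) : R := cos (tau * t).
Definition sinw (tau t : R) : R := sin (tau * t).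

Lemma is_derive_cosw (tau t : R) : is_derive t 1 (cosw tau) (- tau * sinw tau t).
Proof.
have d : is_derive t 1 (fun t : R => tau * t) tau.
  have := @is_deriveZ _ _ _ (@id R) tau t 1 1 (is_derive_id _ _).
  by rewrite /GRing.scale/= mulr1.
have := @is_derive1_comp _ cos (fun t => tau * t) t _ _ (is_derive_cos _) d.
by rewrite mulrC mulrN mulNr.
Qed.

Lemma is_derive_sinw (tau t : R) : is_derive t 1 (sinw tau) (tau * cosw tau t).
Proof.
have d : is_derive t 1 (fun t : R => tau * t) tau.
  have := @is_deriveZ _ _ _ (@id R) tau t 1 1 (is_derive_id _ _).
  by rewrite /GRing.scale/= mulr1.
have := @is_derive1_comp _ sin (fun t => tau * t) t _ _ (is_derive_sin _) d.
by rewrite mulrC.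
Qed.

Lemma continuous_cosw tau : continuous (cosw tau).
Proof.
by move=> t; apply/differentiable_continuous/derivable1_diffP; have [] := is_derive_cosw tau t.
Qed.

Lemma continuous_sinw tau : continuous (sinw tau).
Proof.
by move=> t; apply/differentiable_continuous/derivable1_diffP; have [] := is_derive_sinw tau t.
Qed.

Lemma coswC tau t : cosw tau t = cosw t tau. Proof. by rewrite /cosw mulrC. Qed.
Lemma sinwC tau t : sinw tau t = sinw t tau. Proof. by rewrite /sinw mulrC. Qed.

Lemma cosw1 tau t : `|cosw tau t| <= 1.
Proof. by rewrite ler_norml cos_geN1 cos_le1. Qed.

Lemma sinw1 tau t : `|sinw tau t| <= 1.
Proof. by rewrite ler_norml sin_geN1 sin_le1. Qed.

Definition cosT tau b z := fiber (cosw tau) b z.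
Definition sinT tau b z := fiber (sinw tau) b z.

Lemma parts_t (phi psi : R -> R) b z : C0K K b -> C0K K ('D_tdir b) ->
  (forall p, derivable b p tdir) ->
  continuous psi -> (forall t : R, is_derive t 1 phi (psi t)) -> (forall t, `|phi t| <= 1) ->
  (lebesgueR R).-integrable setT (EFin \o (fun t => psi t * b (z, t))) ->
  fiber phi ('D_tdir b) z = - fiber psi b z.
Proof.
move=> cb cd db cpsi dphi phi1 ipsi.
have cphi : continuous phi.
  by move=> t; apply/differentiable_continuous/derivable1_diffP; have [] := dphi t.
have [M [B [M0 [B0 [_ [zt _]]]]]] := dominated compactK cb.
have dsl (t : R) : is_derive t 1 (fun t => b (z, t)) ('D_tdir b (z, t)).
  by split; [exact: derivable_slice_t|exact: derive_slice_t].
have dpr (t : R) : is_derive t 1 (fun t => phi t * b (z, t))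
    (phi t * 'D_tdir b (z, t) + psi t * b (z, t)).
  by have := is_deriveM (dphi t) (dsl t); rewrite /GRing.scale/= [b _ * _]mulrC.
apply/eqP; rewrite -addr_eq0 /fiber -RintegralD//; last exact: (fiber_integrable compactK cphi phi1 z cd).
apply/eqP; rewrite -(@integral_derive0 R (fun t => phi t * b (z, t)) M).
- by apply: eq_Rintegral => t _; have [_ ->] := dpr t.
- by move=> t; have [] := dpr t.
- have -> : 'D_1 (fun t : R => phi t * b (z, t)) = fun t => phi t * 'D_tdir b (z, t) + psi t * b (z, t).
    by apply/funext => t; have [_ ->] := dpr t.
  move=> t; apply: cvgD; apply: cvgM.
  + exact: cphi.
  + exact: (C0K_slice_t cd).
  + exact: cpsi.
  + exact: (C0K_slice_t cb).
- by move=> t tM; rewrite zt ?mulr0.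
Qed.

Lemma fiber_scale k (phi : R -> R) b z : (lebesgueR R).-integrable setT (EFin \o (fun t => phi t * b (z, t))) ->
  fiber (fun t => k * phi t) b z = k * fiber phi b z.
Proof.
by move=> i; rewrite /fiber -RintegralZl//; apply: eq_Rintegral => t _; rewrite mulrA.
Qed.

Lemma cosT_D tau b z : rapid K b -> cosT tau ('D_tdir b) z = tau * sinT tau b z.
Proof.
move=> rb; have cb := rapid_C0K rb; have isn := fiber_integrable compactK (@continuous_sinw tau) (sinw1 tau) z cb.
have ct : continuous (fun t => - tau * sinw tau t).
  by move=> t; apply: cvgM; [exact: cvg_cst|exact: continuous_sinw].
rewrite /cosT (parts_t cb (rapid_C0K (rapid_D rb)) (rapid_derivable rb) ct
  (@is_derive_cosw tau) (cosw1 tau)); first by rewrite fiber_scale// mulNr opprK.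
have := integrableZl measurableT (- tau) isn.
by apply: eq_integrable => // t _; rewrite /= -EFinM mulrA.
Qed.

Lemma sinT_D tau b z : rapid K b -> sinT tau ('D_tdir b) z = - tau * cosT tau b z.
Proof.
move=> rb; have cb := rapid_C0K rb; have icn := fiber_integrable compactK (@continuous_cosw tau) (cosw1 tau) z cb.
have ct : continuous (fun t => tau * cosw tau t).
  by move=> t; apply: cvgM; [exact: cvg_cst|exact: continuous_cosw].
rewrite /sinT (parts_t cb (rapid_C0K (rapid_D rb)) (rapid_derivable rb) ct
  (@is_derive_sinw tau) (sinw1 tau)); first by rewrite fiber_scale// mulNr.
have := integrableZl measurableT tau icn.
by apply: eq_integrable => // t _; rewrite /= -EFinM mulrA.
Qed.

Lemma fiber_bounded b : C0K K b -> exists C, forall (phi : R -> R) z, continuous phi ->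
  (forall t, `|phi t| <= 1) -> `|fiber phi b z| <= C.
Proof.
move=> cb; have [M [B [_ [_ [_ [_ [_ h]]]]]]] := dominated compactK cb.
exists (\int[lebesgueR R]_t cutoff M B t) => phi z cphi phi1.
by apply: (fiber_le compactK cphi phi1 cb) => t; exact: h.
Qed.

(** Two derivatives in t multiply the transform by - tau^2, so
(1 + tau^2) transforms b into the transform of b minus that of its second
derivative. *)
Lemma decay n b : rapid K b -> exists C, forall tau z,
  (1 + tau ^+ 2) ^+ n * `|cosT tau b z| <= C /\ (1 + tau ^+ 2) ^+ n * `|sinT tau b z| <= C.
Proof.
elim: n b => [|n IH] b rb.
  have [C hC] := fiber_bounded (rapid_C0K rb); exists C => tau z.
  rewrite expr0 !mul1r; split; apply: hC; [exact: continuous_cosw|exact: cosw1|exact: continuous_sinw|exact: sinw1].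
have [C hC] := IH b rb; have [D hD] := IH _ (rapid_D (rapid_D rb)).
exists (C + D) => tau z; have [c1 c2] := hC tau z; have [d1 d2] := hD tau z.
have p0 : 0 <= 1 + tau ^+ 2 by rewrite addr_ge0 ?sqr_ge0.
have step x y : (1 + tau ^+ 2) * x = x - y -> (1 + tau ^+ 2) ^+ n * `|x| <= C ->
    (1 + tau ^+ 2) ^+ n * `|y| <= D -> (1 + tau ^+ 2) ^+ n.+1 * `|x| <= C + D.
  move=> xy hx hy; rewrite exprSr -mulrA -[X in X * `|x|]ger0_norm// -normrM xy.
  apply: (@le_trans _ _ ((1 + tau ^+ 2) ^+ n * (`|x| + `|y|))).
    by rewrite ler_wpM2l ?exprn_ge0// ler_normB.
  by rewrite mulrDr lerD.
split; [apply: step c1 d1|apply: step c2 d2].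
- by rewrite cosT_D ?sinT_D//; [ring|exact: rapid_D].
- by rewrite sinT_D ?cosT_D//; [ring|exact: rapid_D].
Qed.

Lemma fiber_continuous_freq (w : R -> R -> R) b z : C0K K b ->
  (forall tau, continuous (w tau)) -> (forall t, continuous (w ^~ t)) -> (forall tau t, `|w tau t| <= 1) ->
  continuous (fun tau => fiber (w tau) b z).
Proof.
move=> cb cw cw' w1 tau; have [M [B [_ [_ [_ [_ [_ h]]]]]]] := dominated compactK cb.
have := @continuity_under_integral _ _ _ (lebesgueR R)
    (fun tau t => w tau t * b (z, t)) setT measurableT (tau - 1) (tau + 1).
apply.
+ by move=> tau' _; exact: (fiber_integrable compactK (cw tau') (w1 tau') z cb).
+ by apply: aeW => t _ tau' _; apply: continuousM; [exact: cw'|exact: cvg_cst].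
+ exact: (cutoff_integrable M B).
+ by move=> tau' _; apply: aeW => t _; exact: h.
+ by rewrite inE/= in_itv/= ltrDl ltrBlDr ltrDl ltr01.
Qed.

Lemma measurable_cosT b : C0K K b -> measurable_fun setT
  (fun q : (measurableTypeR R * measurableTypeR R) * measurableTypeR R => cosT q.2 b q.1).
Proof.
move=> cb; apply: caratheodory_measurable => [tau|z].
  by apply: plane0_measurable; exact: (fiber_plane0 compactK (@continuous_cosw tau) (cosw1 tau) cb).
apply: fiber_continuous_freq => //; [exact: continuous_cosw| |exact: cosw1].
by move=> t; rewrite (_ : _ ^~ t = cosw t); [exact: continuous_cosw|apply/funext => tau; exact: coswC].
Qed.

Lemma measurable_sinT b : C0K K b -> measurable_fun setT
  (fun q : (measurableTypeR R * measurableTypeR R) * measurableTypeR R => sinT q.2 b q.1).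
Proof.
move=> cb; apply: caratheodory_measurable => [tau|z].
  by apply: plane0_measurable; exact: (fiber_plane0 compactK (@continuous_sinw tau) (sinw1 tau) cb).
apply: fiber_continuous_freq => //; [exact: continuous_sinw| |exact: sinw1].
by move=> t; rewrite (_ : _ ^~ t = sinw t); [exact: continuous_sinw|apply/funext => tau; exact: sinwC].
Qed.

(** Real and imaginary parts of the Fourier transform of v. *)
Definition hatRe tau (v : E -> R[i]) z := cosT tau (reC v) z + sinT tau (imC v) z.
Definition hatIm tau (v : E -> R[i]) z := cosT tau (imC v) z - sinT tau (reC v) z.

Lemma fourierE v z tau : C0K K (reC v) -> C0K K (imC v) ->
  fourier_t v z tau = hatRe tau v z +i* hatIm tau v z.
Proof.
move=> ca cb.
have icn b := fiber_integrable compactK (@continuous_cosw tau) (cosw1 tau) z (b := b).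
have isn b := fiber_integrable compactK (@continuous_sinw tau) (sinw1 tau) z (b := b).
rewrite /fourier_t /cintegral /hatRe /hatIm /cosT /sinT /fiber; congr (_ +i* _).
  rewrite -RintegralD//; [|exact: icn|exact: isn].
  apply: eq_Rintegral => t _; rewrite /expi cosN sinN /cosw /sinw /reC /imC.
  by case: (v (z, t)) => x y /=; rewrite mulNr opprK.
rewrite -RintegralB//; [|exact: icn|exact: isn].
apply: eq_Rintegral => t _; rewrite /expi cosN sinN /cosw /sinw /reC /imC.
by case: (v (z, t)) => x y /=; rewrite mulNr.
Qed.

End Frequency.

(** * The transformed operators *)

Section Null.
Variable R : realType.
Implicit Types f g : R * R -> R.

Lemma plane0N f : plane0 f -> plane0 (fun z => - f z).
Proof. by move=> /(plane0Z (-1)); congr plane0; apply/funext => z; rewrite mulN1r. Qed.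

Lemma plane0B f g : plane0 f -> plane0 g -> plane0 (fun z => f z - g z).
Proof. by move=> Hf Hg; apply: plane0D => //; exact: plane0N. Qed.

Lemma plane_intB f g : plane0 f -> plane0 g -> plane_int (fun z => f z - g z) = plane_int f - plane_int g.
Proof.
move=> Hf Hg; rewrite plane_intD//; last exact: plane0N.
congr (_ + _); rewrite -mulN1r -plane_intZ//; apply: eq_plane_int => z.
by rewrite mulN1r.
Qed.

(** Integration by parts is organised as adding divergences, which are
[null], to an integrand. *)
Definition null f := plane0 f /\ plane_int f = 0.

Lemma nullD f g : null f -> null g -> null (fun z => f z + g z).
Proof. by move=> [Hf f0] [Hg g0]; split; [exact: plane0D|rewrite plane_intD// f0 g0 addr0]. Qed.

Lemma nullB f g : null f -> null g -> null (fun z => f z - g z).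
Proof. by move=> [Hf f0] [Hg g0]; split; [exact: plane0B|rewrite plane_intB// f0 g0 subr0]. Qed.

Lemma nullZ k f : null f -> null (fun z => k * f z).
Proof. by move=> [Hf f0]; split; [exact: plane0Z|rewrite plane_intZ// f0 mulr0]. Qed.

Lemma null_D1 f g : plane1 f -> plane1 g -> null (fun z => 'D_e1 f z * g z + f z * 'D_e1 g z).
Proof.
move=> Hf Hg; have Hfg := plane1M Hf Hg.
rewrite (_ : (fun z => _) = 'D_e1 (fun z => f z * g z)).
  by split; [exact: plane1_D1|exact: plane_int_derive1].
by apply/funext => z; rewrite plane1M_D1.
Qed.

Lemma null_D2 f g : plane1 f -> plane1 g -> null (fun z => 'D_e2 f z * g z + f z * 'D_e2 g z).
Proof.
move=> Hf Hg; have Hfg := plane1M Hf Hg.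
rewrite (_ : (fun z => _) = 'D_e2 (fun z => f z * g z)).
  by split; [exact: plane1_D2|exact: plane_int_derive2].
by apply/funext => z; rewrite plane1M_D2.
Qed.

Lemma plane_int_null_eq f g h : plane0 f -> plane0 g -> null h ->
  (forall z, f z = g z + h z) -> plane_int f = plane_int g.
Proof.
move=> Hf Hg [Hh h0] fgh.
by rewrite (eq_plane_int fgh) plane_intD// h0 addr0.
Qed.

End Null.

Section FixedTau.
Variable R : realType.
Local Notation E := ((R * R) * R)%type.
Variables (U : set (R * R)) (K : set E).
Hypothesis openU : open U.
Hypothesis compactK : compact K.
Hypothesis KU : forall p, K p -> U p.1.
Variable F : R * R -> R.
Hypothesis smoothF : smooth_on U F.
Variable tau : R.

Let closedK : closed K.
Proof. by apply: compact_closed => //; exact: norm_hausdorff. Qed.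

Let plane0cosT b : C0K K b -> plane0 (cosT tau b).
Proof. exact: (fiber_plane0 compactK (@continuous_cosw R tau) (cosw1 tau)). Qed.

Let plane0sinT b : C0K K b -> plane0 (sinT tau b).
Proof. exact: (fiber_plane0 compactK (@continuous_sinw R tau) (sinw1 tau)). Qed.

Let dcosT b z e : rapid1 K b -> is_derive z e (cosT tau b) (cosT tau ('D_(zdir e) b) z).
Proof. exact: (fiber_is_derive compactK (@continuous_cosw R tau) (cosw1 tau)). Qed.

Let dsinT b z e : rapid1 K b -> is_derive z e (sinT tau b) (sinT tau ('D_(zdir e) b) z).
Proof. exact: (fiber_is_derive compactK (@continuous_sinw R tau) (sinw1 tau)). Qed.

Lemma plane0_hatRe v : rapidC K v -> plane0 (hatRe tau v).
Proof.
by move=> [ra rb]; apply: plane0D; [apply: plane0cosT|apply: plane0sinT]; exact: rapid_C0K.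
Qed.

Lemma plane0_hatIm v : rapidC K v -> plane0 (hatIm tau v).
Proof.
by move=> [ra rb]; apply: plane0B; [apply: plane0cosT|apply: plane0sinT]; exact: rapid_C0K.
Qed.

Lemma derive_hatRe v z e : rapid1C K v -> 'D_e (hatRe tau v) z =
  cosT tau ('D_(zdir e) (reC v)) z + sinT tau ('D_(zdir e) (imC v)) z.
Proof.
by move=> [wa wb]; have [_ ->] := is_deriveD (dcosT z e wa) (dsinT z e wb).
Qed.

Lemma derive_hatIm v z e : rapid1C K v -> 'D_e (hatIm tau v) z =
  cosT tau ('D_(zdir e) (imC v)) z - sinT tau ('D_(zdir e) (reC v)) z.
Proof.
by move=> [wa wb]; have [_ ->] := is_deriveB (dcosT z e wb) (dsinT z e wa).
Qed.

Lemma plane1_hatRe v : rapid1C K v -> plane1 (hatRe tau v).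
Proof.
move=> wv; have [wa wb] := wv; split.
- by apply: plane0_hatRe; exact: rapid1C_rapidC.
- rewrite (_ : 'D_e1 _ = fun z => cosT tau ('D_(zdir e1) (reC v)) z + sinT tau ('D_(zdir e1) (imC v)) z).
    by apply: plane0D; [apply: plane0cosT|apply: plane0sinT]; apply: rapid_C0K; exact: rapid1_rapidD.
  by apply/funext => z; exact: derive_hatRe.
- rewrite (_ : 'D_e2 _ = fun z => cosT tau ('D_(zdir e2) (reC v)) z + sinT tau ('D_(zdir e2) (imC v)) z).
    by apply: plane0D; [apply: plane0cosT|apply: plane0sinT]; apply: rapid_C0K; exact: rapid1_rapidD.
  by apply/funext => z; exact: derive_hatRe.
have d z e : derivable (hatRe tau v) z e by have [] := is_deriveD (dcosT z e wa) (dsinT z e wb).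
by move=> z; split.
Qed.

Lemma plane1_hatIm v : rapid1C K v -> plane1 (hatIm tau v).
Proof.
move=> wv; have [wa wb] := wv; split.
- by apply: plane0_hatIm; exact: rapid1C_rapidC.
- rewrite (_ : 'D_e1 _ = fun z => cosT tau ('D_(zdir e1) (imC v)) z - sinT tau ('D_(zdir e1) (reC v)) z).
    by apply: plane0B; [apply: plane0cosT|apply: plane0sinT]; apply: rapid_C0K; exact: rapid1_rapidD.
  by apply/funext => z; exact: derive_hatIm.
- rewrite (_ : 'D_e2 _ = fun z => cosT tau ('D_(zdir e2) (imC v)) z - sinT tau ('D_(zdir e2) (reC v)) z).
    by apply: plane0B; [apply: plane0cosT|apply: plane0sinT]; apply: rapid_C0K; exact: rapid1_rapidD.
  by apply/funext => z; exact: derive_hatIm.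
have d z e : derivable (hatIm tau v) z e by have [] := is_deriveB (dcosT z e wb) (dsinT z e wa).
by move=> z; split.
Qed.

Lemma fiber_first_order phi (b1 b2 b3 b4 : E -> R) (k2 k3 k4 : R) (c c' : R * R -> R) z :
  continuous phi -> (forall t, `|phi t| <= 1) ->
  coef0 U c -> coef0 U c' ->
  C0K K b1 -> C0K K b2 -> C0K K b3 -> C0K K b4 ->
  fiber phi (fun p => 2^-1 * (b1 p + k2 * b2 p + c p.1 * (k3 * b3 p) + c' p.1 * (k4 * b4 p))) z =
  2^-1 * (fiber phi b1 z + k2 * fiber phi b2 z + c z * (k3 * fiber phi b3 z) + c' z * (k4 * fiber phi b4 z)).
Proof.
move=> cphi phi1 cc cc' h1 h2 h3 h4.
have hz k b : C0K K b -> C0K K (fun p => k * b p).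
  by move=> hb; exact: (C0K_coef closedK KU (@coef0_cst _ U k) hb).
have hc3 := C0K_coef closedK KU cc (hz k3 _ h3).
have hc4 := C0K_coef closedK KU cc' (hz k4 _ h4).
have h12 := C0KD h1 (hz k2 _ h2).
have t := fiber_coef compactK cphi phi1; have tz := fiberZ compactK cphi phi1.
have ta := fiber_add compactK cphi phi1.
rewrite tz; last exact: C0KD (C0KD h12 hc3) hc4.
rewrite (ta _ _ z (C0KD h12 hc3) hc4) (ta _ _ z h12 hc3) (ta _ _ z h1 (hz k2 _ h2)).
rewrite (t c _ z (hz k3 _ h3)) (t c' _ z (hz k4 _ h4)).
by rewrite (tz _ _ _ h2) (tz _ _ _ h3) (tz _ _ _ h4).
Qed.

Let cF e : coef0 U ('D_e F). Proof. by have [] := smooth_coef1 e smoothF. Qed.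

Let cosT_F (b1 b2 b3 b4 : E -> R) (k2 k3 k4 : R) e e' z :
  C0K K b1 -> C0K K b2 -> C0K K b3 -> C0K K b4 ->
  cosT tau (fun p => 2^-1 * (b1 p + k2 * b2 p + 'D_e F p.1 * (k3 * b3 p) + 'D_e' F p.1 * (k4 * b4 p))) z =
  2^-1 * (cosT tau b1 z + k2 * cosT tau b2 z + 'D_e F z * (k3 * cosT tau b3 z) + 'D_e' F z * (k4 * cosT tau b4 z)).
Proof. exact: (@fiber_first_order (cosw tau) b1 b2 b3 b4 k2 k3 k4 _ _ z
  (@continuous_cosw R tau) (cosw1 tau) (@cF e) (@cF e')). Qed.

Let sinT_F (b1 b2 b3 b4 : E -> R) (k2 k3 k4 : R) e e' z :
  C0K K b1 -> C0K K b2 -> C0K K b3 -> C0K K b4 ->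
  sinT tau (fun p => 2^-1 * (b1 p + k2 * b2 p + 'D_e F p.1 * (k3 * b3 p) + 'D_e' F p.1 * (k4 * b4 p))) z =
  2^-1 * (sinT tau b1 z + k2 * sinT tau b2 z + 'D_e F z * (k3 * sinT tau b3 z) + 'D_e' F z * (k4 * sinT tau b4 z)).
Proof. exact: (@fiber_first_order (sinw tau) b1 b2 b3 b4 k2 k3 k4 _ _ z
  (@continuous_sinw R tau) (sinw1 tau) (@cF e) (@cF e')). Qed.

Local Notation f1 := ('D_e1 F).
Local Notation f2 := ('D_e2 F).

Section Hats.
Variable v : E -> R[i].
Hypothesis wv : rapid1C K v.

Let p := hatRe tau v.
Let q := hatIm tau v.

Let ca : C0K K (reC v). Proof. by have [[r _ _] _] := wv; exact: rapid_C0K. Qed.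
Let cb : C0K K (imC v). Proof. by have [_ [r _ _]] := wv; exact: rapid_C0K. Qed.
Let ra : rapid K (reC v). Proof. by have [[r _ _] _] := wv. Qed.
Let rb : rapid K (imC v). Proof. by have [_ [r _ _]] := wv. Qed.
Let cza e : C0K K ('D_(zdir e) (reC v)).
Proof. by have [[_ r _] _] := wv; exact: rapid_C0K. Qed.
Let czb e : C0K K ('D_(zdir e) (imC v)).
Proof. by have [_ [_ r _]] := wv; exact: rapid_C0K. Qed.
Let cta : C0K K ('D_tdir (reC v)). Proof. exact/rapid_C0K/rapid_D. Qed.
Let ctb : C0K K ('D_tdir (imC v)). Proof. exact/rapid_C0K/rapid_D. Qed.

(** The next four identities say that, at frequency tau, L and its conjugate
act as d/dz - tau F_z and d/dzbar + tau F_zbar. *)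
Lemma hatRe_opL z : hatRe tau (opL F v) z = 2^-1 *
  ('D_e1 p z + 'D_e2 q z - tau * (f1 z * p z + f2 z * q z)).
Proof.
rewrite /p /q derive_hatRe// derive_hatIm// /hatRe /hatIm reC_opL imC_opL.
rewrite (cosT_F 1 1 (-1) e2 e1 z (cza e1) (czb e2) cta ctb) (sinT_F (-1) 1 1 e1 e2 z (czb e1) (cza e2) cta ctb).
rewrite (cosT_D compactK tau z ra) (cosT_D compactK tau z rb)
  (sinT_D compactK tau z ra) (sinT_D compactK tau z rb).
generalize (cosT tau ('D_(zdir e1) (reC v)) z) (cosT tau ('D_(zdir e2) (reC v)) z)
  (cosT tau ('D_(zdir e1) (imC v)) z) (cosT tau ('D_(zdir e2) (imC v)) z)
  (sinT tau ('D_(zdir e1) (reC v)) z) (sinT tau ('D_(zdir e2) (reC v)) z)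
  (sinT tau ('D_(zdir e1) (imC v)) z) (sinT tau ('D_(zdir e2) (imC v)) z)
  (cosT tau (reC v) z) (sinT tau (reC v) z) (cosT tau (imC v) z) (sinT tau (imC v) z) (f1 z) (f2 z).
move=> *; ring.
Qed.

Lemma hatIm_opL z : hatIm tau (opL F v) z = 2^-1 *
  ('D_e1 q z - 'D_e2 p z - tau * (f1 z * q z - f2 z * p z)).
Proof.
rewrite /p /q derive_hatRe// derive_hatIm// /hatRe /hatIm reC_opL imC_opL.
rewrite (sinT_F 1 1 (-1) e2 e1 z (cza e1) (czb e2) cta ctb) (cosT_F (-1) 1 1 e1 e2 z (czb e1) (cza e2) cta ctb).
rewrite (cosT_D compactK tau z ra) (cosT_D compactK tau z rb)
  (sinT_D compactK tau z ra) (sinT_D compactK tau z rb).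
generalize (cosT tau ('D_(zdir e1) (reC v)) z) (cosT tau ('D_(zdir e2) (reC v)) z)
  (cosT tau ('D_(zdir e1) (imC v)) z) (cosT tau ('D_(zdir e2) (imC v)) z)
  (sinT tau ('D_(zdir e1) (reC v)) z) (sinT tau ('D_(zdir e2) (reC v)) z)
  (sinT tau ('D_(zdir e1) (imC v)) z) (sinT tau ('D_(zdir e2) (imC v)) z)
  (cosT tau (reC v) z) (sinT tau (reC v) z) (cosT tau (imC v) z) (sinT tau (imC v) z) (f1 z) (f2 z).
move=> *; ring.
Qed.

Lemma hatRe_opLbar z : hatRe tau (opLbar F v) z = 2^-1 *
  ('D_e1 p z - 'D_e2 q z + tau * (f1 z * p z - f2 z * q z)).
Proof.
rewrite /p /q derive_hatRe// derive_hatIm// /hatRe /hatIm reC_opLbar imC_opLbar.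
rewrite (cosT_F (-1) 1 1 e2 e1 z (cza e1) (czb e2) cta ctb) (sinT_F 1 (-1) 1 e1 e2 z (czb e1) (cza e2) cta ctb).
rewrite (cosT_D compactK tau z ra) (cosT_D compactK tau z rb)
  (sinT_D compactK tau z ra) (sinT_D compactK tau z rb).
generalize (cosT tau ('D_(zdir e1) (reC v)) z) (cosT tau ('D_(zdir e2) (reC v)) z)
  (cosT tau ('D_(zdir e1) (imC v)) z) (cosT tau ('D_(zdir e2) (imC v)) z)
  (sinT tau ('D_(zdir e1) (reC v)) z) (sinT tau ('D_(zdir e2) (reC v)) z)
  (sinT tau ('D_(zdir e1) (imC v)) z) (sinT tau ('D_(zdir e2) (imC v)) z)
  (cosT tau (reC v) z) (sinT tau (reC v) z) (cosT tau (imC v) z) (sinT tau (imC v) z) (f1 z) (f2 z).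
move=> *; ring.
Qed.

Lemma hatIm_opLbar z : hatIm tau (opLbar F v) z = 2^-1 *
  ('D_e1 q z + 'D_e2 p z + tau * (f1 z * q z + f2 z * p z)).
Proof.
rewrite /p /q derive_hatRe// derive_hatIm// /hatRe /hatIm reC_opLbar imC_opLbar.
rewrite (sinT_F (-1) 1 1 e2 e1 z (cza e1) (czb e2) cta ctb) (cosT_F 1 (-1) 1 e1 e2 z (czb e1) (cza e2) cta ctb).
rewrite (cosT_D compactK tau z ra) (cosT_D compactK tau z rb)
  (sinT_D compactK tau z ra) (sinT_D compactK tau z rb).
generalize (cosT tau ('D_(zdir e1) (reC v)) z) (cosT tau ('D_(zdir e2) (reC v)) z)
  (cosT tau ('D_(zdir e1) (imC v)) z) (cosT tau ('D_(zdir e2) (imC v)) z)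
  (sinT tau ('D_(zdir e1) (reC v)) z) (sinT tau ('D_(zdir e2) (reC v)) z)
  (sinT tau ('D_(zdir e1) (imC v)) z) (sinT tau ('D_(zdir e2) (imC v)) z)
  (cosT tau (reC v) z) (sinT tau (reC v) z) (cosT tau (imC v) z) (sinT tau (imC v) z) (f1 z) (f2 z).
move=> *; ring.
Qed.

End Hats.
End FixedTau.

(* Keeps unification from comparing distinct directions by unfolding them. *)
Opaque e1 e2 zdir tdir.

(** * Adjoints and the commutator *)

Section Identities.
Variable R : realType.
Local Notation E := ((R * R) * R)%type.
Variables (U : set (R * R)) (K : set E).
Hypothesis openU : open U.
Hypothesis compactK : compact K.
Hypothesis KU : forall p, K p -> U p.1.
Variable F : R * R -> R.
Hypothesis smoothF : smooth_on U F.
Variable tau : R.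

Let closedK : closed K.
Proof. by apply: compact_closed => //; exact: norm_hausdorff. Qed.

Local Notation P := (hatRe tau).
Local Notation Q := (hatIm tau).
Local Notation f1 := ('D_e1 F).
Local Notation f2 := ('D_e2 F).

Let cosT_coef c b z : C0K K b -> cosT tau (fun p => c p.1 * b p) z = c z * cosT tau b z.
Proof. exact: (fiber_coef compactK (@continuous_cosw R tau) (cosw1 tau)). Qed.

Let sinT_coef c b z : C0K K b -> sinT tau (fun p => c p.1 * b p) z = c z * sinT tau b z.
Proof. exact: (fiber_coef compactK (@continuous_sinw R tau) (sinw1 tau)). Qed.

Let cosT_add b b' z : C0K K b -> C0K K b' -> cosT tau (fun p => b p + b' p) z = cosT tau b z + cosT tau b' z.
Proof. exact: (fiber_add compactK (@continuous_cosw R tau) (cosw1 tau)). Qed.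

Let sinT_add b b' z : C0K K b -> C0K K b' -> sinT tau (fun p => b p + b' p) z = sinT tau b z + sinT tau b' z.
Proof. exact: (fiber_add compactK (@continuous_sinw R tau) (sinw1 tau)). Qed.

Lemma hatRe_zmul c v z : rapidC K v -> P (zmul c v) z = c z * P v z.
Proof.
move=> [/rapid_C0K ca /rapid_C0K cb].
by rewrite /hatRe reC_zmul imC_zmul cosT_coef// sinT_coef// mulrDr.
Qed.

Lemma hatIm_zmul c v z : rapidC K v -> Q (zmul c v) z = c z * Q v z.
Proof.
move=> [/rapid_C0K ca /rapid_C0K cb].
by rewrite /hatIm reC_zmul imC_zmul cosT_coef// sinT_coef// mulrBr.
Qed.

Lemma plane0_cP c v : coef0 U c -> rapidC K v -> plane0 (fun z => c z * P v z).
Proof.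
move=> cc rv; have := plane0_hatRe compactK tau (rapidC_zmul closedK KU cc rv).
by congr plane0; apply/funext => z; rewrite hatRe_zmul.
Qed.

Lemma plane0_cQ c v : coef0 U c -> rapidC K v -> plane0 (fun z => c z * Q v z).
Proof.
move=> cc rv; have := plane0_hatIm compactK tau (rapidC_zmul closedK KU cc rv).
by congr plane0; apply/funext => z; rewrite hatIm_zmul.
Qed.

Lemma plane1_cP c v : coef1 U c -> rapid1C K v -> plane1 (fun z => c z * P v z).
Proof.
move=> cc wv; have := plane1_hatRe compactK tau (rapid1C_zmul closedK KU cc wv).
by congr plane1; apply/funext => z; rewrite hatRe_zmul//; exact: rapid1C_rapidC.
Qed.

Lemma plane1_cQ c v : coef1 U c -> rapid1C K v -> plane1 (fun z => c z * Q v z).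
Proof.
move=> cc wv; have := plane1_hatIm compactK tau (rapid1C_zmul closedK KU cc wv).
by congr plane1; apply/funext => z; rewrite hatIm_zmul//; exact: rapid1C_rapidC.
Qed.

Lemma derive_coef_slices c e b : coef1 U c -> rapid1 K b -> 'D_(zdir e) (fun p => c p.1 * b p) =
  fun p => 'D_e c p.1 * b p + c p.1 * 'D_(zdir e) b p.
Proof.
move=> cc wb; apply/funext => p.
by have [_ ->] := is_derive_coef closedK KU e p cc wb.
Qed.

Lemma derive_cP c v z e : coef1 U c -> rapid1C K v ->
  'D_e (fun z : R * R => c z * P v z) z = 'D_e c z * P v z + c z * 'D_e (P v) z.
Proof.
move=> cc wv; have [wa wb] := wv.
have -> : (fun z => c z * P v z) = P (zmul c v).
  by apply/funext => y; rewrite hatRe_zmul//; exact: rapid1C_rapidC.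
rewrite (derive_hatRe compactK tau z e (rapid1C_zmul closedK KU cc wv)) (derive_hatRe compactK tau z e wv).
rewrite reC_zmul imC_zmul !derive_coef_slices// /hatRe.
have [c0 c1 _] := cc; have [ra wra _] := wa; have [rb wrb _] := wb.
have [xa ya] := (rapid_C0K ra, rapid_C0K (wra e)).
have [xb yb] := (rapid_C0K rb, rapid_C0K (wrb e)).
have cM := @C0K_coef _ _ _ closedK KU.
rewrite (cosT_add z (cM _ _ (c1 e) xa) (cM _ _ c0 ya)) (sinT_add z (cM _ _ (c1 e) xb) (cM _ _ c0 yb)).
rewrite (cosT_coef ('D_e c) z xa) (cosT_coef c z ya) (sinT_coef ('D_e c) z xb) (sinT_coef c z yb).
by rewrite !mulrDr addrACA.
Qed.

Lemma derive_cQ c v z e : coef1 U c -> rapid1C K v ->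
  'D_e (fun z : R * R => c z * Q v z) z = 'D_e c z * Q v z + c z * 'D_e (Q v) z.
Proof.
move=> cc wv; have [wa wb] := wv.
have -> : (fun z => c z * Q v z) = Q (zmul c v).
  by apply/funext => y; rewrite hatIm_zmul//; exact: rapid1C_rapidC.
rewrite (derive_hatIm compactK tau z e (rapid1C_zmul closedK KU cc wv)) (derive_hatIm compactK tau z e wv).
rewrite reC_zmul imC_zmul !derive_coef_slices// /hatIm.
have [c0 c1 _] := cc; have [ra wra _] := wa; have [rb wrb _] := wb.
have [xa ya] := (rapid_C0K ra, rapid_C0K (wra e)).
have [xb yb] := (rapid_C0K rb, rapid_C0K (wrb e)).
have cM := @C0K_coef _ _ _ closedK KU.
rewrite (cosT_add z (cM _ _ (c1 e) xb) (cM _ _ c0 yb)) (sinT_add z (cM _ _ (c1 e) xa) (cM _ _ c0 ya)).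
rewrite (cosT_coef ('D_e c) z xb) (cosT_coef c z yb) (sinT_coef ('D_e c) z xa) (sinT_coef c z ya).
by rewrite !mulrBr opprD addrACA.
Qed.

Definition mod2 (v : E -> R[i]) z := P v z ^+ 2 + Q v z ^+ 2.
Definition inner2 (u v : E -> R[i]) z := P u z * P v z + Q u z * Q v z.

Lemma plane0_inner2 u v : rapidC K u -> rapidC K v -> plane0 (inner2 u v).
Proof.
move=> ru rv; apply: plane0D; apply: plane0M.
- exact: (plane0_hatRe compactK tau ru).
- exact: (plane0_hatRe compactK tau rv).
- exact: (plane0_hatIm compactK tau ru).
- exact: (plane0_hatIm compactK tau rv).
Qed.

Lemma plane0_mod2 v : rapidC K v -> plane0 (mod2 v).
Proof. by move=> rv; exact: (plane0_inner2 rv rv). Qed.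

Lemma plane0_coef_mod2 c v : coef0 U c -> rapidC K v -> plane0 (fun z => c z * mod2 v z).
Proof.
move=> cc rv; rewrite (_ : (fun z => _) = fun z => (c z * P v z) * P v z + (c z * Q v z) * Q v z).
  apply: plane0D; apply: plane0M.
  - exact: (plane0_cP cc rv).
  - exact: (plane0_hatRe compactK tau rv).
  - exact: (plane0_cQ cc rv).
  - exact: (plane0_hatIm compactK tau rv).
by apply/funext => z; rewrite /mod2 mulrDr -!mulrA.
Qed.

(** The sum of the two integrands is a divergence: the zeroth order terms in
tau cancel because tau F_z and tau F_zbar are conjugate to each other. *)
Lemma adjoint_opL u w : rapid1C K u -> rapid1C K w ->
  plane_int (inner2 (opL F u) w) = - plane_int (inner2 u (opLbar F w)).
Proof.
move=> wu ww; have ru := rapid1C_rapidC wu; have rw := rapid1C_rapidC ww.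
have rLu := rapidC_opL closedK KU smoothF wu; have rLw := rapidC_opLbar closedK KU smoothF ww.
apply/eqP; rewrite -addr_eq0 -plane_intD; [|exact: plane0_inner2|exact: plane0_inner2].
have [Pu Qu] := (plane1_hatRe compactK tau wu, plane1_hatIm compactK tau wu).
have [Pw Qw] := (plane1_hatRe compactK tau ww, plane1_hatIm compactK tau ww).
have [_ <-] := nullZ 2^-1 (nullB (nullD (nullD (null_D1 Pu Pw) (null_D2 Qu Pw)) (null_D1 Qu Qw))
  (null_D2 Pu Qw)).
apply/eqP; apply: eq_plane_int => z; rewrite /inner2.
rewrite (hatRe_opL compactK KU smoothF tau wu) (hatIm_opL compactK KU smoothF tau wu).
rewrite (hatRe_opLbar compactK KU smoothF tau ww) (hatIm_opLbar compactK KU smoothF tau ww).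
generalize ('D_e1 (P u) z) ('D_e2 (P u) z) ('D_e1 (Q u) z) ('D_e2 (Q u) z) (P u z) (Q u z)
  ('D_e1 (P w) z) ('D_e2 (P w) z) ('D_e1 (Q w) z) ('D_e2 (Q w) z) (P w z) (Q w z) (f1 z) (f2 z).
by move=> *; ring.
Qed.

Lemma adjoint_opLbar u w : rapid1C K u -> rapid1C K w ->
  plane_int (inner2 (opLbar F u) w) = - plane_int (inner2 u (opL F w)).
Proof.
move=> wu ww; have ru := rapid1C_rapidC wu; have rw := rapid1C_rapidC ww.
have rLu := rapidC_opLbar closedK KU smoothF wu; have rLw := rapidC_opL closedK KU smoothF ww.
apply/eqP; rewrite -addr_eq0 -plane_intD; [|exact: plane0_inner2|exact: plane0_inner2].
have [Pu Qu] := (plane1_hatRe compactK tau wu, plane1_hatIm compactK tau wu).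
have [Pw Qw] := (plane1_hatRe compactK tau ww, plane1_hatIm compactK tau ww).
have [_ <-] := nullZ 2^-1 (nullD (nullB (nullD (null_D1 Pu Pw) (null_D1 Qu Qw)) (null_D2 Qu Pw))
  (null_D2 Pu Qw)).
apply/eqP; apply: eq_plane_int => z; rewrite /inner2.
rewrite (hatRe_opLbar compactK KU smoothF tau wu) (hatIm_opLbar compactK KU smoothF tau wu).
rewrite (hatRe_opL compactK KU smoothF tau ww) (hatIm_opL compactK KU smoothF tau ww).
generalize ('D_e1 (P u) z) ('D_e2 (P u) z) ('D_e1 (Q u) z) ('D_e2 (Q u) z) (P u z) (Q u z)
  ('D_e1 (P w) z) ('D_e2 (P w) z) ('D_e1 (Q w) z) ('D_e2 (Q w) z) (P w z) (Q w z) (f1 z) (f2 z).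
by move=> *; ring.
Qed.

(** The divergence of c |w|^2 in the first coordinate, with |w|^2 the sum of
two squares. *)
Lemma null_coef1 c v : coef1 U c -> rapid1C K v -> null (fun z => 'D_e1 c z * mod2 v z +
  2 * c z * (P v z * 'D_e1 (P v) z + Q v z * 'D_e1 (Q v) z)).
Proof.
move=> cc wv; have [hP hQ] := (plane1_hatRe compactK tau wv, plane1_hatIm compactK tau wv).
have := nullD (null_D1 (plane1_cP cc wv) hP) (null_D1 (plane1_cQ cc wv) hQ).
congr null; apply/funext => z.
have := derive_cP z e1 cc wv; have := derive_cQ z e1 cc wv; rewrite /mod2.
generalize ('D_e1 (fun z : R * R => c z * P v z) z) ('D_e1 (fun z : R * R => c z * Q v z) z)
  ('D_e1 (P v) z) ('D_e1 (Q v) z) (P v z) (Q v z) (c z) ('D_e1 c z).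
by move=> x y *; subst x y; ring.
Qed.

Lemma null_coef2 c v : coef1 U c -> rapid1C K v -> null (fun z => 'D_e2 c z * mod2 v z +
  2 * c z * (P v z * 'D_e2 (P v) z + Q v z * 'D_e2 (Q v) z)).
Proof.
move=> cc wv; have [hP hQ] := (plane1_hatRe compactK tau wv, plane1_hatIm compactK tau wv).
have := nullD (null_D2 (plane1_cP cc wv) hP) (null_D2 (plane1_cQ cc wv) hQ).
congr null; apply/funext => z.
have := derive_cP z e2 cc wv; have := derive_cQ z e2 cc wv; rewrite /mod2.
generalize ('D_e2 (fun z : R * R => c z * P v z) z) ('D_e2 (fun z : R * R => c z * Q v z) z)
  ('D_e2 (P v) z) ('D_e2 (Q v) z) (P v z) (Q v z) (c z) ('D_e2 c z).
by move=> x y *; subst x y; ring.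
Qed.

Definition lap z := 'D_e1 f1 z + 'D_e2 f2 z.

(** The pointwise form of [commutator].  Here a_j and b_j stand
for the derivatives d_j p and d_j q of the two parts of w, g_j for d_j F, l_j
for d_j d_j F, and x and y for the two mixed second derivatives of q.  Apart
from the curvature term the right-hand side is a sum of divergences: that of
(p d_2 q, - p d_1 q), whose second order part cancels, and that of |w|^2 grad F. *)
Lemma commutator_density (t a1 a2 b1 b2 p q l1 l2 g1 g2 x y : R) : x = y ->
  (2^-1 * (a1 + b2 - t * (g1 * p + g2 * q))) ^+ 2 +
  (2^-1 * (b1 - a2 - t * (g1 * q - g2 * p))) ^+ 2 -
  ((2^-1 * (a1 - b2 + t * (g1 * p - g2 * q))) ^+ 2 +
   (2^-1 * (b1 + a2 + t * (g1 * q + g2 * p))) ^+ 2) =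
  t / 2 * ((l1 + l2) * (p ^+ 2 + q ^+ 2)) +
  (a1 * b2 + p * x - (a2 * b1 + p * y) -
   t / 2 * (l1 * (p ^+ 2 + q ^+ 2) + 2 * g1 * (p * a1 + q * b1) +
            (l2 * (p ^+ 2 + q ^+ 2) + 2 * g2 * (p * a2 + q * b2)))).
Proof. by move=> ->; field. Qed.

(** Integrate [commutator_density].  The mixed derivatives of the transform
agree because they are transforms of mixed derivatives of the smooth v. *)
Lemma commutator v : smoothKC K v ->
  plane_int (mod2 (opL F v)) - plane_int (mod2 (opLbar F v)) = tau / 2 * plane_int (fun z => lap z * mod2 v z).
Proof.
move=> tv; have wv := smoothKC_rapid1C closedK tv; have rv := rapid1C_rapidC wv.
have rL := rapidC_opL closedK KU smoothF wv; have rLb := rapidC_opLbar closedK KU smoothF wv.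
have cf e : coef1 U ('D_e F) := smooth_coef1 e smoothF.
have clap : coef0 U lap.
  by apply: coef0D; [have [_ h _] := cf e1; exact: h|have [_ h _] := cf e2; exact: h].
have Hl := plane0_coef_mod2 clap rv.
have [hP hQ] := (plane1_hatRe compactK tau wv, plane1_hatIm compactK tau wv).
have [Q1 Q2 Qxy] : [/\ plane1 ('D_e1 (Q v)), plane1 ('D_e2 (Q v)) &
    forall z, 'D_e1 ('D_e2 (Q v)) z = 'D_e2 ('D_e1 (Q v)) z].
  have [ta tb] := tv.
  pose v' e : E -> R[i] := fun p => 'D_(zdir e) (reC v) p +i* 'D_(zdir e) (imC v) p.
  have tv' e : smoothKC K (v' e).
    by split; [exact: (smoothK_D closedK (zdir e) ta)|exact: (smoothK_D closedK (zdir e) tb)].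
  have QE e : 'D_e (Q v) = Q (v' e).
    by apply/funext => z; rewrite (derive_hatIm compactK tau z e wv).
  split=> [||z].
  - by rewrite (QE e1); exact: (plane1_hatIm compactK tau (smoothKC_rapid1C closedK (tv' e1))).
  - by rewrite (QE e2); exact: (plane1_hatIm compactK tau (smoothKC_rapid1C closedK (tv' e2))).
  have h12 := etrans (congr1 (fun f => 'D_e1 f z) (QE e2))
    (derive_hatIm compactK tau z e1 (smoothKC_rapid1C closedK (tv' e2))).
  have h21 := etrans (congr1 (fun f => 'D_e2 f z) (QE e1))
    (derive_hatIm compactK tau z e2 (smoothKC_rapid1C closedK (tv' e1))).
  apply: etrans h12 (etrans _ (esym h21)).
  have sa : 'D_(zdir e1) (reC (v' e2)) = 'D_(zdir e2) (reC (v' e1)).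
    exact: (smoothK_schwarz closedK (zdir e2) (zdir e1) ta).
  have sb : 'D_(zdir e1) (imC (v' e2)) = 'D_(zdir e2) (imC (v' e1)).
    exact: (smoothK_schwarz closedK (zdir e2) (zdir e1) tb).
  exact: (f_equal2 (fun f g => cosT tau f z - sinT tau g z) sb sa).
have n1 := nullB (null_D1 hP Q2) (null_D2 hP Q1).
have n := nullB n1 (nullZ (tau / 2) (nullD (null_coef1 (cf e1) wv) (null_coef2 (cf e2) wv))).
rewrite -plane_intZ// -plane_intB; [|exact: plane0_mod2|exact: plane0_mod2].
apply: (plane_int_null_eq _ _ n).
- by apply: plane0B; exact: plane0_mod2.
- exact: plane0Z.
move=> z; rewrite /mod2 /lap.
rewrite (hatRe_opLbar compactK KU smoothF tau wv) (hatIm_opLbar compactK KU smoothF tau wv).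
rewrite (hatRe_opL compactK KU smoothF tau wv) (hatIm_opL compactK KU smoothF tau wv).
exact: (commutator_density _ _ _ _ _ _ _ _ _ _ _ (Qxy z)).
Qed.

End Identities.

(** The pointwise form of [poincare]: the difference of the two sides is the
sum of the squared moduli |A w + lam z w|^2 and |B w + lam zbar w|^2 divided
by 2 lam.  The first line of the right-hand side is half the divergence of
|w|^2 (x, y). *)
Lemma poincare_density (R : realType) (lam t a1 a2 b1 b2 p q g1 g2 x y d1 d2 : R) : 0 < lam ->
  d1 = 1 -> d2 = 1 ->
  p ^+ 2 + q ^+ 2 <=
  2^-1 * (d1 * (p ^+ 2 + q ^+ 2) + 2 * x * (p * a1 + q * b1) +
          (d2 * (p ^+ 2 + q ^+ 2) + 2 * y * (p * a2 + q * b2))) +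
  (lam * ((x ^+ 2 + y ^+ 2) * (p ^+ 2 + q ^+ 2)) +
   (2 * lam)^-1 *
     (((2^-1 * (a1 + b2 - t * (g1 * p + g2 * q))) ^+ 2 +
       (2^-1 * (b1 - a2 - t * (g1 * q - g2 * p))) ^+ 2) +
      ((2^-1 * (a1 - b2 + t * (g1 * p - g2 * q))) ^+ 2 +
       (2^-1 * (b1 + a2 + t * (g1 * q + g2 * p))) ^+ 2))).
Proof.
move=> lam0 -> ->; rewrite -subr_ge0.
pose s1 := 2^-1 * (a1 - b2 + t * (g1 * p - g2 * q)) + lam * (x * p - y * q).
pose s2 := 2^-1 * (b1 + a2 + t * (g1 * q + g2 * p)) + lam * (x * q + y * p).
pose s3 := 2^-1 * (a1 + b2 - t * (g1 * p + g2 * q)) + lam * (x * p + y * q).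
pose s4 := 2^-1 * (b1 - a2 - t * (g1 * q - g2 * p)) + lam * (x * q - y * p).
rewrite (_ : _ - _ = (2 * lam)^-1 * (s1 ^+ 2 + s2 ^+ 2 + s3 ^+ 2 + s4 ^+ 2)).
  apply: mulr_ge0; first by rewrite invr_ge0 mulr_ge0// ltW.
  by rewrite !addr_ge0 ?sqr_ge0.
rewrite /s1 /s2 /s3 /s4; field.
by rewrite gt_eqF.
Qed.

(** * Uncertainty principle and energy identity *)

Section Estimates.
Variable R : realType.
Local Notation E := ((R * R) * R)%type.
Variables (U : set (R * R)) (K : set E).
Hypothesis openU : open U.
Hypothesis compactK : compact K.
Hypothesis KU : forall p, K p -> U p.1.
Variable F : R * R -> R.
Hypothesis smoothF : smooth_on U F.
Variable tau : R.

Let closedK : closed K.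
Proof. by apply: compact_closed => //; exact: norm_hausdorff. Qed.

Let coef1_fst : coef1 U (fst : R * R -> R).
Proof. exact: coef1_x. Qed.

Let coef1_snd : coef1 U (snd : R * R -> R).
Proof. exact: coef1_y. Qed.

Local Notation mod2t := (mod2 tau).
Local Notation inner2t := (inner2 tau).

Lemma coef0_rsqX k : coef0 U (fun z => rsq z ^+ k).
Proof. by have [] := coef1_rsqX openU k. Qed.

Lemma derive_fst_e1 z : 'D_e1 (fst : R * R -> R) z = 1.
Proof.
have [_ h] := linear_is_derive (l := (fst : R * R -> R)) (fun p => cvg_fst) (fun k x y => erefl) z.
by rewrite h.
Qed.

Lemma derive_snd_e2 z : 'D_e2 (snd : R * R -> R) z = 1.
Proof.
have [_ h] := linear_is_derive (l := (snd : R * R -> R)) (fun p => cvg_snd) (fun k x y => erefl) z.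
by rewrite h.
Qed.

(** The divergence of (x, y) is 2, which produces |w|^2; the derivatives of w
that appear on the other side of the integration by parts are recovered from
A w and B w, in which the terms with F cancel. *)
Lemma poincare v lam : rapid1C K v -> 0 < lam ->
  plane_int (mod2t v) <= lam * plane_int (fun z => rsq z * mod2t v z) +
    (2 * lam)^-1 * (plane_int (mod2t (opL F v)) + plane_int (mod2t (opLbar F v))).
Proof.
move=> wv lam0; have rv := rapid1C_rapidC wv.
have rL := rapidC_opL closedK KU smoothF wv; have rLb := rapidC_opLbar closedK KU smoothF wv.
have [n n0] := nullZ 2^-1 (nullD (null_coef1 compactK KU tau coef1_fst wv)
  (null_coef2 compactK KU tau coef1_snd wv)).
have HL := plane0_mod2 compactK tau rL; have HLb := plane0_mod2 compactK tau rLb.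
have Hs : plane0 (fun z => rsq z * mod2t v z).
  have := plane0_coef_mod2 compactK KU tau (@coef0_rsqX 1%N) rv.
  by congr plane0; apply/funext => z; rewrite expr1.
rewrite -plane_intD// -plane_intZ// -plane_intZ; last exact: plane0D.
rewrite -plane_intD; [|exact: plane0Z|by apply: plane0Z; exact: plane0D].
rewrite -[X in _ <= X]add0r -n0 -plane_intD//; last by apply: plane0D; apply: plane0Z => //; exact: plane0D.
apply: plane_int_le.
- exact: (plane0_mod2 compactK tau rv).
- by apply: plane0D => //; apply: plane0D; apply: plane0Z => //; exact: plane0D.
move=> z; rewrite /mod2 /rsq.
rewrite (hatRe_opLbar compactK KU smoothF tau wv) (hatIm_opLbar compactK KU smoothF tau wv).
rewrite (hatRe_opL compactK KU smoothF tau wv) (hatIm_opL compactK KU smoothF tau wv).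
exact: (poincare_density _ _ _ _ _ _ _ _ _ _ _ lam0 (derive_fst_e1 z) (derive_snd_e2 z)).
Qed.

Lemma coef0_fst : coef0 U (fst : R * R -> R). Proof. by have [] := coef1_fst. Qed.
Lemma coef0_snd : coef0 U (snd : R * R -> R). Proof. by have [] := coef1_snd. Qed.

Lemma rapidC_zbarM v : rapidC K v -> rapidC K (zbarM v).
Proof.
move=> [ra rb]; rewrite /rapidC reC_zbarM imC_zbarM; split; apply: rapidD.
- exact: (rapid_coef closedK KU coef0_fst).
- exact: (rapid_coef closedK KU coef0_snd).
- exact: (rapid_coef closedK KU coef0_fst).
- by apply: (@rapidZ _ U) => //; exact: (rapid_coef closedK KU coef0_snd).
Qed.

Lemma mod2_zbarM v z : rapidC K v -> mod2t (zbarM v) z = rsq z * mod2t v z.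
Proof.
move=> [/rapid_C0K ca /rapid_C0K cb].
have c0 := continuous_cosw (tau := tau); have s0 := continuous_sinw (tau := tau).
have c1 := cosw1 tau; have s1 := sinw1 tau.
have cx b : C0K K b -> C0K K (fun p => p.1.1 * b p) by exact: (C0K_coef closedK KU coef0_fst).
have cy b : C0K K b -> C0K K (fun p => p.1.2 * b p) by exact: (C0K_coef closedK KU coef0_snd).
have cm b : C0K K b -> C0K K (fun p => -1 * b p).
  by exact: (C0K_coef closedK KU (@coef0_cst _ U (-1))).
rewrite /mod2 /hatRe /hatIm reC_zbarM imC_zbarM /cosT /sinT.
rewrite (fiber_add compactK c0 c1 z (cx _ ca) (cy _ cb)) (fiber_add compactK s0 s1 z (cx _ ca) (cy _ cb)).
rewrite (fiber_add compactK c0 c1 z (cx _ cb) (cm _ (cy _ ca))) (fiber_add compactK s0 s1 z (cx _ cb) (cm _ (cy _ ca))).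
rewrite (fiberZ compactK c0 c1 (-1) z (cy _ ca)) (fiberZ compactK s0 s1 (-1) z (cy _ ca)).
rewrite (fiber_coef compactK c0 c1 fst z ca) (fiber_coef compactK s0 s1 fst z ca).
rewrite (fiber_coef compactK c0 c1 fst z cb) (fiber_coef compactK s0 s1 fst z cb).
rewrite (fiber_coef compactK c0 c1 snd z ca) (fiber_coef compactK s0 s1 snd z ca).
rewrite (fiber_coef compactK c0 c1 snd z cb) (fiber_coef compactK s0 s1 snd z cb).
rewrite /rsq; ring.
Qed.

Lemma rapidC_zbarX k v : rapidC K v -> rapidC K (fun p => (toC p.1)^* ^+ k * v p).
Proof. by rewrite -iter_zbarM => rv; elim: k => //= k IH; exact: rapidC_zbarM. Qed.

Lemma mod2_zbarX k v z : rapidC K v ->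
  mod2t (fun p => (toC p.1)^* ^+ k * v p) z = rsq z ^+ k * mod2t v z.
Proof.
move=> rv; rewrite -iter_zbarM; elim: k => [|k IH]; first by rewrite expr0 mul1r.
rewrite iterS mod2_zbarM ?IH ?exprS ?mulrA//.
by rewrite iter_zbarM; exact: rapidC_zbarX.
Qed.

Lemma inner2_add u w v z : rapidC K u -> rapidC K w ->
  inner2t (fun p => u p + w p) v z = inner2t u v z + inner2t w v z.
Proof.
move=> [/rapid_C0K ua /rapid_C0K ub] [/rapid_C0K wa /rapid_C0K wb].
have c0 := continuous_cosw (tau := tau); have s0 := continuous_sinw (tau := tau).
have c1 := cosw1 tau; have s1 := sinw1 tau.
have re : reC (fun p => u p + w p) = fun p => reC u p + reC w p.
  by apply/funext => p; rewrite /reC raddfD.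
have im : imC (fun p => u p + w p) = fun p => imC u p + imC w p.
  by apply/funext => p; rewrite /imC raddfD.
rewrite /inner2 {1 3}/hatRe {1 3}/hatIm re im /cosT /sinT.
rewrite (fiber_add compactK c0 c1 z ua wa) (fiber_add compactK s0 s1 z ua wa).
rewrite (fiber_add compactK c0 c1 z ub wb) (fiber_add compactK s0 s1 z ub wb).
rewrite /hatRe /hatIm /cosT /sinT; ring.
Qed.

(** Move the outer L and the outer conjugate operator of P to the other side
with [adjoint_opL] and [adjoint_opLbar]; then |z|^(2k) |B w|^2 is
|zbar^k B w|^2. *)
Lemma energy_identity k v : smoothKC K v ->
  plane_int (inner2t (opP k F v) v) =
  - (plane_int (mod2t (opLbar F v)) + plane_int (mod2t (fun p => (toC p.1)^* ^+ k * opL F v p))).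
Proof.
move=> tv; have wv := smoothKC_rapid1C closedK tv; have rv := rapid1C_rapidC wv.
have wL := rapid1C_opL closedK KU smoothF tv; have wLb := rapid1C_opLbar closedK KU smoothF tv.
have rL := rapid1C_rapidC wL; have rLb := rapid1C_rapidC wLb.
have wsL := rapid1C_rsqX openU closedK KU k wL; have rsL := rapid1C_rapidC wsL.
have rLL := rapidC_opL closedK KU smoothF wLb.
have rLbsL := rapidC_opLbar closedK KU smoothF wsL.
rewrite opPE (eq_plane_int (fun z => inner2_add v z rLL rLbsL)) plane_intD; last 2 first.
- exact: (plane0_inner2 compactK tau rLL rv).
- exact: (plane0_inner2 compactK tau rLbsL rv).
have E : plane_int (inner2t (fun p => (rsq p.1 ^+ k)%:C * opL F v p) (opL F v)) =
    plane_int (mod2t (fun p => (toC p.1)^* ^+ k * opL F v p)).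
  apply: eq_plane_int => z; rewrite (mod2_zbarX k z rL).
  have cM := hatRe_zmul compactK tau (fun z => rsq z ^+ k) z rL.
  have cM' := hatIm_zmul compactK tau (fun z => rsq z ^+ k) z rL.
  rewrite /zmul in cM cM'.
  by rewrite /inner2 /mod2 cM cM'; ring.
rewrite opprD -E.
exact: (f_equal2 +%R (adjoint_opL compactK KU smoothF tau wLb wv)
  (adjoint_opLbar compactK KU smoothF tau wsL wv)).
Qed.

End Estimates.

(** * Interpolation of weights *)

Section Weights.
Variable R : realType.
Implicit Types (a x C : R) (m k q : nat).

Lemma expr_interpolation x m q : 0 <= x -> (m <= q)%N -> x ^+ m <= 1 + x ^+ q.
Proof.
move=> x0 mq; have [x1|x1] := leP x 1.
  by rewrite ler_wpDr ?exprn_ge0// exprn_ile1.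
by rewrite ler_wpDl// ler_weXn2l// ltW.
Qed.

(** Where 4 a x <= 1 the constant dominates; elsewhere inserting further
factors 4 a x >= 1 only increases the product. *)
Lemma linear_weight a x q : 0 < a -> 0 <= x -> (0 < q)%N ->
  a * x <= 4^-1 + a * (4 * a) ^+ q.-1 * x ^+ q.
Proof.
move=> a0 x0; case: q => //= q _.
have a4 : 0 < 4 * a by rewrite mulr_gt0.
have [h|h] := leP (4 * a * x) 1.
  rewrite ler_wpDr//; last by lra.
  by rewrite !mulr_ge0 ?exprn_ge0// ltW.
rewrite ler_wpDl ?invr_ge0//.
have -> : a * (4 * a) ^+ q * x ^+ q.+1 = a * x * (4 * a * x) ^+ q.
  by rewrite [(4 * a * x) ^+ q]exprMn exprS; ring.
by rewrite ler_peMr ?exprn_ege1 ?mulr_ge0// ltW.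
Qed.

Definition wconst C q := 1 + (1 + 4 * C) * (4 * (1 + 4 * C)) ^+ q.-1.

Lemma wconst_ge0 C q : 0 <= C -> 0 <= wconst C q.
Proof. by move=> C0; rewrite /wconst addr_ge0// !mulr_ge0 ?exprn_ge0 ?mulr_ge0 ?addr_ge0 ?mulr_ge0. Qed.

(** The coefficient a = 1 + 4 C is large enough for C / a to be at most 1/4, so
that both terms on the left leave together at most 1/2. *)
Lemma weight_bound C x m q : 0 <= C -> 0 <= x -> (m <= q)%N -> (0 < q)%N ->
  (1 + 4 * C) * x + C / (1 + 4 * C) * x ^+ m <= 2^-1 + wconst C q * x ^+ q.
Proof.
move=> C0 x0 mq q0.
have a0 : 0 < 1 + 4 * C by rewrite ltr_wpDr// mulr_ge0.
have h1 := linear_weight a0 x0 q0.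
have h2 := expr_interpolation x0 mq.
have h3 : C / (1 + 4 * C) <= 4^-1 by rewrite ler_pdivrMr//; lra.
have h4 : C / (1 + 4 * C) * x ^+ m <= 4^-1 * (1 + x ^+ q).
  by rewrite ler_pM ?divr_ge0 ?exprn_ge0// ltW.
have h5 : 0 <= x ^+ q by rewrite exprn_ge0.
apply: le_trans (lerD h1 h4) _; rewrite /wconst.
move: ((1 + 4 * C) * _) => D; rewrite [(1 + D) * _]mulrDl mul1r.
move: (D * x ^+ q) => Y; lra.
Qed.

End Weights.

(** * The estimate at a fixed frequency *)

Section Key.
Variable R : realType.
Local Notation E := ((R * R) * R)%type.
Variables (U : set (R * R)) (K : set E).
Hypothesis openU : open U.
Hypothesis compactK : compact K.
Hypothesis KU : forall p, K p -> U p.1.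
Variable F : R * R -> R.
Hypothesis smoothF : smooth_on U F.
Variables (m k : nat) (c C eps : R).
Hypotheses (m0 : (0 < m)%N) (k0 : (0 < k)%N) (c0 : 0 < c) (cC : c <= C).
Hypothesis eps1 : eps = 1 \/ eps = -1.
Hypothesis Ksmall : forall p, K p -> rsq p.1 <= 2.
Hypothesis Klap : forall p, K p ->
  4 * c * rsq p.1 ^+ m.-1 <= eps * lap F p.1 <= 4 * C * rsq p.1 ^+ m.-1.

Let closedK : closed K.
Proof. by apply: compact_closed => //; exact: norm_hausdorff. Qed.

Lemma mod2_off tau v z : rapidC K v -> (forall t, ~ K (z, t)) -> mod2 tau v z = 0.
Proof.
move=> [/rapid_C0K[_ za] /rapid_C0K[_ zb]] h.
by rewrite /mod2 /hatRe /hatIm /cosT /sinT !fiber_off ?addr0 ?subr0 ?expr0n ?addr0// => t; rewrite ?za ?zb.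
Qed.

Lemma mod2_ge0 (tau : R) v z : 0 <= mod2 tau v z.
Proof. by rewrite addr_ge0// sqr_ge0. Qed.

Lemma plane_int_weight_le tau v (w1 w2 : R * R -> R) : rapidC K v ->
  plane0 (fun z => w1 z * mod2 tau v z) -> plane0 (fun z => w2 z * mod2 tau v z) ->
  (forall p, K p -> w1 p.1 <= w2 p.1) ->
  plane_int (fun z => w1 z * mod2 tau v z) <= plane_int (fun z => w2 z * mod2 tau v z).
Proof.
move=> rv h1 h2 w12; apply: plane_int_le => // z.
have [[t Kt]|nK] := pselect (exists t, K (z, t)).
  by rewrite ler_wpM2r ?mod2_ge0//; exact: (w12 (z, t)).
by rewrite mod2_off ?mulr0// => t Kt; apply: nK; exists t.
Qed.

Definition keyconst := 8 + wconst C (m.-1 + k) / c.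

Lemma rsq_ge0 (z : R * R) : 0 <= rsq z.
Proof. by rewrite addr_ge0// sqr_ge0. Qed.

(** With s j the integral of |z|^(2j) |w|^2, the curvature bounds turn the
commutator identities for w and for zbar^k w into linear inequalities between
s 0, s 1, s (m-1), s (m-1+k) and the four norms; the two signs of
tau * eps are then treated as in the introduction. *)
Lemma key_estimate tau om v : smoothKC K v -> 1 <= om -> om ^+ m = `|tau| ->
  plane_int (mod2 tau v) <= keyconst * om ^+ k.-1 *
    (plane_int (mod2 tau (opLbar F v)) + plane_int (mod2 tau (fun p => (toC p.1)^* ^+ k * opL F v p))).
Proof.
move=> tv om1 omt; have wv := smoothKC_rapid1C closedK tv; have rv := rapid1C_rapidC wv.
have C0 : 0 < C := lt_le_trans c0 cC.
pose s j := plane_int (fun z => rsq z ^+ j * mod2 tau v z).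
have Hs j : plane0 (fun z => rsq z ^+ j * mod2 tau v z).
  exact: (plane0_coef_mod2 compactK KU tau (@coef0_rsqX _ _ openU j) rv).
have Hsc a j : plane0 (fun z => (a * rsq z ^+ j) * mod2 tau v z).
  by have := plane0Z a (Hs j); congr plane0; apply/funext => z; rewrite mulrA.
have Hv : plane0 (mod2 tau v) := plane0_mod2 compactK tau rv.
have Isc a j : plane_int (fun z => (a * rsq z ^+ j) * mod2 tau v z) = a * s j.
  by rewrite /s -plane_intZ//; apply: eq_plane_int => z; rewrite mulrA.
have s0 j : 0 <= s j.
  by apply: plane_int_ge0 => z; rewrite mulr_ge0 ?mod2_ge0 ?exprn_ge0 ?rsq_ge0.
have HscD a i b j : plane0 (fun z => (a * rsq z ^+ i + b * rsq z ^+ j) * mod2 tau v z).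
  by have := plane0D (Hsc a i) (Hsc b j); congr plane0; apply/funext => z; rewrite mulrDl.
have IscD a i b j : plane_int (fun z => (a * rsq z ^+ i + b * rsq z ^+ j) * mod2 tau v z) =
    a * s i + b * s j.
  by rewrite -!Isc -plane_intD//; apply: eq_plane_int => z; rewrite mulrDl.
have sE0 : plane_int (mod2 tau v) = s 0%N by apply: eq_plane_int => z; rewrite expr0 mul1r.
have sE1 : plane_int (fun z => rsq z * mod2 tau v z) = s 1%N by apply: eq_plane_int => z; rewrite expr1.
have clap : coef0 U (lap F).
  by apply: coef0D; [have [_ h _] := smooth_coef1 e1 smoothF; exact: h
                    |have [_ h _] := smooth_coef1 e2 smoothF; exact: h].
have clapr j : coef0 U (fun z => lap F z * rsq z ^+ j).
  by apply: coef0M => //; exact: coef0_rsqX.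
have Hlap j : plane0 (fun z => (lap F z * rsq z ^+ j) * mod2 tau v z).
  exact: (plane0_coef_mod2 compactK KU tau (clapr j) rv).
have Hlape j : plane0 (fun z => (eps * (lap F z * rsq z ^+ j)) * mod2 tau v z).
  by have := plane0Z eps (Hlap j); congr plane0; apply/funext => z; rewrite mulrA.
have Ilape j : plane_int (fun z => (eps * (lap F z * rsq z ^+ j)) * mod2 tau v z) =
    eps * plane_int (fun z => lap F z * rsq z ^+ j * mod2 tau v z).
  by rewrite -(plane_intZ eps (Hlap j)); apply: eq_plane_int => z; rewrite [RHS]mulrA.
pose J j := eps * plane_int (fun z => lap F z * rsq z ^+ j * mod2 tau v z).
have JE j : plane_int (fun z => lap F z * rsq z ^+ j * mod2 tau v z) = eps * J j.
  by rewrite /J mulrA; case: eps1 => ->; rewrite ?mulN1r ?opprK ?mul1r// mulNr mulN1r opprK mul1r.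
have Jlow j : 4 * c * s (m.-1 + j)%N <= J j.
  rewrite -Isc /J -Ilape; apply: plane_int_weight_le => // p Kp.
  by rewrite exprD !mulrA ler_wpM2r ?exprn_ge0 ?rsq_ge0//; have /andP[] := Klap Kp.
have Jup j : J j <= 4 * C * s (m.-1 + j)%N.
  rewrite -Isc /J -Ilape; apply: plane_int_weight_le => // p Kp.
  by rewrite exprD !mulrA ler_wpM2r ?exprn_ge0 ?rsq_ge0//; have /andP[] := Klap Kp.
have com0 := commutator compactK KU smoothF tau tv.
have {}com0 : plane_int (mod2 tau (opL F v)) - plane_int (mod2 tau (opLbar F v)) = tau / 2 * (eps * J 0%N).
  rewrite com0 -JE; congr (_ * _); apply: eq_plane_int => z; by rewrite expr0 mulr1.
have tu := smoothKC_zbarX k tv.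
have comk := commutator compactK KU smoothF tau tu.
rewrite (opL_zbarX F k tv) in comk.
have {}comk : plane_int (mod2 tau (fun p => (toC p.1)^* ^+ k * opL F v p)) -
    plane_int (mod2 tau (opLbar F (fun p => (toC p.1)^* ^+ k * v p))) = tau / 2 * (eps * J k).
  rewrite comk -JE; congr (_ * _); apply: eq_plane_int => z.
  by rewrite (mod2_zbarX compactK KU tau k z rv) mulrA.
have nn u : 0 <= plane_int (mod2 tau u) by apply: plane_int_ge0 => z; exact: mod2_ge0.
have poin := poincare openU compactK KU smoothF tau wv.
rewrite sE1 sE0 in poin.
have NU0 := nn (opLbar F (fun p => (toC p.1)^* ^+ k * v p)); have NA0 := nn (opLbar F v).
have NB0 := nn (opL F v); have NZ0 := nn (fun p => (toC p.1)^* ^+ k * opL F v p).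
rewrite sE0; move: NU0 NA0 NB0 NZ0 com0 comk poin.
generalize (plane_int (mod2 tau (opLbar F (fun p => (toC p.1)^* ^+ k * v p)))) (plane_int (mod2 tau (opLbar F v)))
  (plane_int (mod2 tau (opL F v))) (plane_int (mod2 tau (fun p => (toC p.1)^* ^+ k * opL F v p))).
move=> NU NA NB NZ NU0 NA0 NB0 NZ0 com0 comk poin.
have om0 : 0 < om := lt_le_trans ltr01 om1.
have omk : 1 <= om ^+ k.-1 by rewrite exprn_ege1.
have w0 := wconst_ge0 (m.-1 + k) (ltW C0).
have kc8 : 8 <= keyconst by rewrite /keyconst lerDl divr_ge0// ltW.
have kc0 : 0 <= keyconst by rewrite (le_trans _ kc8).
have [te|te] : tau * eps = `|tau| \/ tau * eps = - `|tau|.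
  case: eps1 => ->; rewrite ?mulr1 ?mulrN1.
  - by have [t0|t0] := leP 0 tau; [left; rewrite ger0_norm|right; rewrite ltr0_norm// opprK].
  - by have [t0|t0] := leP 0 tau; [right; rewrite ger0_norm|left; rewrite ltr0_norm].
- (* The commutator term has the unfavourable sign in the bound for B w; it is
     absorbed by means of zbar^k B w. *)
  set a := 1 + 4 * C; set D := wconst C (m.-1 + k); set q := (m.-1 + k)%N.
  have a0 : 0 < a by rewrite /a ltr_wpDr// mulr_ge0// ltW.
  have omS : om ^+ m = om * om ^+ m.-1 by rewrite -exprS prednK.
  have omq : om ^+ q = om ^+ m * om ^+ k.-1.
    by rewrite -exprD /q; congr (_ ^+ _); case: (m) (k) m0 k0 => [|m'] [|k'] //= _ _; rewrite addnS.
  have hE : 2 * om ^+ m * c * s q <= NZ.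
    have h : NZ - NU = om ^+ m / 2 * J k by rewrite comk omt -te; ring.
    have := ler_wpM2l (divr_ge0 (exprn_ge0 m (ltW om0)) (ler0n R 2)) (Jlow k).
    rewrite -h -/q; have -> : om ^+ m / 2 * (4 * c * s q) = 2 * om ^+ m * c * s q by field.
    lra.
  have hB : NB <= NA + 2 * om ^+ m * C * s m.-1.
    have h : NB - NA = om ^+ m / 2 * J 0%N by rewrite com0 omt -te; ring.
    have := ler_wpM2l (divr_ge0 (exprn_ge0 m (ltW om0)) (ler0n R 2)) (Jup 0%N).
    rewrite -h addn0; have -> : om ^+ m / 2 * (4 * C * s m.-1) = 2 * om ^+ m * C * s m.-1 by field.
    lra.
  (* [weight_bound] at x = om |z|^2, multiplied by |w|^2 and integrated *)
  have hw : a * om * s 1%N + C / a * om ^+ m.-1 * s m.-1 <= 2^-1 * s 0%N + D * om ^+ q * s q.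
    rewrite -!IscD; apply: plane_int_weight_le => // p _.
    rewrite expr0 expr1 mulr1 -!mulrA -!exprMn.
    rewrite [C * (a^-1 * _)]mulrA; apply: weight_bound; [exact: ltW| |exact: leq_addr|].
      by rewrite mulr_ge0 ?rsq_ge0// ltW.
    by rewrite addn_gt0 k0 orbT.
  have := poin (a * om) (mulr_gt0 a0 om0).
  have h2 : (2 * (a * om))^-1 * (NB + NA) <= NA + C / a * om ^+ m.-1 * s m.-1.
    have -> : NA + C / a * om ^+ m.-1 * s m.-1 =
      (2 * (a * om))^-1 * (2 * (a * om) * NA + 2 * om ^+ m * C * s m.-1).
      by rewrite omS; field; rewrite !gt_eqF.
    rewrite ler_wpM2l//; first by rewrite invr_ge0 mulr_ge0// mulr_ge0// ltW.
    have aom : 1 <= a * om by rewrite mulr_ege1// /a lerDl mulr_ge0// ltW.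
    have := ler_wpM2r NA0 aom; lra.
  have Dc0 : 0 <= D / c * om ^+ k.-1 by rewrite mulr_ge0 ?exprn_ge0 ?divr_ge0// ltW.
  have h3 : 2 * D * om ^+ q * s q <= D / c * om ^+ k.-1 * NZ.
    have -> : 2 * D * om ^+ q * s q = D / c * om ^+ k.-1 * (2 * om ^+ m * c * s q).
      by rewrite omq; field; rewrite gt_eqF.
    by rewrite ler_wpM2l.
  have h4 : 2 * NA <= 8 * om ^+ k.-1 * NA.
    by rewrite ler_wpM2r//; lra.
  have h5 : 0 <= D / c * om ^+ k.-1 * NA by rewrite mulr_ge0.
  have h6 : 0 <= 8 * om ^+ k.-1 * NZ by rewrite !mulr_ge0// exprn_ge0// ltW.
  rewrite /keyconst -/D.
  have -> : (8 + D / c) * om ^+ k.-1 * (NA + NZ) = 8 * om ^+ k.-1 * NA + 8 * om ^+ k.-1 * NZ +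
    D / c * om ^+ k.-1 * NA + D / c * om ^+ k.-1 * NZ by ring.
  move: h2 h3 h4 h5 h6 hw.
  have -> : 2 * D * om ^+ q * s q = 2 * (D * om ^+ q * s q) by ring.
  move: (D * om ^+ q * s q) (8 * om ^+ k.-1 * NA) (8 * om ^+ k.-1 * NZ) (D / c * om ^+ k.-1 * NA)
    (D / c * om ^+ k.-1 * NZ) (C / a * om ^+ m.-1 * s m.-1) (_ * (NB + NA)) (a * om * s 1%N).
  move=> *; lra.
- (* The commutator gives |B w| <= |A w|; with |z|^2 <= 2 the value lam = 1/4
     leaves half of |w|^2 on the left. *)
  have J0 : 0 <= J 0%N by apply: le_trans (Jlow 0%N); rewrite !mulr_ge0// ltW.
  have NBA : NB <= NA.
    have h : NB - NA = - (`|tau| / 2 * J 0%N) by rewrite com0 -[`|tau|]opprK -te; ring.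
    by rewrite -subr_le0 h oppr_le0 mulr_ge0// divr_ge0.
  have s12 : s 1%N <= 2 * s 0%N.
    rewrite -Isc; have := Isc 1 1%N; rewrite mul1r => <-.
    by apply: plane_int_weight_le => // p Kp; rewrite expr0 expr1 mulr1 mul1r; exact: Ksmall.
  have := poin 4^-1 (ltac:(by rewrite invr_gt0)).
  have -> : (2 * 4^-1)^-1 = 2 :> R by field.
  move=> P1; apply: (@le_trans _ _ (8 * NA)); first by lra.
  apply: ler_pM => //; first by rewrite -[8]mulr1 ler_pM.
  by rewrite lerDl.
Qed.

End Key.

(** * Integration over z and tau *)

Section PlaneMeasure.
Variable R : realType.

(** The same product as [lebesgueC], as a function that can carry the
sigma-finiteness required by Fubini. *)
Definition plane_measure : set (measurableTypeR R * measurableTypeR R)%type -> \bar R :=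
  (@lebesgue_measure R \x @lebesgue_measure R)%E.

HB.instance Definition _ := Measure.on plane_measure.

Let plane_measure_sigma_finite : sigma_finite setT plane_measure.
Proof.
exists (fun n : nat => box (n%:R : R)).
  apply/seteqP; split=> // z _; exists (Num.truncn (`|z.1| + `|z.2|)).+1 => //.
  have h := ltW (truncnS_gt (`|z.1| + `|z.2|)).
  by split; apply: le_trans h; rewrite ?lerDl ?lerDr.
by move=> n; split; [exact: measurable_box|exact: lebesgueC_box].
Qed.

HB.instance Definition _ := Measure_isSigmaFinite.Build _ _ _ plane_measure
  plane_measure_sigma_finite.

End PlaneMeasure.

Section Iterated.
Variable R : realType.
Local Notation Z := (measurableTypeR R * measurableTypeR R)%type.
Implicit Types h : Z * measurableTypeR R -> R.

Definition japanese (tau : R) : R := 1 + tau ^+ 2.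

Lemma japanese_ge1 tau : 1 <= japanese tau.
Proof. by rewrite /japanese lerDl sqr_ge0. Qed.

Lemma japanese_gt0 tau : 0 < japanese tau.
Proof. exact: lt_le_trans ltr01 (japanese_ge1 tau). Qed.

Lemma continuous_japanese : continuous japanese.
Proof. by move=> t; apply: cvgD; [exact: cvg_cst|exact: exprn_continuous]. Qed.

Definition japaneseV (tau : R) : R := (japanese tau)^-1.

Lemma japaneseV_ge0 tau : 0 <= japaneseV tau.
Proof. by rewrite invr_ge0 ltW// japanese_gt0. Qed.

Lemma continuous_japaneseV : continuous japaneseV.
Proof.
by move=> t; apply: cvgV; [rewrite gt_eqF// japanese_gt0|exact: continuous_japanese].
Qed.

Lemma japaneseV_integrable : (lebesgueR R).-integrable setT (EFin \o japaneseV).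
Proof.
apply/integrableP; split.
  by apply/measurable_EFinP; apply: continuous_measurable_fun; exact: continuous_japaneseV.
rewrite (_ : (\int[_]_x _)%E = (\int[@lebesgue_measure R]_x (japaneseV x)%:E)%E).
  rewrite (@ge0_symfun_integralT R japaneseV).
  - rewrite (_ : (\int[_]_(x in _) _)%E = (pi / 2)%:E) -?EFinM ?ltry//.
    rewrite -integral0y_oneDsqr; congr (integral _ _ _).
    by apply/seteqP; split=> x /=; rewrite in_itv/= andbT.
  - exact: japaneseV_ge0.
  - exact: continuous_japaneseV.
  - by move=> x; rewrite /japaneseV /japanese /= sqrrN.
by apply: eq_integral => x _; rewrite /= ger0_norm// japaneseV_ge0.
Qed.

(** Bounded support in z and decay like (1 + tau^2)^-1 in tau: integrable on
the product, and stable under linear combinations. *)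
Definition phase_class h := measurable_fun setT h /\
  exists M C, forall z tau, `|h (z, tau)| <= C * japaneseV tau /\ (~ box M z -> h (z, tau) = 0).

Definition phase_int h : R := \int[lebesgueC R]_z \int[lebesgueR R]_tau h (z, tau).

Local Notation lebC := (@plane_measure R).

Lemma phase_classD h1 h2 : phase_class h1 -> phase_class h2 -> phase_class (fun q => h1 q + h2 q).
Proof.
move=> [m1 [M1 [C1 b1]]] [m2 [M2 [C2 b2]]]; split; first exact: measurable_funD.
exists (`|M1| + `|M2|), (C1 + C2) => z tau.
have [x1 y1] := b1 z tau; have [x2 y2] := b2 z tau; split.
  by rewrite (le_trans (ler_normD _ _))// mulrDl lerD.
move=> zM; rewrite y1 ?y2 ?addr0// => hz; apply: zM; apply: box_le hz.
  by rewrite (le_trans (ler_norm _))// lerDr.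
by rewrite (le_trans (ler_norm _))// lerDl.
Qed.

Lemma phase_classZ k h : phase_class h -> phase_class (fun q => k * h q).
Proof.
move=> [m1 [M1 [C1 b1]]]; split; first exact: measurable_funM.
exists M1, (`|k| * C1) => z tau; have [x1 y1] := b1 z tau; split.
  by rewrite normrM -mulrA ler_wpM2l.
by move=> zM; rewrite y1 ?mulr0.
Qed.

Lemma phase_class_slice h z : phase_class h -> (lebesgueR R).-integrable setT (EFin \o (fun tau => h (z, tau))).
Proof.
move=> [mh [M [C b]]].
have mhz : measurable_fun setT (fun tau : measurableTypeR R => h (z, tau)).
  exact: (measurable_fun_pair2 z mh).
apply: (le_integrable measurableT _ _ (integrableZl measurableT `|C| japaneseV_integrable)).
- exact/measurable_EFinP.
- move=> tau _; rewrite /= lee_fin [leRHS]ger0_norm ?mulr_ge0 ?japaneseV_ge0//.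
  by rewrite (le_trans (b z tau).1)// ler_wpM2r ?japaneseV_ge0// ler_norm.
Qed.

Lemma phase_class_integrable h : phase_class h -> (lebC \x @lebesgue_measure R)%E.-integrable setT (EFin \o h).
Proof.
move=> Nh; have [mh [M [C b]]] := Nh.
apply/(@integrable12ltyP _ _ _ _ _ lebC (@lebesgue_measure R)); first exact/measurable_EFinP.
have cj : (\int[@lebesgue_measure R]_t (japaneseV t)%:E < +oo)%E.
  have /integrableP[_] := japaneseV_integrable.
  by under eq_integral do rewrite /= ger0_norm ?japaneseV_ge0//.
have cj0 : (0 <= \int[@lebesgue_measure R]_t (japaneseV t)%:E)%E.
  by apply: integral_ge0 => t _; rewrite lee_fin japaneseV_ge0.
have cjf : (\int[@lebesgue_measure R]_t (japaneseV t)%:E)%E \is a fin_num by rewrite ge0_fin_numE.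
pose D := fine (\int[@lebesgue_measure R]_t (japaneseV t)%:E)%E.
have D0 : 0 <= D by rewrite fine_ge0.
pose w := fun z : Z => `|C| * D * \1_(box M) z.
have iw : lebC.-integrable setT (EFin \o w).
  apply: (@bounded_support_integrable _ Z R (lebesgueC R) w (box M) (`|C| * D)).
  - exact: measurable_box.
  - exact: lebesgueC_box.
  - by apply: measurable_funM => //; apply: measurable_indic; exact: measurable_box.
  - move=> z; rewrite /w normrM normr_nat ger0_norm ?mulr_ge0//.
    by case: (z \in _); rewrite ?mulr1 ?mulr0 ?mulr_ge0.
  - by move=> z zM; rewrite /w indicE memNset// mulr0.
have /integrableP[_] := iw; apply: le_lt_trans.
apply: ge0_le_integral => //.
- by move=> z _; apply: integral_ge0.
- apply: (measurable_fun_fubini_tonelli_F (fun q => `|(EFin \o h) q|%E)) => //.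
  by apply: measurableT_comp => //; exact/measurable_EFinP.
- by apply/measurable_EFinP; apply: measurableT_comp => //; have /integrableP[/measurable_EFinP] := iw.
move=> z _; have [zM|zM] := pselect (box M z); last first.
  rewrite (eq_integral (fun _ => 0%E)) ?integral0//.
  by move=> t _; rewrite /= (b z t).2// normr0.
rewrite /= ger0_norm; last by rewrite mulr_ge0 ?mulr_ge0.
have -> : w z = `|C| * D by rewrite /w indicE mem_set// mulr1.
have -> : (`|C| * D)%:E = (\int[@lebesgue_measure R]_t (`|C| * japaneseV t)%:E)%E.
  under eq_integral do rewrite EFinM.
  rewrite ge0_integralZl//=; last 2 first.
  - by apply/measurable_EFinP; apply: continuous_measurable_fun; exact: continuous_japaneseV.
  - by move=> t _; rewrite lee_fin japaneseV_ge0.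
  by rewrite EFinM fineK.
apply: ge0_le_integral => //.
- apply/measurable_EFinP; apply: measurableT_comp => //; exact: (measurable_fun_pair2 z mh).
- apply/measurable_EFinP; apply: measurable_funM => //.
  by apply: continuous_measurable_fun; exact: continuous_japaneseV.
by move=> t _; rewrite lee_fin (le_trans (b z t).1)// ler_wpM2r ?japaneseV_ge0// ler_norm.
Qed.

Lemma inner_integralE h z : phase_class h ->
  (\int[lebesgueR R]_tau h (z, tau))%:E = (\int[@lebesgue_measure R]_tau (h (z, tau))%:E)%E.
Proof.
by move=> Nh; rewrite /Rintegral fineK//; apply: integrable_fin_num => //; exact: phase_class_slice.
Qed.

Lemma outer_integrable h : phase_class h ->
  (lebesgueC R).-integrable setT (EFin \o (fun z => \int[lebesgueR R]_tau h (z, tau))).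
Proof.
move=> Nh; have := integrable_fubini_F (phase_class_integrable Nh).
by apply: eq_integrable => // z _ /=; rewrite inner_integralE.
Qed.

Lemma phase_intD h1 h2 : phase_class h1 -> phase_class h2 ->
  phase_int (fun q => h1 q + h2 q) = phase_int h1 + phase_int h2.
Proof.
move=> N1 N2; rewrite /phase_int -RintegralD//; [|exact: outer_integrable..].
by apply: eq_Rintegral => z _; rewrite RintegralD//; exact: phase_class_slice.
Qed.

Lemma phase_intZ k h : phase_class h -> phase_int (fun q => k * h q) = k * phase_int h.
Proof.
move=> N1; rewrite /phase_int -RintegralZl//; last exact: outer_integrable.
by apply: eq_Rintegral => z _; rewrite RintegralZl//; exact: phase_class_slice.
Qed.

(** The Sobolev inner product integrates in tau first, while all identities
hold after integration in z at fixed tau. *)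
Lemma phase_int_swap h : phase_class h -> (forall tau, plane0 (fun z => h (z, tau))) ->
  phase_int h = \int[lebesgueR R]_tau plane_int (fun z => h (z, tau)).
Proof.
move=> Nh Hh; rewrite /phase_int /Rintegral; congr fine.
transitivity (\int[lebC]_z \int[@lebesgue_measure R]_tau (h (z, tau))%:E)%E.
  by apply: eq_integral => z _; rewrite inner_integralE.
rewrite (Fubini (phase_class_integrable Nh)); apply: eq_integral => tau _.
by rewrite /plane_int /Rintegral fineK//; apply: integrable_fin_num => //; exact: (plane0_integrable (Hh tau)).
Qed.

Lemma phase_int_ge0 h : phase_class h -> (forall tau, plane0 (fun z => h (z, tau))) ->
  (forall tau, 0 <= plane_int (fun z => h (z, tau))) -> 0 <= phase_int h.
Proof. by move=> Nh Hh h0; rewrite phase_int_swap//; exact: Rintegral_ge0. Qed.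

End Iterated.

(** * Sobolev weights *)

Section WeightBounds.
Variable R : realType.

Lemma japanese_ge0 (tau : R) : 0 <= japanese tau.
Proof. by rewrite ltW// japanese_gt0. Qed.

Definition wt (s tau : R) : R := japanese tau `^ s.

Lemma wt_ge0 s tau : 0 <= wt s tau.
Proof. exact: powR_ge0. Qed.

Lemma wtD s r tau : wt (s + r) tau = wt s tau * wt r tau.
Proof. by rewrite /wt powRD// (gt_eqF (japanese_gt0 tau)) implybT. Qed.

Lemma wt_le_exp (s : R) : exists n, forall tau, wt s tau <= japanese tau ^+ n.
Proof.
exists (Num.truncn s).+1 => tau.
rewrite -powR_mulrn ?japanese_ge0// /wt ler_powR ?japanese_ge1//.
exact: ltW (truncnS_gt s).
Qed.

Lemma measurable_wt s : measurable_fun setT (wt s : measurableTypeR R -> R).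
Proof.
apply: (measurableT_comp (measurable_powR s)).
exact: continuous_measurable_fun (@continuous_japanese R).
Qed.

Lemma low_frequency (e tau : R) : `|tau| <= 1 -> wt e tau <= 2 `^ `|e|.
Proof.
move=> t1.
have j2 : japanese tau <= 2.
  by rewrite /japanese -real_normK ?num_real// [leRHS](_ : 2 = 1 + 1 ^+ 2) ?lerD2l ?lerXn2r ?nnegrE//; ring.
apply: (@le_trans _ _ (japanese tau `^ `|e|)).
  by rewrite /wt ler_powR ?japanese_ge1// ler_norm.
by rewrite ge0_ler_powR ?nnegrE// japanese_ge0.
Qed.

(** The number om = |tau|^(1/m) satisfies om^(k-1) = (tau^2)^((k-1)/(2m)),
which the Sobolev weight of the same order dominates. *)
Lemma high_frequency (m k : nat) (tau : R) : (0 < m)%N -> (0 < k)%N -> 1 <= `|tau| ->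
  exists om, [/\ 1 <= om, om ^+ m = `|tau| &
    om ^+ k.-1 <= wt ((k%:R - 1) / (2 * m%:R)) tau].
Proof.
move=> m0 k0 t1; exists (`|tau| `^ (m%:R)^-1); split.
- by rewrite -(powRr0 `|tau|) ler_powR// invr_ge0.
- by rewrite -powR_mulrn ?powR_ge0// -powRrM mulVf ?pnatr_eq0 -?lt0n// powRr1.
have km : k.-1%:R = k%:R - 1 :> R by rewrite -[in RHS](prednK k0) -natr1 addrK.
rewrite -powR_mulrn ?powR_ge0// -powRrM km.
have -> : (m%:R)^-1 * (k%:R - 1) = 2%:R * ((k%:R - 1) / (2 * m%:R)) :> R.
  by field; rewrite pnatr_eq0 -lt0n.
rewrite powRrM powR_mulrn// real_normK ?num_real//.
rewrite ge0_ler_powR ?nnegrE ?sqr_ge0//.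
- by rewrite divr_ge0 ?mulr_ge0// -km.
- exact: japanese_ge0.
by rewrite /japanese lerDr.
Qed.

End WeightBounds.

Section Sobolev.
Variable R : realType.
Local Notation E := ((R * R) * R)%type.
Variable K : set E.
Hypothesis compactK : compact K.

Definition hs_density (s : R) (u w : E -> R[i]) (q : (R * R) * R) : R := wt s q.2 * inner2 q.2 u w q.1.

Lemma hat_decay n u : rapidC K u -> exists C, forall tau z,
  japanese tau ^+ n * `|hatRe tau u z| <= C /\ japanese tau ^+ n * `|hatIm tau u z| <= C.
Proof.
move=> [ra rb]; have [C1 h1] := decay compactK n ra; have [C2 h2] := decay compactK n rb.
exists (C1 + C2) => tau z; have [c1 s1] := h1 tau z; have [c2 s2] := h2 tau z.
have j0 : 0 <= japanese tau ^+ n by rewrite exprn_ge0// ltW// japanese_gt0.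
split.
  apply: (@le_trans _ _ (japanese tau ^+ n * (`|cosT tau (reC u) z| + `|sinT tau (imC u) z|))).
    by rewrite ler_wpM2l// ler_normD.
  by rewrite mulrDr lerD.
apply: (@le_trans _ _ (japanese tau ^+ n * (`|cosT tau (imC u) z| + `|sinT tau (reC u) z|))).
  by rewrite ler_wpM2l// ler_normB.
by rewrite mulrDr addrC lerD.
Qed.

(** The first transform is rapidly decreasing, the second merely bounded; the
decay of the first absorbs the polynomial weight and one more power of
1 + tau^2. *)
Lemma hs_phase_class s u w : rapidC K u -> rapidC K w -> phase_class (hs_density s u w).
Proof.
move=> ru rw; have [[ua _] [ub _]] := (ru, ru); have [[wa wb] _] := (rw, rw).
have {}ub : rapid K (imC u) by case: ru.
have mP v : rapidC K v -> measurable_fun setT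
    (fun q : (measurableTypeR R * measurableTypeR R) * measurableTypeR R => hatRe q.2 v q.1).
  move=> [/rapid_C0K ca /rapid_C0K cb].
  exact: measurable_funD (measurable_cosT compactK ca) (measurable_sinT compactK cb).
have mQ v : rapidC K v -> measurable_fun setT
    (fun q : (measurableTypeR R * measurableTypeR R) * measurableTypeR R => hatIm q.2 v q.1).
  move=> [/rapid_C0K ca /rapid_C0K cb].
  exact: measurable_funB (measurable_cosT compactK cb) (measurable_sinT compactK ca).
split.
  apply: measurable_funM.
    exact: (measurableT_comp (measurable_wt s) measurable_snd).
  apply: measurable_funD; apply: measurable_funM; [exact: mP|exact: mP|exact: mQ|exact: mQ].
have [n wn] := wt_le_exp s.
have [C hC] := hat_decay n.+1 ru; have [D hD] := hat_decay 0 rw.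
have [M [B [M0 [_ [za _]]]]] := dominated compactK (rapid_C0K ua).
have [M' [B' [M0' [_ [zb _]]]]] := dominated compactK (rapid_C0K ub).
exists (M + M'), (2 * (C * D)) => z tau; split.
  have [c1 c2] := hC tau z; have [d1 d2] := hD tau z.
  rewrite !expr0 !mul1r in d1 d2.
  have j0 : 0 < japanese tau := japanese_gt0 tau.
  have jn : 0 <= japanese tau ^+ n.+1 by rewrite exprn_ge0// ltW.
  rewrite /hs_density /= /japaneseV ler_pdivlMr// normrM ger0_norm ?wt_ge0//.
  apply: (@le_trans _ _ (japanese tau ^+ n.+1 * (`|hatRe tau u z| * `|hatRe tau w z|
    + `|hatIm tau u z| * `|hatIm tau w z|))).
    rewrite mulrAC exprSr ler_pM//.
    - by rewrite mulr_ge0 ?wt_ge0// ltW.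
    - by rewrite ler_wpM2r// ltW.
    - by rewrite /inner2 -!normrM ler_normD.
  rewrite (_ : 2 * (C * D) = C * D + C * D); last by ring.
  by rewrite mulrDr !mulrA; apply: lerD; apply: ler_pM => //; rewrite mulr_ge0.
move=> zM; rewrite /hs_density /= /inner2.
have z1 t : reC u (z, t) = 0.
  by apply: za => h; apply: zM; apply: box_le h; rewrite lerDl.
have z2 t : imC u (z, t) = 0.
  by apply: zb => h; apply: zM; apply: box_le h; rewrite lerDr.
by rewrite /hatRe /hatIm /cosT /sinT !(fiber_off _ z1) !(fiber_off _ z2) addr0 subr0 !mul0r addr0 mulr0.
Qed.

Lemma hs_plane0 s u w tau : rapidC K u -> rapidC K w -> plane0 (fun z => hs_density s u w (z, tau)).
Proof. by move=> ru rw; exact: (plane0Z (wt s tau) (plane0_inner2 compactK tau ru rw)). Qed.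

Lemma hs_plane_int s u w tau : rapidC K u -> rapidC K w ->
  plane_int (fun z => hs_density s u w (z, tau)) = wt s tau * plane_int (inner2 tau u w).
Proof. by move=> ru rw; rewrite /hs_density /= plane_intZ//; exact: (plane0_inner2 compactK tau ru rw). Qed.

Lemma Re_innerHs s u w : rapidC K u -> rapidC K w ->
  complex.Re (innerHs s u w) = phase_int (hs_density s u w).
Proof.
move=> [/rapid_C0K ua /rapid_C0K ub] [/rapid_C0K wa /rapid_C0K wb].
transitivity (\int[lebesgueC R]_z \int[lebesgueR R]_tau complex.Re
  (((1 + tau ^+ 2) `^ s)%:C * fourier_t u z tau * (fourier_t w z tau)^*)); first by [].
rewrite /phase_int; apply: eq_Rintegral => z _; apply: eq_Rintegral => tau _.
rewrite (fourierE compactK z tau ua ub) (fourierE compactK z tau wa wb) /hs_density /inner2 /=.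
rewrite /wt /japanese; ring.
Qed.

Lemma normHs2_phase s u : rapidC K u -> normHs2 s u = phase_int (hs_density s u u).
Proof. by move=> ru; exact: Re_innerHs. Qed.

Lemma normHs2_ge0 s u : rapidC K u -> 0 <= normHs2 s u.
Proof.
move=> ru; rewrite (normHs2_phase s ru); apply: phase_int_ge0 => [|tau|tau].
- exact: (hs_phase_class s ru ru).
- exact: (hs_plane0 s tau ru ru).
- by rewrite (hs_plane_int s tau ru ru) mulr_ge0 ?wt_ge0//; apply: plane_int_ge0 => z; exact: mod2_ge0.
Qed.

Lemma sum_frequencies s p v a b : rapidC K p -> rapidC K v -> rapidC K a -> rapidC K b ->
  (forall tau, plane_int (inner2 tau p v) = - (plane_int (mod2 tau a) + plane_int (mod2 tau b))) ->
  complex.Re (innerHs s p v) = - (normHs2 s a + normHs2 s b).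
Proof.
move=> rp rv ra rb e.
rewrite (normHs2_phase s ra) (normHs2_phase s rb) (Re_innerHs s rp rv).
apply/eqP; rewrite -addr_eq0; apply/eqP.
have N1 := hs_phase_class s rp rv; have N2 := hs_phase_class s ra ra; have N3 := hs_phase_class s rb rb.
have T1 tau := hs_plane0 s tau rp rv; have T2 tau := hs_plane0 s tau ra ra.
have T3 tau := hs_plane0 s tau rb rb.
have e2 := phase_intD N2 N3.
have e1 := phase_intD N1 (phase_classD N2 N3).
have e0 := phase_int_swap (phase_classD N1 (phase_classD N2 N3))
  (fun tau => plane0D (T1 tau) (plane0D (T2 tau) (T3 tau))).
rewrite -[X in _ + X = _]e2 -[LHS]e1 [LHS]e0.
rewrite /Rintegral (eq_integral (fun _ => 0%E)) ?integral0// => tau _.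
rewrite (plane_intD (T1 tau) (plane0D (T2 tau) (T3 tau))) (plane_intD (T2 tau) (T3 tau)).
rewrite (hs_plane_int s tau rp rv) (hs_plane_int s tau ra ra) (hs_plane_int s tau rb rb).
by rewrite e mulrN mulrDr addNr.
Qed.

Lemma compare_frequencies s1 s s2 x y v a b : rapidC K v -> rapidC K a -> rapidC K b ->
  (forall tau, wt s1 tau * plane_int (mod2 tau v) <=
    x * (wt s tau * plane_int (mod2 tau a) + wt s tau * plane_int (mod2 tau b)) +
    y * (wt s2 tau * plane_int (mod2 tau v))) ->
  normHs2 s1 v <= x * (normHs2 s a + normHs2 s b) + y * normHs2 s2 v.
Proof.
move=> rv ra rb e.
rewrite (normHs2_phase s ra) (normHs2_phase s rb) (normHs2_phase s1 rv) (normHs2_phase s2 rv).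
have N1 := hs_phase_class s1 rv rv; have N2 := hs_phase_class s ra ra; have N3 := hs_phase_class s rb rb.
have N4 := hs_phase_class s2 rv rv.
have T1 tau := hs_plane0 s1 tau rv rv; have T2 tau := hs_plane0 s tau ra ra.
have T3 tau := hs_plane0 s tau rb rb; have T4 tau := hs_plane0 s2 tau rv rv.
have N23 := phase_classZ x (phase_classD N2 N3); have N44 := phase_classZ y N4; have N11 := phase_classZ (-1) N1.
have H23 tau := plane0Z x (plane0D (T2 tau) (T3 tau)); have H44 tau := plane0Z y (T4 tau).
have H11 tau := plane0Z (-1) (T1 tau).
have e1 := phase_intD N2 N3; have e2 := phase_intZ x (phase_classD N2 N3); have e3 := phase_intZ y N4.
have e4 := phase_intZ (-1) N1; have e5 := phase_intD N23 N44; have e6 := phase_intD (phase_classD N23 N44) N11.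
rewrite -subr_ge0 -mulN1r -[X in _ <= _ + X]e4 -[X in _ <= _ * X + _ + _]e1.
rewrite -[X in _ <= X + _ + _]e2 -[X in _ <= _ + X + _]e3 -[X in _ <= X + _]e5 -[X in _ <= X]e6.
apply: phase_int_ge0 => [|tau|tau]; first exact: (phase_classD (phase_classD N23 N44) N11).
  exact: (plane0D (plane0D (H23 tau) (H44 tau)) (H11 tau)).
rewrite (plane_intD (plane0D (H23 tau) (H44 tau)) (H11 tau)) (plane_intD (H23 tau) (H44 tau)).
rewrite (plane_intZ x (plane0D (T2 tau) (T3 tau))) (plane_intZ y (T4 tau))
  (plane_intZ (-1) (T1 tau)) (plane_intD (T2 tau) (T3 tau)).
rewrite (hs_plane_int s tau ra ra) (hs_plane_int s tau rb rb) (hs_plane_int s1 tau rv rv) (hs_plane_int s2 tau rv rv).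
by rewrite mulN1r subr_ge0; exact: e.
Qed.

End Sobolev.

(** * The Sobolev estimate *)

Section MainEstimate.
Variable R : realType.
Local Notation E := ((R * R) * R)%type.
Variables (U : set (R * R)) (K : set E).
Hypothesis openU : open U.
Hypothesis compactK : compact K.
Hypothesis KU : forall p, K p -> U p.1.
Variable F : R * R -> R.
Hypothesis smoothF : smooth_on U F.
Variables (m k : nat) (c C eps : R).
Hypotheses (m0 : (0 < m)%N) (k0 : (0 < k)%N) (c0 : 0 < c) (cC : c <= C).
Hypothesis eps1 : eps = 1 \/ eps = -1.
Hypothesis Ksmall : forall p, K p -> rsq p.1 <= 2.
Hypothesis Klap : forall p, K p ->
  4 * c * rsq p.1 ^+ m.-1 <= eps * lap F p.1 <= 4 * C * rsq p.1 ^+ m.-1.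

Let closedK : closed K.
Proof. by apply: compact_closed => //; exact: norm_hausdorff. Qed.

Local Notation kappa := ((k%:R - 1) / (2 * m%:R) : R).

Lemma Re_norm_ge (x : R[i]) : - complex.Re x <= complex.Re `|x|.
Proof.
case: x => a b; rewrite normc_def /=.
rewrite (@le_trans _ _ `|a|)//; first by rewrite -normrN ler_norm.
by rewrite -sqrtr_sqr ler_wsqrtr// lerDl sqr_ge0.
Qed.

(** For |tau| >= 1 the loss om^(k-1) of [key_estimate] is compensated by the
weight of order - (k-1)/(2m); for |tau| <= 1 weights of different orders
differ by bounded factors. *)
Lemma frequency_estimate s N0 tau v : smoothKC K v ->
  wt (s - kappa) tau * plane_int (mod2 tau v) <=
  keyconst m k c C * (wt s tau * plane_int (mod2 tau (opLbar F v)) +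
    wt s tau * plane_int (mod2 tau (fun p => (toC p.1)^* ^+ k * opL F v p))) +
  2 `^ `|s - kappa + N0| * (wt (- N0) tau * plane_int (mod2 tau v)).
Proof.
move=> tv.
have nn u : 0 <= plane_int (mod2 tau u) by apply: plane_int_ge0 => z; exact: mod2_ge0.
have C0 : 0 <= C by rewrite ltW// (lt_le_trans c0).
have kc0 : 0 <= keyconst m k c C.
  by rewrite /keyconst addr_ge0// divr_ge0 ?wconst_ge0// ltW.
have [t1|/ltW t1] := leP `|tau| 1.
  rewrite ler_wpDl//.
    by rewrite mulr_ge0// addr_ge0// mulr_ge0 ?wt_ge0.
  rewrite mulrA ler_wpM2r//.
  have -> : s - kappa = (s - kappa + N0) + - N0 by rewrite addrK.
  by rewrite wtD addrK ler_wpM2r ?wt_ge0// low_frequency.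
rewrite ler_wpDr//.
  by rewrite mulr_ge0 ?powR_ge0// mulr_ge0 ?wt_ge0.
have [om [om1 omt omk]] := high_frequency m0 k0 t1.
have key := key_estimate openU compactK KU smoothF m0 k0 c0 cC eps1 Ksmall Klap tv om1 omt.
have wk : wt (- kappa) tau * wt kappa tau = 1 by rewrite -wtD addNr /wt powRr0.
have W0 := wt_ge0 (- kappa) tau; have Ws := wt_ge0 s tau.
rewrite -mulrDr wtD.
move: key (nn (opLbar F v)) (nn (fun p => (toC p.1)^* ^+ k * opL F v p)).
move: (plane_int (mod2 tau v)) (plane_int (mod2 tau (opLbar F v)))
  (plane_int (mod2 tau (fun p => (toC p.1)^* ^+ k * opL F v p))) => a x y key x0 y0.
rewrite -mulrA [leRHS]mulrCA ler_wpM2l//.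
apply: (@le_trans _ _ (wt (- kappa) tau * (keyconst m k c C * wt kappa tau * (x + y)))).
  rewrite ler_wpM2l//; apply: (le_trans key).
  by rewrite ler_wpM2r ?addr_ge0// ler_wpM2l.
by rewrite -mulrA mulrCA [X in _ * X <= _]mulrA wk mul1r.
Qed.

Lemma sobolev_estimate s N0 v : smoothKC K v ->
  normHs2 (s - kappa) v + normHs2 s (opLbar F v)
  + normHs2 s (fun p => (toC p.1)^* ^+ k * opL F v p) <=
  (1 + keyconst m k c C + 2 `^ `|s - kappa + N0|) *
    (complex.Re `|innerHs s (opP k F v) v| + normHs2 (- N0) v).
Proof.
move=> tv; have rv := rapid1C_rapidC (smoothKC_rapid1C closedK tv).
have rLb := rapid1C_rapidC (rapid1C_opLbar closedK KU smoothF tv).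
have rL := rapid1C_rapidC (rapid1C_opL closedK KU smoothF tv).
have rZ := rapidC_zbarX compactK KU k rL.
have rP := rapidC_opP openU closedK KU smoothF k tv.
set kc := keyconst m k c C; set lc := 2 `^ _.
have lc0 : 0 <= lc := powR_ge0 _ _.
have C0 : 0 <= C by rewrite ltW// (lt_le_trans c0).
have kc0 : 0 <= kc by rewrite /kc /keyconst addr_ge0// divr_ge0 ?wconst_ge0// ltW.
have energy := sum_frequencies compactK s rP rv rLb rZ
  (fun tau => energy_identity openU compactK KU smoothF tau k tv).
have main := compare_frequencies compactK rv rLb rZ
  (fun tau => frequency_estimate s N0 tau tv).
have n0 := normHs2_ge0 compactK (- N0) rv.
move: energy main n0.
move: (normHs2 s (opLbar F v)) (normHs2 s (fun p => (toC p.1)^* ^+ k * opL F v p))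
  (normHs2 (s - kappa) v) (normHs2 (- N0) v).
move=> a b n B energy main n0.
have A0 : 0 <= complex.Re `|innerHs s (opP k F v) v|.
  by case: (innerHs _ _ _) => x y; rewrite normc_def /= sqrtr_ge0.
have X0 : a + b <= complex.Re `|innerHs s (opP k F v) v|.
  by apply: le_trans (Re_norm_ge _); rewrite energy opprK.
move: main X0 A0; move: (complex.Re _) => A main X0 A0.
have h1 := ler_wpM2l kc0 X0; have h2 : 0 <= lc * A := mulr_ge0 lc0 A0.
have h3 : 0 <= kc * B := mulr_ge0 kc0 n0.
rewrite -/kc -/lc in main.
move: kc lc {kc0 lc0} h1 h2 h3 main => kc lc h1 h2 h3 main.
have -> : (1 + kc + lc) * (A + B) = A + B + kc * A + kc * B + lc * A + lc * B by ring.
lra.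
Qed.

End MainEstimate.

(** * The sign of the curvature *)

Section Laplacian.
Variable R : realType.
Variable U : set (R * R).
Hypothesis openU : open U.
Variable F : R * R -> R.
Hypothesis smoothF : smooth_on U F.

Lemma derivable_D (u v z : R * R) : U z -> derivable ('D_u F) z v.
Proof. by move=> Uz; apply: diff_derivable; exact: (((smoothF 2).2 u).1 z Uz). Qed.

Lemma schwarz_smooth (z : R * R) : U z -> 'D_e2 ('D_e1 F) z = 'D_e1 ('D_e2 F) z.
Proof.
move=> Uz; apply: (schwarz openU Uz).
- by move=> q Uq; apply: diff_derivable; exact: (smoothF 1).1.
- by move=> q Uq; apply: diff_derivable; exact: (smoothF 1).1.
- by move=> q Uq; exact: derivable_D.
- by move=> q Uq; exact: derivable_D.
- exact: (((smoothF 2).2 e1).2 e2 z Uz).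
- exact: (((smoothF 2).2 e2).2 e1 z Uz).
Qed.

Lemma derive_half (u v : R * R) (c : R) z : U z ->
  'D_v (fun z => 'D_u F z * c) z = 'D_v ('D_u F) z * c.
Proof.
move=> Uz; rewrite -[RHS]mulrC.
have -> : (fun z => 'D_u F z * c) = c \*: ('D_u F).
  by apply/funext => q; rewrite /= mulrC.
by rewrite deriveZ//; exact: derivable_D.
Qed.

Lemma dzbar_dz_ofreal (z : R * R) : U z ->
  dzbar (dz (ofreal F)) z = (lap F z / 4)%:C.
Proof.
move=> Uz; rewrite dzbarE.
have -> : reC (dz (ofreal F)) = (fun z => 'D_e1 F z * 2^-1).
  by apply/funext => q; rewrite /reC dz_ofreal.
have -> : imC (dz (ofreal F)) = (fun z => 'D_e2 F z * - 2^-1).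
  by apply/funext => q; rewrite /imC dz_ofreal /= mulrN mulNr.
rewrite !derive_half// schwarz_smooth// /lap.
generalize ('D_e1 ('D_e1 F) z) ('D_e2 ('D_e2 F) z) ('D_e1 ('D_e2 F) z) => a b d.
by congr (_ +i* _); field.
Qed.

End Laplacian.

Section Curvature.
Variable R : realType.
Variable U : set (R * R).
Hypothesis openU : open U.
Variable F : R * R -> R.
Hypothesis smoothF : smooth_on U F.
Variable m : nat.
Variable g : R * R -> R[i].
Hypothesis Fzzbar : forall z, U z ->
  dzbar (dz (ofreal F)) z = `|toC z| ^+ (2 * (m - 1)) * g z.

Lemma lap_coefficient (z : R * R) : U z ->
  lap F z = 4 * (rsq z ^+ m.-1 * complex.Re (g z)) /\
  rsq z ^+ m.-1 * complex.Im (g z) = 0.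
Proof.
move=> Uz; have := Fzzbar Uz.
rewrite (dzbar_dz_ofreal openU smoothF Uz) normC_toC subn1.
case: (g z) => a b e.
have /= := congr1 (@complex.Re R) e; have /= := congr1 (@complex.Im R) e.
rewrite !mul0r subr0 addr0 => eb ea; split=> //.
by rewrite -ea; field.
Qed.

Hypothesis continuous_img : {for (0, 0), continuous (fun z => complex.Im (g z))}.
Hypothesis continuous_reg : {for (0, 0), continuous (fun z => complex.Re (g z))}.
Hypothesis U0 : U (0, 0).
Hypothesis g0 : g (0, 0) != 0.

(** Since F_(z zbar) is real, Im g vanishes wherever z is nonzero; if it did
not vanish at 0 it would not vanish at nearby points of the real axis. *)
Lemma coefficient_real : complex.Im (g (0, 0)) = 0.
Proof.
apply/eqP; apply/negPn/negP => n0.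
have /nbhs_ballP[e /= e0 he] : nbhs ((0, 0) : R * R) [set z | complex.Im (g z) != 0 /\ U z].
  apply: filterI; last exact: open_nbhs_nbhs.
  have nz : nbhs (complex.Im (g (0, 0))) [set x : R | x != 0].
    by apply: open_nbhs_nbhs; split=> //; exact: open_neq.
  have cg : continuous_at (0, 0) (fun z => complex.Im (g z)) := continuous_img.
  exact: (cg _ nz).
(* a nonzero point of the ball, where |z|^(2(m-1)) can be divided out *)
have [|gz Uz] := he (e / 2, 0).
  split=> /=; last exact: ballxx.
  by rewrite /ball /= sub0r normrN gtr0_norm ?divr_gt0// ltr_pdivrMr// ltr_pMr// ltr1n.
have [_ /eqP] := lap_coefficient Uz.
by rewrite mulf_eq0 (negPf gz) orbF expf_eq0 /rsq /= expr0n addr0 sqrf_eq0 (gt_eqF (divr_gt0 e0 _)) ?andbF.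
Qed.

Lemma curvature_sign : exists eps c C r : R,
  [/\ eps = 1 \/ eps = -1, 0 < c <= C, 0 < r <= 1 &
    forall z, ball (0, 0) r z -> U z /\
      4 * c * rsq z ^+ m.-1 <= eps * lap F z <= 4 * C * rsq z ^+ m.-1].
Proof.
pose a := complex.Re (g (0, 0)).
have a0 : a != 0.
  by apply: contraNneq g0 => ea; move: ea coefficient_real; rewrite /a; case: (g _) => x y /= -> ->.
have na : 0 < `|a| / 2 by rewrite divr_gt0// normr_gt0.
have /nbhs_ballP[e /= e0 he] : nbhs ((0, 0) : R * R) [set z | ball a (`|a| / 2) (complex.Re (g z)) /\ U z].
  apply: filterI; last exact: open_nbhs_nbhs.
  by apply: continuous_reg; exact: nbhsx_ballx.
(* On the ball Re g stays within |a| / 2 of its value a at 0. *)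
exists (Num.sg a), (`|a| / 2), (2 * `|a|), (Num.min e 1); split.
- by case: (sgrP a) a0 => // _; [left|right].
- by rewrite na /=; lra.
- by rewrite lt_min e0 ltr01 ge_min lexx orbT.
move=> z bz; have [] := he z (le_ball _ bz); first by rewrite ge_min lexx.
move=> ga Uz; split=> //; rewrite (lap_coefficient Uz).1.
have r0 : 0 <= rsq z ^+ m.-1 by rewrite exprn_ge0// addr_ge0// sqr_ge0.
move: ga; rewrite /ball /=; move: (complex.Re (g z)) (rsq z ^+ m.-1) r0 => b q q0 ab.
have [hl hr] : `|a| / 2 <= Num.sg a * b /\ Num.sg a * b <= 2 * `|a|.
  move: ab; rewrite ltr_norml => /andP[h1 h2].
  case: (sgrP a) a0 h1 h2 => // a0' _ h1 h2.
    by rewrite mul1r; split; lra.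
  by rewrite mulN1r; split; lra.
have -> : Num.sg a * (4 * (q * b)) = 4 * q * (Num.sg a * b) by ring.
by rewrite ![4 * _ * q]mulrAC !ler_wpM2l// mulr_ge0.
Qed.

End Curvature.

Theorem proposition1p1 (R : realType) (m k : nat) (hm : (1 <= m)%N)
  (hk : (1 <= k)%N)
  (U : set (R * R)) (openU : open U) (U0 : U (0, 0))
  (F : R * R -> R) (smoothF : smooth_on U F)
  (g h : R * R -> R[i]) (smoothg : csmooth_on U g) (smoothh : csmooth_on U h)
  (Fzzbar : forall z, U z ->
     dzbar (dz (ofreal F)) z = `|toC z| ^+ (2 * (m - 1)) * g z)
  (Fz : forall z, U z ->
     dz (ofreal F) z = (toC z)^* * `|toC z| ^+ (2 * (m - 1)) * h z)
  (g0 : g (0, 0) != 0) (gU : forall z, U z -> g z != 0) :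
  exists V : set ((R * R) * R),
    [/\ open V, V ((0, 0), 0), V `<=` [set p | U p.1] &
      exists C : R -> R -> R,
        (forall N : R, 0 < N -> forall s0 : R,
           exists B : R, \forall s \near s0, `|C s N| <= B) /\
        (forall s N : R, 0 < N ->
           forall v : (R * R) * R -> R[i], test_function V v ->
             normHs2 (s - (k%:R - 1) / (2 * m%:R)) v
             + normHs2 s (opLbar F v)
             + normHs2 s (fun p => (toC p.1)^* ^+ k * opL F v p)
             <= C s N * (complex.Re `|innerHs s (opP k F v) v|
                         + normHs2 (- N) v))].
Proof.
have [eps [c [C [r [eps1 /andP[c0 cC] /andP[r0 r1] near0]]]]] := curvature_sign openU
  smoothF Fzzbar (smoothg.2 0 _ U0) (smoothg.1 0 _ U0) U0 g0.
exists [set p | ball ((0, 0) : R * R) r p.1]; split.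
- by apply: (open_comp (f := fst)); [move=> p _; exact: cvg_fst|exact: ball_open].
- exact: ballxx.
- by move=> p /near0[].
(* continuous in s, hence locally bounded *)
exists (fun s N => 1 + keyconst m k c C + 2 `^ `|s - (k%:R - 1) / (2 * m%:R) + N|); split.
  move=> N _ s0; exists (`|1 + keyconst m k c C| + 2 `^ (`|s0 - (k%:R - 1) / (2 * m%:R) + N| + 1)).
  near=> s.
  rewrite (le_trans (ler_normD _ _))// lerD2l (ger0_norm (powR_ge0 _ _)) ler_powR ?ler1n//.
  set x := (k%:R - 1) / _.
  have -> : s - x + N = (s0 - x + N) + (s - s0) by ring.
  rewrite (le_trans (ler_normD _ _))// lerD2l distrC.
  by near: s; apply/nbhs_ballP; exists 1 => //= y; exact: ltW.
move=> s N _ v [sv cv vV].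
pose K := closure [set p | v p != 0].
have K0 p : ~ K p -> v p = 0.
  by move=> Kp; apply/eqP/negPn/negP => vp; apply: Kp; exact: subset_closure.
apply: (sobolev_estimate openU cv _ smoothF hm hk c0 cC eps1 _ _ s N).
- by move=> p /vV/near0[].
- move=> p /vV[/= b1 b2]; rewrite /rsq.
  have sq1 (x : R) : ball 0 r x -> x ^+ 2 <= 1.
    rewrite /ball /= sub0r normrN => /ltW xr.
    by rewrite -real_normK ?num_real// expr_le1// (le_trans xr).
  by have := lerD (sq1 _ b1) (sq1 _ b2).
- by move=> p /vV/near0[].
split; split.
- exact: sv.1.
- by move=> p /K0; rewrite /reC => ->.
- exact: sv.2.
- by move=> p /K0; rewrite /imC => ->.
Unshelve. all: by end_near. Qed.
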